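(* Let $k$ and $\delta$ be integers with $k\geqslant 1$. As $n\to \infty$ (through integers), $$\frac{p^k(n+\delta)\,p^k(n-\delta)}{p^k(n)^2} = 1 -\frac{\left(1-\frac 1{k+1} \right)a_k \delta^2}{(n+h_k)^{2-1/(k+1)}} +\frac{\left(\frac 32 -\frac 1{k+1} \right) \delta^2}{(n+h_k)^{2}}+O\left( \frac{1}{n^{2+1/(k+1)}}\right),$$ where the implied constant depends only on $k$ and $\delta$.
   Context: For a positive integer $k$, $p^k(n)$ denotes the number of partitions of the integer $n$ into (positive) $k$th powers, so $\sum_{n=0}^\infty p^k(n) q^n = \prod_{m=1}^\infty \frac 1{1-q^{m^k}}$; $p^k(n)^2$ means $(p^k(n))^2$. With $\Gamma$ the gamma function and $\zeta$ the Riemann zeta function, set $c_k:=\frac 1k \Gamma(1+\frac 1k)\zeta(1+\frac 1k)$, $a_k:=c_k^{k/(k+1)}$ and $h_k:=\frac{\zeta(-k)}2$. *)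

(* Defs.v *)
From Stdlib Require Import Reals ZArith.
From Coquelicot Require Import Coquelicot.
From mathcomp Require Import all_boot.

Set Implicit Arguments.
Unset Strict Implicit.
Unset Printing Implicit Defensive.

Local Open Scope R_scope.

(* A partition of [n] into positive [k]th powers is given by the multiplicity
   [f i] of each part [(i + 1)^k].  For [k >= 1] a part [m^k] of a partition of
   [n] satisfies [m <= m^k <= n] and occurs at most [n] times, so the index and
   multiplicity bounds lose nothing. *)
Definition kth_power_partitions (k n : nat) : {set {ffun 'I_n -> 'I_n.+1}} :=
  [set f : {ffun 'I_n -> 'I_n.+1} |
    (\sum_(i < n) f i * i.+1 ^ k == n)%N].

(* Negative integers have no partition. *)
Definition pk (k : nat) (n : Z) : nat :=
  if Z.ltb n 0 then 0%N else #|kth_power_partitions k (Z.to_nat n)|.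

Definition Gamma (x : R) : R :=
  RInt_gen (fun t => Rpower t (x - 1) * exp (- t))
           (at_right 0) (Rbar_locally p_infty).

Definition Cexp (z : C) : C :=
  (exp (Re z) * cos (Im z), exp (Re z) * sin (Im z)).

Definition Cpower_nat (m : nat) (s : C) : C :=
  Cexp (Cmult s (RtoC (ln (INR m)))).

Definition analytic_at (f : C -> C) (s0 : C) : Prop :=
  exists (r : R) (a : nat -> C), 0 < r /\
    forall s : C, Cmod (Cminus s s0) < r ->
      @is_pseries C_AbsRing C_NormedModule a (Cminus s s0) (f s).

(* [zeta] is the analytic continuation to [C \ {1}] of the Dirichlet series
   [sum_(m >= 1) m^(-s)], [Re s > 1].  By the identity theorem this determines
   [zeta] everywhere except at the irrelevant point [1]. *)
Definition is_Riemann_zeta (zeta : C -> C) : Prop :=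
  (forall s : C, 1 < Re s ->
     @is_series C_AbsRing C_NormedModule
       (fun m : nat => Cpower_nat m.+1 (Copp s)) (zeta s)) /\
  (forall s : C, s <> RtoC 1 -> analytic_at zeta s).

(* The zeta function takes real values at the real arguments used below, so
   [Re] only serves as a cast from [C] to [R]. *)
Definition c_coef (zeta : C -> C) (k : nat) : R :=
  / INR k * Gamma (1 + / INR k) * Re (zeta (RtoC (1 + / INR k))).

Definition a_coef (zeta : C -> C) (k : nat) : R :=
  Rpower (c_coef zeta k) (INR k / (INR k + 1)).

Definition h_coef (zeta : C -> C) (k : nat) : R :=
  Re (zeta (RtoC (- INR k))) / 2.

(* Main.v *)
(** Write [x = X ^ -k] and [n = c X ^ (k + 1)], so that [x] is the leading-order
    saddle point of [F z * exp (n z)], where [F z = sum p(n) exp (- n z)].  On the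
    line [z = x + i y] the ratio [p (n + d) / p n] is [E (exp (d z))] for the
    normalised complex weight [F z * exp (n z) dy], hence
    [p (n + d) p (n - d) / p n ^ 2 = E (exp (d u)) E (exp (- d u))] with
    [u = i y], which is [1 + d ^ 2 (E u ^ 2 - (E u) ^ 2)] up to a negligible error.

    The moments [E u ^ j] need no Gaussian integrals: integrating the derivative of
    [u ^ j F z exp (n z)] over a period gives linear relations between them, whose
    coefficients are the derivatives of [log F] at [x].  Those follow from
    Euler-Maclaurin summation of [t / (exp t - 1)] and its derivatives over
    [t = (m / X) ^ k].  The relations are solved asymptotically using only
    an a priori bound on [F z / F x] and a lower bound on the total mass.

    Away from the real axis the bound on [F z / F x] reduces to a lower bound on
    [sum_(m <= X) sin (m ^ k y / 2) ^ 2]: the [k]th difference of [m ^ k y] with step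
    [d] is [k! d ^ k y], and when [k! y] is very close to [2 pi a] one uses
    [m = 1 mod k!].

    The shift by [h_k] changes the main terms by less than the error term, so the
    value of [zeta] at [- k] plays no role.  Only parts [m ^ k] with [m <= M] are
    kept, for some [M >= X ^ 3], so that all products and sums are finite. *)
Require Import Defs.
From Stdlib Require Import Reals ZArith Lra Lia Psatz.
From Coquelicot Require Import Coquelicot.
Local Open Scope R_scope.

(** * The function [t / (exp t - 1)] and its derivatives *)

(** The natural small parameter is [e = / sqrt X]. A shift [d] of [n] enters through
    [b = d * e ^ (2 * k + 1)], and the error allowed in the theorem has size
    [X ^ -(2 k + 3) = e ^ (4 k + 6)], the size of [b ^ 2 * e ^ 4]. So the variance is needed up to
    [O(e ^ 4)]: its leading term and one correction of order [e ^ 2]. Odd moments turn out to be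
    [O(e)], and this parity is what makes remainders of fifth order in [Y] sufficient. The exact
    saddle point is never computed. As [X] is fixed by [n = c * X ^ (k + 1)], the linear term of the
    exponent survives, but Euler-Maclaurin shows it to be [e / 2 + O(e ^ 3)], one more known
    coefficient in the relations between moments. These relations involve integrals over a whole
    period, so the weight must decay faster than any power of [Y] on all of it; this is what forces
    the study of the minor arcs. The shift by [h_k] is harmless because [1 / (k + 1) <= 1 / 2]:
    moving [n] by a constant in [n ^ -(2 - 1 / (k + 1))] costs [n ^ -(3 - 1 / (k + 1))], which is
    [O(n ^ -(2 + 1 / (k + 1)))]. *)

Fixpoint Ecoef (i n : nat) : R :=
  match i with
  | O => / INR (fact (S n))
  | S j => INR (S n) * Ecoef j (S n)
  end.

(** In this form the coefficients visibly decrease in [i]. Hence on [t >= 0] every derivative of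
    [(exp t - 1) / t] is dominated by the function itself, which puts all the ratios [Eratio i] in
    [[0, 1]]. *)
Lemma Ecoef_closed (i n : nat) : Ecoef i n = / (INR (fact n) * INR (n + i + 1)).
Proof.
revert n; induction i as [|i IH]; intros n.
- change (Ecoef 0 n) with (/ INR (fact (S n))).
  rewrite fact_simpl, mult_INR, Nat.add_0_r, Nat.add_1_r.
  now rewrite Rmult_comm.
- change (Ecoef (S i) n) with (INR (S n) * Ecoef i (S n)). rewrite IH, fact_simpl, mult_INR.
  replace (S n + i + 1)%nat with (n + S i + 1)%nat by lia.
  field. repeat split; try apply INR_fact_neq_0; apply not_0_INR; lia.
Qed.

Lemma Ecoef_pos (i n : nat) : 0 < Ecoef i n.
Proof.
rewrite Ecoef_closed. apply Rinv_0_lt_compat, Rmult_lt_0_compat.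
apply INR_fact_lt_0. apply lt_0_INR; lia.
Qed.

Lemma Ecoef_le (i n : nat) : Ecoef i n <= Ecoef 0 n.
Proof.
rewrite !Ecoef_closed. apply Rinv_le_contravar.
- apply Rmult_lt_0_compat. apply INR_fact_lt_0. apply lt_0_INR; lia.
- apply Rmult_le_compat_l. left; apply INR_fact_lt_0. apply le_INR; lia.
Qed.

Lemma CV_radius_Ecoef (i : nat) : CV_radius (Ecoef i) = p_infty.
Proof.
induction i as [|i IH].
- change (Ecoef 0) with (PS_decr_1 (fun n => / INR (fact n))).
  rewrite CV_radius_decr_1. apply CV_radius_infinite_DAlembert.
  + intros n. apply Rinv_neq_0_compat, INR_fact_neq_0.
  + apply is_lim_seq_ext with (fun n => / INR (S n)).
    * intros n. rewrite fact_simpl, mult_INR.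
      assert (0 < INR (S n)) by (apply lt_0_INR; lia).
      assert (0 < INR (fact n)) by apply INR_fact_lt_0.
      replace (/ (INR (S n) * INR (fact n)) / / INR (fact n)) with (/ INR (S n))
        by (field; lra).
      rewrite Rabs_pos_eq; [reflexivity|left; now apply Rinv_0_lt_compat].
    * apply (is_lim_seq_incr_1 (fun n => / INR n)).
      replace (Finite 0) with (Rbar_inv p_infty) by reflexivity.
      apply is_lim_seq_inv. apply is_lim_seq_INR. easy.
- change (Ecoef (S i)) with (PS_derive (Ecoef i)). now rewrite CV_radius_derive.
Qed.

(* [Efun i] is the [i]th derivative of [(exp t - 1) / t]. *)
Definition Efun (i : nat) (t : R) : R := PSeries (Ecoef i) t.

Lemma is_derive_Efun (i : nat) (t : R) : is_derive (Efun i) t (Efun (S i) t).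
Proof.
apply (is_derive_PSeries (Ecoef i)). now rewrite CV_radius_Ecoef.
Qed.

Lemma Efun0_exp (t : R) : exp t = 1 + t * Efun 0 t.
Proof.
rewrite exp_Reals, PSeries_decr_1.
- unfold Efun. replace (/ INR (fact 0)) with 1 by (simpl; lra). reflexivity.
- exists (exp t). apply is_exp_Reals.
Qed.

Lemma Efun0_at0 : Efun 0 0 = 1.
Proof. unfold Efun. rewrite PSeries_0. simpl. lra. Qed.

Lemma Efun0_pos (t : R) : 0 < Efun 0 t.
Proof.
destruct (Rtotal_order t 0) as [H|[H|H]].
- assert (exp t < 1) by (rewrite <- exp_0; now apply exp_increasing).
  rewrite Efun0_exp in H0. nra.
- rewrite H, Efun0_at0. lra.
- assert (1 < exp t) by (rewrite <- exp_0; now apply exp_increasing).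
  rewrite Efun0_exp in H0. nra.
Qed.

Lemma ex_series_Efun (i : nat) (t : R) : ex_series (fun n => Ecoef i n * t ^ n).
Proof.
apply ex_pseries_R. apply CV_radius_inside. now rewrite CV_radius_Ecoef.
Qed.

Lemma Series_nonneg (a : nat -> R) :
  (forall n, 0 <= a n) -> ex_series a -> 0 <= Series a.
Proof.
intros Ha Hex.
replace 0 with (Series (fun n => 0 * a n)) by (rewrite Series_scal_l; ring).
apply Series_le; [|easy]. intros n; specialize (Ha n); lra.
Qed.

Lemma Efun_bounds (i : nat) (t : R) : 0 <= t -> 0 <= Efun i t <= Efun 0 t.
Proof.
intros Ht. unfold Efun, PSeries. split.
- apply Series_nonneg; [|apply ex_series_Efun].
  intros n. apply Rmult_le_pos; [left; apply Ecoef_pos|now apply pow_le].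
- apply Series_le; [|apply ex_series_Efun].
  intros n; split.
  + apply Rmult_le_pos; [left; apply Ecoef_pos|now apply pow_le].
  + apply Rmult_le_compat_r; [now apply pow_le|apply Ecoef_le].
Qed.

(** All terms of the series are nonnegative, so a single one is a lower bound; its inverse gives
    [Hfun] the decay [t ^ -q] for every [q]. *)
Lemma Efun0_ge (q : nat) (t : R) : 0 <= t -> t ^ q / INR (fact (S q)) <= Efun 0 t.
Proof.
intros Ht. unfold Efun, PSeries.
assert (Hp : forall n, 0 <= Ecoef 0 n * t ^ n).
{ intros n. apply Rmult_le_pos; [left; apply Ecoef_pos|now apply pow_le]. }
rewrite (Series_incr_n _ (S q)); [|lia|apply ex_series_Efun].
assert (0 <= Series (fun n => Ecoef 0 (S q + n) * t ^ (S q + n))).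
{ apply Series_nonneg; [intros n; apply Hp|].
  apply (ex_series_incr_n (fun n => Ecoef 0 n * t ^ n)), ex_series_Efun. }
change (Init.Nat.pred (S q)) with q.
enough (t ^ q / INR (fact (S q)) <= sum_f_R0 (fun n => Ecoef 0 n * t ^ n) q) by lra.
destruct q as [|q].
- simpl. lra.
- rewrite tech5. assert (0 <= sum_f_R0 (fun n => Ecoef 0 n * t ^ n) q) by now apply cond_pos_sum.
  change (Ecoef 0 (S q)) with (/ INR (fact (S (S q)))). unfold Rdiv. lra.
Qed.

(* [Hfun t = t / (exp t - 1)], with value [1] at [0]. *)
Definition Hfun (t : R) : R := / Efun 0 t.

(** The logarithmic derivative of [Hfun] is [- Eratio 1], and the derivative of each ratio is a
    polynomial in such ratios. So every derivative of [Hfun] is [Hfun] times a factor bounded on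
    [t >= 0]. *)
Definition Eratio (i : nat) (t : R) : R := Efun i t * Hfun t.

Lemma Hfun_pos (t : R) : 0 < Hfun t.
Proof. apply Rinv_0_lt_compat, Efun0_pos. Qed.

Lemma is_derive_Hfun (t : R) : is_derive Hfun t (Hfun t * - Eratio 1 t).
Proof.
unfold Eratio, Hfun. pose proof (Efun0_pos t).
replace (/ Efun 0 t * - (Efun 1 t * / Efun 0 t)) with (- Efun 1 t / Efun 0 t ^ 2) by (field; lra).
apply is_derive_inv; [apply is_derive_Efun|lra].
Qed.

Lemma is_derive_Eratio (i : nat) (t : R) :
  is_derive (Eratio i) t (Eratio (S i) t + -1 * Eratio i t * Eratio 1 t).
Proof.
unfold Eratio at 1.
replace (Eratio (S i) t + -1 * Eratio i t * Eratio 1 t)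
  with (plus (mult (Efun (S i) t) (Hfun t)) (mult (Efun i t) (Hfun t * - Eratio 1 t)))
  by (unfold plus, mult, Eratio; simpl; ring).
apply (is_derive_mult (Efun i) Hfun). apply is_derive_Efun. apply is_derive_Hfun.
intros; apply Rmult_comm.
Qed.

Lemma Eratio_bounds (i : nat) (t : R) : 0 <= t -> 0 <= Eratio i t <= 1.
Proof.
intros Ht. destruct (Efun_bounds i t Ht). unfold Eratio, Hfun.
pose proof (Efun0_pos t). split.
- apply Rmult_le_pos; [lra|]. left; now apply Rinv_0_lt_compat.
- apply Rmult_le_reg_r with (Efun 0 t); [lra|]. rewrite Rmult_assoc, Rinv_l; lra.
Qed.

Lemma Hfun_le_pow (q : nat) (t : R) : 0 < t -> Hfun t <= INR (fact (S q)) / t ^ q.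
Proof.
intros Ht. pose proof (Efun0_ge q t (Rlt_le _ _ Ht)) as H.
assert (0 < t ^ q) by now apply pow_lt.
assert (0 < INR (fact (S q))) by apply INR_fact_lt_0.
unfold Hfun. replace (INR (fact (S q)) / t ^ q) with (/ (t ^ q / INR (fact (S q)))) by (field; lra).
apply Rinv_le_contravar; [|easy]. now apply Rdiv_lt_0_compat.
Qed.

Lemma Hfun_le1 (t : R) : 0 <= t -> Hfun t <= 1.
Proof.
intros Ht. pose proof (Efun0_ge 0 t Ht) as H. simpl in H.
unfold Hfun. rewrite <- Rinv_1. apply Rinv_le_contravar; lra.
Qed.

Lemma Hfun_decay (k : nat) (p : nat) : (1 <= k)%nat ->
  forall v, 0 <= v -> Hfun (v ^ k) * (1 + v) ^ p <= 2 ^ p * INR (fact (S p)).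
Proof.
intros Hk v Hv.
assert (1 <= INR (fact (S p))) by (apply (le_INR 1); apply lt_O_fact).
assert (0 < 2 ^ p) by (apply pow_lt; lra).
pose proof (Hfun_pos (v ^ k)).
destruct (Rle_dec v 1) as [Hv1|Hv1].
- pose proof (Hfun_le1 (v ^ k) (pow_le _ _ Hv)).
  assert ((1 + v) ^ p <= 2 ^ p) by (apply pow_incr; lra).
  assert (0 <= (1 + v) ^ p) by (apply pow_le; lra). nra.
- assert (1 <= v) by lra.
  assert (Hvk : v <= v ^ k).
  { rewrite <- (pow_1 v) at 1. now apply Rle_pow. }
  assert (Hp : (1 + v) ^ p <= 2 ^ p * (v ^ k) ^ p).
  { rewrite <- Rpow_mult_distr. apply pow_incr. lra. }
  assert (0 < v ^ k) by lra.
  pose proof (Hfun_le_pow p (v ^ k) ltac:(lra)) as Hle.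
  assert (0 < (v ^ k) ^ p) by now apply pow_lt.
  apply Rle_trans with (INR (fact (S p)) / (v ^ k) ^ p * (2 ^ p * (v ^ k) ^ p)).
  + apply Rmult_le_compat; try lra. apply pow_le; lra.
  + right. field. lra.
Qed.

(* The functions [v -> Hfun (v ^ k) * a v], with [a] in this algebra, are
   closed under differentiation and decay faster than any power. *)
Inductive symbol (k : nat) : (R -> R) -> Prop :=
| symbol_const c : symbol k (fun _ => c)
| symbol_id : symbol k (fun v => v)
| symbol_Eratio i : symbol k (fun v => Eratio i (v ^ k))
| symbol_plus a b : symbol k a -> symbol k b -> symbol k (fun v => a v + b v)
| symbol_mult a b : symbol k a -> symbol k b -> symbol k (fun v => a v * b v).

Lemma symbol_pow (k p : nat) : symbol k (fun v => v ^ p).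
Proof.
induction p as [|p IH].
- exact (symbol_const k 1).
- exact (symbol_mult k _ _ (symbol_id k) IH).
Qed.

Lemma symbol_growth (k : nat) (a : R -> R) : symbol k a ->
  exists C p, 0 <= C /\ forall v, 0 <= v -> Rabs (a v) <= C * (1 + v) ^ p.
Proof.
induction 1 as [c| |i|a b _ [Ca [p [HCa Ha]]] _ [Cb [q [HCb Hb]]]
  |a b _ [Ca [p [HCa Ha]]] _ [Cb [q [HCb Hb]]]].
- exists (Rabs c), 0%nat. split; [apply Rabs_pos|]. intros; simpl; lra.
- exists 1, 1%nat. split; [lra|]. intros v Hv. rewrite Rabs_pos_eq; lra.
- exists 1, 0%nat. split; [lra|]. intros v Hv.
  destruct (Eratio_bounds i (v ^ k) (pow_le _ _ Hv)). rewrite Rabs_pos_eq; simpl; lra.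
- exists (Ca + Cb), (p + q)%nat. split; [lra|]. intros v Hv.
  specialize (Ha v Hv); specialize (Hb v Hv).
  assert ((1 + v) ^ p <= (1 + v) ^ (p + q)) by (apply Rle_pow; [lra|lia]).
  assert ((1 + v) ^ q <= (1 + v) ^ (p + q)) by (apply Rle_pow; [lra|lia]).
  eapply Rle_trans; [apply Rabs_triang|]. nra.
- exists (Ca * Cb), (p + q)%nat. split; [nra|]. intros v Hv.
  rewrite Rabs_mult, pow_add.
  replace (Ca * Cb * ((1 + v) ^ p * (1 + v) ^ q)) with ((Ca * (1 + v) ^ p) * (Cb * (1 + v) ^ q))
    by ring.
  apply Rmult_le_compat; auto using Rabs_pos.
Qed.

Lemma symbol_derive (k : nat) (a : R -> R) : symbol k a ->
  exists a', symbol k a' /\ forall v, is_derive a v (a' v).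
Proof.
induction 1 as [c| |i|a b Sa [a' [Sa' Ha]] Sb [b' [Sb' Hb]]
  |a b Sa [a' [Sa' Ha]] Sb [b' [Sb' Hb]]].
- exists (fun _ => 0). split; [constructor|]. intros v. apply @is_derive_const.
- exists (fun _ => 1). split; [constructor|]. intros v. apply @is_derive_id.
- exists (fun v => (INR k * v ^ pred k) *
    (Eratio (S i) (v ^ k) + (-1 * Eratio i (v ^ k)) * Eratio 1 (v ^ k))).
  split.
  + repeat first [apply symbol_const | apply symbol_Eratio | apply symbol_pow
      | apply symbol_mult | apply symbol_plus].
  + intros v. apply (is_derive_comp (Eratio i) (fun v => v ^ k)).
    * apply is_derive_Eratio.
    * replace (INR k * v ^ pred k) with (INR k * 1 * v ^ pred k) by ring.
      apply (is_derive_pow (fun v => v)). apply @is_derive_id.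
- exists (fun v => a' v + b' v). split; [now constructor|].
  intros v. now apply @is_derive_plus.
- exists (fun v => a' v * b v + a v * b' v). split; [repeat constructor; easy|].
  intros v. apply (is_derive_mult a b); auto. intros; apply Rmult_comm.
Qed.

(** The factor [Hfun (v ^ k)] carries the decay and the symbol grows at most polynomially, both on
    [v >= 0] only: for odd [k] the factor itself grows as [v] tends to minus infinity. *)
Definition schwartz (k : nat) (G : R -> R) : Prop :=
  exists a, symbol k a /\ forall v, G v = Hfun (v ^ k) * a v.

Lemma schwartz_decay (k : nat) (G : R -> R) (p : nat) : (1 <= k)%nat ->
  schwartz k G -> exists C, 0 <= C /\ forall v, 0 <= v -> Rabs (G v) <= C / (1 + v) ^ p.
Proof.
intros Hk [a [Sa HG]]. destruct (symbol_growth k a Sa) as [C [q [HC Ha]]].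
set (D := 2 ^ (p + q) * INR (fact (S (p + q)))).
assert (0 <= D).
{ apply Rmult_le_pos. apply pow_le; lra. apply pos_INR. }
exists (C * D). split; [nra|].
intros v Hv. rewrite HG, Rabs_mult.
assert (Hp : 0 < (1 + v) ^ p) by (apply pow_lt; lra).
pose proof (Hfun_decay k (p + q) Hk v Hv) as HH. fold D in HH.
pose proof (Hfun_pos (v ^ k)).
rewrite (Rabs_pos_eq (Hfun _)) by lra.
specialize (Ha v Hv). apply Rmult_le_reg_r with ((1 + v) ^ p); [easy|].
replace (C * D / (1 + v) ^ p * (1 + v) ^ p) with (C * D) by (field; lra).
rewrite pow_add in HH.
apply Rle_trans with (Hfun (v ^ k) * (C * (1 + v) ^ q) * (1 + v) ^ p).
- apply Rmult_le_compat_r; [lra|]. apply Rmult_le_compat_l; lra.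
- nra.
Qed.

Lemma schwartz_derive (k : nat) (G : R -> R) : schwartz k G ->
  exists G', schwartz k G' /\ forall v, is_derive G v (G' v).
Proof.
intros [a [Sa HG]]. destruct (symbol_derive k a Sa) as [a' [Sa' Ha]].
set (b := fun v => (INR k * v ^ pred k) * (-1 * Eratio 1 (v ^ k)) * a v + a' v).
exists (fun v => Hfun (v ^ k) * b v). split.
- exists b. split; [|easy]. unfold b.
  apply symbol_plus; [|easy]. apply symbol_mult; [|easy].
  repeat first [apply symbol_const | apply symbol_Eratio | apply symbol_pow
    | apply symbol_mult].
- intros v. apply is_derive_ext with (fun v => Hfun (v ^ k) * a v); [now intros|].
  replace (Hfun (v ^ k) * b v)
    with (plus (mult ((INR k * 1 * v ^ pred k) * (Hfun (v ^ k) * - Eratio 1 (v ^ k))) (a v))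
      (mult (Hfun (v ^ k)) (a' v))) by (unfold plus, mult, b; simpl; ring).
  apply (is_derive_mult (fun v => Hfun (v ^ k)) a); [|easy|intros; apply Rmult_comm].
  apply (is_derive_comp Hfun (fun v => v ^ k)). apply is_derive_Hfun.
  apply (is_derive_pow (fun v => v)). apply @is_derive_id.
Qed.

(** * Finite sums and Euler-Maclaurin summation *)

Fixpoint rsum (f : nat -> R) (n : nat) : R :=
  match n with O => 0 | S m => rsum f m + f m end.

Lemma rsum_ext (f g : nat -> R) (n : nat) :
  (forall m, (m < n)%nat -> f m = g m) -> rsum f n = rsum g n.
Proof.
induction n as [|n IH]; intros H; [easy|].
simpl. rewrite IH by (intros; apply H; lia). now rewrite H by lia.
Qed.

Lemma rsum_le (f g : nat -> R) (n : nat) :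
  (forall m, (m < n)%nat -> f m <= g m) -> rsum f n <= rsum g n.
Proof.
induction n as [|n IH]; intros H; simpl; [lra|].
apply Rplus_le_compat; [apply IH; intros; apply H; lia|apply H; lia].
Qed.

Lemma rsum_plus (f g : nat -> R) (n : nat) :
  rsum (fun m => f m + g m) n = rsum f n + rsum g n.
Proof. induction n as [|n IH]; simpl; [ring|]. rewrite IH; ring. Qed.

Lemma rsum_scal (c : R) (f : nat -> R) (n : nat) :
  rsum (fun m => c * f m) n = c * rsum f n.
Proof. induction n as [|n IH]; simpl; [ring|]. rewrite IH; ring. Qed.

Lemma rsum_const (c : R) (n : nat) : rsum (fun _ => c) n = INR n * c.
Proof. induction n as [|n IH]; [simpl; ring|]. rewrite S_INR. simpl rsum. rewrite IH; ring. Qed.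

Lemma rsum_Rabs (f : nat -> R) (n : nat) :
  Rabs (rsum f n) <= rsum (fun m => Rabs (f m)) n.
Proof.
induction n as [|n IH]; simpl; [rewrite Rabs_R0; lra|].
eapply Rle_trans; [apply Rabs_triang|lra].
Qed.

Lemma rsum_nonneg (f : nat -> R) (n : nat) :
  (forall m, (m < n)%nat -> 0 <= f m) -> 0 <= rsum f n.
Proof.
intros H. replace 0 with (rsum (fun _ => 0) n) by (rewrite rsum_const; ring).
now apply rsum_le.
Qed.

Lemma rsum_le_len (f : nat -> R) (n p : nat) : (n <= p)%nat ->
  (forall m, 0 <= f m) -> rsum f n <= rsum f p.
Proof.
intros H Hf. induction H; [lra|]. simpl. specialize (Hf m). lra.
Qed.

(** * Integrals over the half-line *)

Lemma is_derive_Rcontinuous (f : R -> R) (x l : R) : is_derive f x l -> continuous f x.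
Proof. intros H. apply @ex_derive_continuous. now exists l. Qed.

Lemma ex_RInt_cont (G : R -> R) (a b : R) : (forall v, continuous G v) -> ex_RInt G a b.
Proof. intros H. apply @ex_RInt_continuous. intros; apply H. Qed.

Lemma RInt_Chasles_cont (G : R -> R) (a b c : R) : (forall v, continuous G v) ->
  RInt G a c = RInt G a b + RInt G b c.
Proof.
intros H. symmetry. apply (RInt_Chasles G a b c); now apply ex_RInt_cont.
Qed.

Lemma RInt_decay (G : R -> R) (C a b : R) : (forall v, continuous G v) ->
  (forall v, 0 <= v -> Rabs (G v) <= C / (1 + v) ^ 2) -> 0 <= a <= b ->
  Rabs (RInt G a b) <= C / (1 + a) - C / (1 + b).
Proof.
intros Hc HG Hab.
assert (HI : is_RInt (fun v => C / (1 + v) ^ 2) a b (C / (1 + a) - C / (1 + b))).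
{ replace (C / (1 + a) - C / (1 + b)) with (minus (- C / (1 + b)) (- C / (1 + a)))
    by (unfold minus, plus, opp; simpl; field; lra).
  apply (is_RInt_derive (fun v => - C / (1 + v))).
  - intros x Hx. rewrite Rmin_left in Hx by lra. rewrite Rmax_right in Hx by lra.
    auto_derive; [lra|]. field; lra.
  - intros x Hx. rewrite Rmin_left in Hx by lra. rewrite Rmax_right in Hx by lra.
    apply @ex_derive_continuous. auto_derive. nra. }
rewrite <- (is_RInt_unique _ _ _ _ HI).
assert (ex_RInt G a b) by (apply @ex_RInt_continuous; intros; apply Hc).
eapply Rle_trans; [apply abs_RInt_le; [lra|easy]|].
apply RInt_le; [lra| |now exists (C / (1 + a) - C / (1 + b))|intros; apply HG; lra].
apply @ex_RInt_continuous. intros z _.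
apply (continuous_comp G Rabs); [apply Hc|apply continuous_Rabs].
Qed.

(** The integral over the half-line, along integer upper limits. [Lim_seq] is total, so convergence
    is a separate fact; other upper limits are covered by the tail bound. *)
Definition Jint (G : R -> R) : R := real (Lim_seq (fun N => RInt G 0 (INR N))).

Lemma Jint_lim (G : R -> R) (C : R) : (forall v, continuous G v) ->
  (forall v, 0 <= v -> Rabs (G v) <= C / (1 + v) ^ 2) ->
  is_lim_seq (fun N => RInt G 0 (INR N)) (Jint G).
Proof.
intros Hc HG. apply Lim_seq_correct'.
assert (HC : 0 <= C).
{ specialize (HG 0 (Rle_refl 0)). pose proof (Rabs_pos (G 0)).
  replace (C / (1 + 0) ^ 2) with C in HG by field. lra. }
assert (Hdiff : forall n m : nat, (n <= m)%nat ->
  Rabs (RInt G 0 (INR m) - RInt G 0 (INR n)) <= C / (1 + INR n)).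
{ intros n m Hnm. pose proof (pos_INR n). pose proof (le_INR _ _ Hnm).
  rewrite (RInt_Chasles_cont G 0 (INR n) (INR m)) by easy.
  rewrite Rplus_minus_l.
  eapply Rle_trans; [apply (RInt_decay G C); try easy; lra|].
  assert (0 <= C / (1 + INR m)) by (apply Rdiv_le_0_compat; lra). lra. }
apply ex_lim_seq_cauchy_corr. intros eps.
destruct (nfloor_ex (C / eps)) as [N HN].
{ apply Rdiv_le_0_compat; [easy|apply cond_pos]. }
exists N.
assert (Hle : forall n m, (N <= n)%nat -> (n <= m)%nat ->
  Rabs (RInt G 0 (INR m) - RInt G 0 (INR n)) < eps).
{ intros n m Hn Hm. eapply Rle_lt_trans; [now apply Hdiff|].
  apply le_INR in Hn. pose proof (cond_pos eps).
  assert (0 <= INR N) by apply pos_INR.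
  apply Rmult_lt_reg_r with (1 + INR n); [lra|].
  replace (C / (1 + INR n) * (1 + INR n)) with (C / eps * eps) by (field; lra).
  rewrite (Rmult_comm eps). apply Rmult_lt_compat_r; lra. }
intros n m Hn Hm. destruct (Nat.le_ge_cases n m) as [H|H].
- rewrite Rabs_minus_sym. now apply Hle.
- now apply Hle.
Qed.

Lemma Jint_tail (G : R -> R) (C Y : R) : (forall v, continuous G v) ->
  (forall v, 0 <= v -> Rabs (G v) <= C / (1 + v) ^ 2) -> 0 <= Y ->
  Rabs (Jint G - RInt G 0 Y) <= C / (1 + Y).
Proof.
intros Hc HG HY.
assert (HC : 0 <= C).
{ specialize (HG 0 (Rle_refl 0)). pose proof (Rabs_pos (G 0)).
  replace (C / (1 + 0) ^ 2) with C in HG by field. lra. }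
assert (HL : is_lim_seq (fun N => Rabs (RInt G 0 (INR N) - RInt G 0 Y))
  (Rabs (Jint G - RInt G 0 Y))).
{ apply (is_lim_seq_abs _ (Jint G - RInt G 0 Y)).
  apply is_lim_seq_minus'; [now apply Jint_lim with C|apply is_lim_seq_const]. }
destruct (nfloor_ex Y HY) as [N HN].
apply (is_lim_seq_le_loc _ (fun _ => C / (1 + Y)) _ _) with (2 := HL)
  (3 := is_lim_seq_const _).
exists (S N). intros n Hn.
apply le_INR in Hn. rewrite S_INR in Hn.
rewrite (RInt_Chasles_cont G 0 Y (INR n)) by easy.
rewrite Rplus_minus_l.
eapply Rle_trans; [apply (RInt_decay G C); try easy; lra|].
assert (0 <= C / (1 + INR n)) by (apply Rdiv_le_0_compat; lra). lra.
Qed.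

(** The error is viewed as a function of the step [r]: it vanishes at [r = 0], and its derivative is
    [r / 2] times a difference of two values of [G']. Mean value arguments then give the bound, with
    constant 1 in place of the classical 1/12. *)
Lemma trapezoid (G G' G'' : R -> R) (a h B : R) :
  (forall v, is_derive G v (G' v)) -> (forall v, is_derive G' v (G'' v)) ->
  0 < h -> (forall v, a <= v <= a + h -> Rabs (G'' v) <= B) ->
  Rabs (RInt G a (a + h) - h * (G a + G (a + h)) / 2) <= h ^ 3 * B.
Proof.
intros HG HG' Hh HB.
assert (Hc : forall v, continuous G v) by (intros v; eapply is_derive_Rcontinuous, HG).
assert (HB0 : 0 <= B).
{ eapply Rle_trans; [apply Rabs_pos|apply (HB a); lra]. }
set (E := fun r => RInt G a (a + r) - r * (G a + G (a + r)) / 2).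
set (E' := fun r => (G (a + r) - G a) / 2 - r * G' (a + r) / 2).
assert (HE : forall r, is_derive E r (E' r)).
{ intros r. unfold E, E'.
  assert (H1 : is_derive (fun r => RInt G a (a + r)) r (G (a + r))).
  { replace (G (a + r)) with (scal 1 (G (a + r))) by (unfold scal; simpl; unfold mult; simpl; ring).
    apply (is_derive_comp (RInt G a) (fun r => a + r)).
    - apply (is_derive_RInt G _ a). 2: apply Hc.
      apply filter_forall. intros x. apply @RInt_correct. now apply ex_RInt_cont.
    - auto_derive; [easy|ring]. }
  assert (H2 : is_derive (fun r => G (a + r)) r (G' (a + r))).
  { replace (G' (a + r)) with (scal 1 (G' (a + r))) by (unfold scal; simpl; unfold mult; simpl;
    ring).
    apply (is_derive_comp G (fun r => a + r)); [apply HG|auto_derive; [easy|ring]]. }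
  replace ((G (a + r) - G a) / 2 - r * G' (a + r) / 2)
    with (minus (G (a + r)) ((1 * (G a + G (a + r)) + r * (0 + G' (a + r))) * / 2))
    by (unfold minus, plus, opp; simpl; field).
  apply @is_derive_minus; [easy|].
  apply is_derive_ext with (fun r => / 2 * (r * (G a + G (a + r)))); [intros; simpl; field|].
  replace ((1 * (G a + G (a + r)) + r * (0 + G' (a + r))) * / 2)
    with (/ 2 * (1 * (G a + G (a + r)) + r * (0 + G' (a + r)))) by ring.
  apply (is_derive_scal (fun r => r * (G a + G (a + r)))).
  apply (is_derive_mult (fun r => r) (fun r => G a + G (a + r))).
  - apply @is_derive_id.
  - apply (is_derive_plus (fun _ => G a) (fun r => G (a + r))); [apply @is_derive_const|easy].
  - intros; apply Rmult_comm. }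
assert (HE' : forall r, 0 <= r <= h -> Rabs (E' r) <= h ^ 2 * B).
{ intros r Hr.
  destruct (MVT_gen G a (a + r) G') as [xi [Hxi Hd]].
  - intros; apply HG.
  - intros. apply continuity_pt_filterlim, Hc.
  - rewrite Rmin_left, Rmax_right in Hxi by lra.
    destruct (MVT_gen G' xi (a + r) G'') as [eta [Heta Hd']].
    + intros; apply HG'.
    + intros. apply continuity_pt_filterlim. eapply is_derive_Rcontinuous, HG'.
    + rewrite Rmin_left, Rmax_right in Heta by lra.
      unfold E'. rewrite Hd.
      replace (G' xi * (a + r - a) / 2 - r * G' (a + r) / 2)
        with (- (r / 2) * (G' (a + r) - G' xi)) by field.
      rewrite Hd', !Rabs_mult, Rabs_Ropp, (Rabs_pos_eq (r / 2)) by lra.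
      rewrite (Rabs_pos_eq (a + r - xi)) by lra.
      specialize (HB eta ltac:(lra)). pose proof (Rabs_pos (G'' eta)).
      assert (Rabs (G'' eta) * (a + r - xi) <= B * h) by (apply Rmult_le_compat; lra).
      assert (0 <= Rabs (G'' eta) * (a + r - xi)) by (apply Rmult_le_pos; lra).
      nra. }
change (Rabs (E h) <= h ^ 3 * B).
destruct (MVT_gen E 0 h E') as [xi [Hxi Hd]].
- intros; apply HE.
- intros. apply continuity_pt_filterlim. eapply is_derive_Rcontinuous, HE.
- rewrite Rmin_left, Rmax_right in Hxi by lra.
  assert (E0 : E 0 = 0).
  { unfold E. rewrite Rplus_0_r, RInt_point. unfold zero; simpl. field. }
  rewrite E0 in Hd. replace (E h) with (E' xi * h) by lra.
  rewrite Rabs_mult, (Rabs_pos_eq h) by lra.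
  specialize (HE' xi ltac:(lra)). nra.
Qed.

(** The trapezoidal rule with step [/ X] is summed against an integrable bound on [G'']. The sum
    omits the node 0, whence [G 0 / 2]; the far node and the tail of the integral are small because
    [M / X >= X ^ 2]. *)
Lemma euler_maclaurin (k : nat) (G : R -> R) : (1 <= k)%nat -> schwartz k G ->
  exists C, 0 <= C /\ forall (X : R) (M : nat), 1 <= X -> X ^ 3 <= INR M ->
  Rabs (rsum (fun m => G (INR (S m) / X)) M - (X * Jint G - G 0 / 2)) <= C / X.
Proof.
intros Hk HG.
destruct (schwartz_derive k G HG) as [G' [HsG' HG']].
destruct (schwartz_derive k G' HsG') as [G'' [HsG'' HG'']].
destruct (schwartz_decay k G 2 Hk HG) as [C [HC Hdec]].
destruct (schwartz_decay k G'' 2 Hk HsG'') as [C'' [HC'' Hdec'']].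
assert (Hc : forall v, continuous G v) by (intros v; eapply is_derive_Rcontinuous, HG').
exists (2 * C'' + 2 * C). split; [lra|].
intros X M HX HM.
set (h := / X). assert (Hh : 0 < h <= 1).
{ unfold h; split; [apply Rinv_0_lt_compat; lra|]. rewrite <- Rinv_1.
  apply Rinv_le_contravar; lra. }
assert (HhX : h * X = 1) by (unfold h; field; lra).
(* The factor [2 - 2 / (1 + N h)] is the integral of [2 / (1 + v) ^ 2] up to [N h]. It dominates the
   accumulated errors [h / (1 + v) ^ 2], and each inductive step telescopes because [h <= 1]. *)
assert (Htrap : forall N, Rabs (RInt G 0 (INR N * h)
   - h * (rsum (fun m => G (INR (S m) * h)) N + G 0 / 2 - G (INR N * h) / 2))
   <= h ^ 2 * C'' * (2 - 2 / (1 + INR N * h))).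
{ induction N as [|N IH].
  - simpl. rewrite Rmult_0_l, RInt_point. unfold zero; simpl.
    replace (0 - h * (0 + G 0 / 2 - G 0 / 2)) with 0 by field.
    rewrite Rabs_R0. replace (h * (h * 1) * C'' * (2 - 2 / (1 + 0))) with 0 by field. lra.
  - pose proof (pos_INR N) as HN.
    assert (HNh : 0 <= INR N * h) by (apply Rmult_le_pos; lra).
    replace (INR (S N) * h) with (INR N * h + h) by (rewrite S_INR; ring).
    rewrite (RInt_Chasles_cont G 0 (INR N * h) (INR N * h + h)) by easy.
    cbn [rsum].
    pose proof (trapezoid G G' G'' (INR N * h) h (C'' / (1 + INR N * h) ^ 2) HG' HG''
      ltac:(lra)) as HT.
    lapply HT; [clear HT; intros HT|].
    + replace (INR (S N) * h) with (INR N * h + h) by (rewrite S_INR; ring).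
      match goal with |- Rabs ?e <= _ => replace e with
        ((RInt G 0 (INR N * h) - h * (rsum (fun m => G (INR (S m) * h)) N + G 0 / 2 - G (INR N *
          h) / 2))
         + (RInt G (INR N * h) (INR N * h + h) - h * (G (INR N * h) + G (INR N * h + h)) / 2)) end.
      2: { field. }
      eapply Rle_trans; [apply Rabs_triang|].
      set (u := 1 + INR N * h) in *.
      assert (Hu : 1 <= u) by (unfold u; lra).
      replace (1 + (INR N * h + h)) with (u + h) by (unfold u; ring).
      assert (Hk2 : h / u ^ 2 <= 2 / u - 2 / (u + h)).
      { replace (2 / u - 2 / (u + h)) with (2 * h / (u * (u + h))) by (field; lra).
        apply Rmult_le_reg_r with (u ^ 2 * (u + h)).
        - apply Rmult_lt_0_compat; [apply pow_lt|]; lra.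
        - replace (h / u ^ 2 * (u ^ 2 * (u + h))) with (h * (u + h)) by (field; lra).
          replace (2 * h / (u * (u + h)) * (u ^ 2 * (u + h))) with (h * (2 * u)) by (field; lra).
          apply Rmult_le_compat_l; lra. }
      assert (Hk3 : h ^ 3 * (C'' / u ^ 2) <= h ^ 2 * C'' * (2 / u - 2 / (u + h))).
      { replace (h ^ 3 * (C'' / u ^ 2)) with (h ^ 2 * C'' * (h / u ^ 2)) by (field; lra).
        apply Rmult_le_compat_l; [|easy]. apply Rmult_le_pos; [apply pow_le|]; lra. }
      lra.
    + intros v Hv. eapply Rle_trans; [apply Hdec''; lra|].
      apply Rmult_le_compat_l; [easy|]. apply Rinv_le_contravar.
      * apply pow_lt; lra.
      * apply pow_incr; lra. }
specialize (Htrap M).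
assert (HMh : X ^ 2 <= INR M * h).
{ apply Rmult_le_reg_r with X; [lra|]. rewrite Rmult_assoc, HhX. simpl in *; lra. }
assert (HX2 : X <= X ^ 2) by (simpl; nra).
assert (Htail := Jint_tail G C (INR M * h) Hc Hdec ltac:(lra)).
specialize (Hdec (INR M * h) ltac:(lra)).
set (Y := INR M * h) in *.
rewrite (rsum_ext _ (fun m => G (INR (S m) * h))) by (intros; reflexivity).
set (S := rsum (fun m => G (INR (Datatypes.S m) * h)) M) in *.
replace (S - (X * Jint G - G 0 / 2)) with
  (- X * (RInt G 0 Y - h * (S + G 0 / 2 - G Y / 2)) - X * (Jint G - RInt G 0 Y) + G Y / 2).
2: { replace (- X * (RInt G 0 Y - h * (S + G 0 / 2 - G Y / 2)))
      with (- X * RInt G 0 Y + (h * X) * (S + G 0 / 2 - G Y / 2)) by ring.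
     rewrite HhX. field. }
assert (B1 : Rabs (- X * (RInt G 0 Y - h * (S + G 0 / 2 - G Y / 2))) <= 2 * C'' / X).
{ rewrite Rabs_mult, Rabs_Ropp, (Rabs_pos_eq X) by lra.
  apply Rle_trans with (X * (h ^ 2 * C'' * 2)).
  - apply Rmult_le_compat_l; [lra|]. eapply Rle_trans; [apply Htrap|].
    apply Rmult_le_compat_l. apply Rmult_le_pos; [apply pow_le|]; lra.
    assert (0 <= 2 / (1 + Y)) by (apply Rdiv_le_0_compat; lra). lra.
  - right. unfold h. field. lra. }
assert (B2 : Rabs (X * (Jint G - RInt G 0 Y)) <= C / X).
{ rewrite Rabs_mult, (Rabs_pos_eq X) by lra.
  apply Rle_trans with (X * (C / X ^ 2)); [|right; field; lra].
  apply Rmult_le_compat_l; [lra|]. eapply Rle_trans; [apply Htail|].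
  apply Rmult_le_compat_l; [lra|]. apply Rinv_le_contravar; nra. }
assert (B3 : Rabs (G Y / 2) <= C / X).
{ unfold Rdiv at 1. rewrite Rabs_mult, (Rabs_pos_eq (/ 2)) by lra.
  assert (C / (1 + Y) ^ 2 <= C / X).
  { apply Rmult_le_compat_l; [lra|]. apply Rinv_le_contravar; nra. }
  pose proof (Rabs_pos (G Y)). lra. }
eapply Rle_trans; [apply Rabs_triang|].
apply Rle_trans with (2 * C'' / X + C / X + C / X); [|right; field; lra].
apply Rplus_le_compat; [|easy].
eapply Rle_trans; [apply Rabs_triang|]. rewrite Rabs_Ropp. lra.
Qed.

(** * Derivatives of the logarithm of the generating function *)

(** Coefficients of [(q d/dq) ^ i] applied to [q / (1 - q)], the sum of [l ^ i * q ^ l] over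
    [l >= 1]. Built from [PS_derive] and [PS_incr_1], they make the derivative of each series the
    next series divided by [q]. *)
Fixpoint phi_coef (i : nat) : nat -> R :=
  match i with
  | O => PS_incr_1 (fun _ => 1)
  | S j => PS_incr_1 (PS_derive (phi_coef j))
  end.

Lemma phi_coef_S (i n : nat) : phi_coef i (S n) = INR (S n) ^ i.
Proof.
revert n; induction i as [|i IH]; intros n; [reflexivity|].
change (phi_coef (S i) (S n)) with (INR (S n) * phi_coef i (S n)).
now rewrite IH.
Qed.

Lemma phi_coef_0 (i : nat) : phi_coef i 0 = 0.
Proof. now destruct i. Qed.

Lemma CV_radius_phi_coef (i : nat) : CV_radius (phi_coef i) = 1.
Proof.
induction i as [|i IH]; simpl phi_coef; rewrite CV_radius_incr_1.
- replace (Finite 1) with (Finite (/ 1)) by (now rewrite Rinv_1).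
  apply CV_radius_finite_DAlembert; [intros; lra|lra|].
  apply is_lim_seq_ext with (fun _ => 1); [|apply is_lim_seq_const].
  intros _. replace (1 / 1) with 1 by lra. now rewrite Rabs_R1.
- now rewrite CV_radius_derive.
Qed.

Lemma exp_neg_lt1 (t : R) : 0 < t -> 0 < exp (- t) < 1.
Proof.
intros Ht. split; [apply exp_pos|]. rewrite <- exp_0. apply exp_increasing; lra.
Qed.

Lemma exp_neg_CV (i : nat) (t : R) : 0 < t ->
  Rbar_lt (Rabs (exp (- t))) (CV_radius (phi_coef i)).
Proof.
intros Ht. destruct (exp_neg_lt1 t Ht). rewrite CV_radius_phi_coef. simpl.
rewrite Rabs_pos_eq; lra.
Qed.

(* [psi i t = t ^ (i + 1) * sum_(l >= 1) l ^ i * exp (- l * t)]. *)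
Definition psi (i : nat) (t : R) : R := t ^ S i * PSeries (phi_coef i) (exp (- t)).

Lemma psi_lim (i : nat) (t : R) : 0 < t ->
  is_lim_seq (rsum (fun l => t ^ S i * (INR (S l) ^ i * exp (- t) ^ S l))) (psi i t).
Proof.
intros Ht.
assert (H : is_series (fun n => phi_coef i n * exp (- t) ^ n) (PSeries (phi_coef i) (exp (- t)))).
{ apply is_pseries_R. apply PSeries_correct. apply CV_radius_inside.
  now apply exp_neg_CV. }
apply is_lim_seq_ext with (fun L => t ^ S i * sum_n (fun n => phi_coef i n * exp (- t) ^ n) L).
- intros L. rewrite (rsum_scal (t ^ S i)). f_equal. induction L as [|L IH].
  + rewrite sum_O, phi_coef_0. simpl. ring.
  + rewrite sum_Sn. cbn [rsum]. rewrite <- IH, phi_coef_S. reflexivity.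
- apply (is_lim_seq_scal_l _ (t ^ S i) (PSeries (phi_coef i) (exp (- t)))). exact H.
Qed.

Lemma psi_nonneg (i : nat) (t : R) : 0 < t -> 0 <= psi i t.
Proof.
intros Ht.
apply (is_lim_seq_le (fun _ => 0) _ 0 (psi i t)) with (3 := psi_lim i t Ht);
  [|apply is_lim_seq_const].
intros n. apply rsum_nonneg. intros m _. pose proof (exp_pos (- t)).
apply Rmult_le_pos; [apply pow_le; lra|].
apply Rmult_le_pos; apply pow_le; [apply pos_INR|lra].
Qed.

Lemma psi0_Hfun (t : R) : 0 < t -> psi 0 t = Hfun t.
Proof.
intros Ht. unfold psi. simpl phi_coef. rewrite PSeries_incr_1.
destruct (exp_neg_lt1 t Ht).
unfold PSeries. rewrite (Series_ext _ (fun n => exp (- t) ^ n)) by (intros; ring).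
rewrite Series_geom by (rewrite Rabs_pos_eq; lra).
unfold Hfun. pose proof (Efun0_exp t). pose proof (Efun0_pos t).
assert (He : exp (- t) * (1 + t * Efun 0 t) = 1).
{ rewrite <- H1, <- exp_plus. replace (- t + t) with 0 by ring. apply exp_0. }
assert (exp (- t) = / (1 + t * Efun 0 t)).
{ apply Rmult_eq_reg_r with (1 + t * Efun 0 t); [|nra]. rewrite He. field. nra. }
rewrite H3. field. nra.
Qed.

(** In other words [psi (i + 1) = (i + 1) * psi i - t * (psi i)']: the whole family arises from
    [psi 0 = Hfun] by Euler operators, which preserve smoothness and decay and multiply integrals by
    a scalar. *)
Lemma is_derive_psi (i : nat) (t : R) : 0 < t ->
  is_derive (psi i) t ((INR (S i) * psi i t - psi (S i) t) / t).
Proof.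
intros Ht. unfold psi at 1.
replace ((INR (S i) * psi i t - psi (S i) t) / t)
  with (plus (mult (INR (S i) * 1 * t ^ i) (PSeries (phi_coef i) (exp (- t))))
     (mult (t ^ S i) (scal (scal (-1) (exp (- t))) (PSeries (PS_derive (phi_coef i)) (exp (-
       t)))))).
- apply (is_derive_mult (fun t => t ^ S i) (fun t => PSeries (phi_coef i) (exp (- t)))).
  + apply (is_derive_pow (fun t => t)). apply @is_derive_id.
  + apply (is_derive_comp (PSeries (phi_coef i)) (fun t => exp (- t))).
    * apply is_derive_PSeries. now apply exp_neg_CV.
    * apply (is_derive_comp exp (fun t => - t)). apply is_derive_exp.
      auto_derive; [easy|ring].
  + intros; apply Rmult_comm.
- unfold psi. change (phi_coef (S i)) with (PS_incr_1 (PS_derive (phi_coef i))).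
  rewrite (PSeries_incr_1 (PS_derive (phi_coef i))).
  unfold plus, scal, mult; simpl; unfold mult; simpl. field. lra.
Qed.

Lemma schwartz_continuous (k : nat) (G : R -> R) : schwartz k G -> forall v, continuous G v.
Proof.
intros H v. destruct (schwartz_derive k G H) as [G' [_ HG]].
eapply is_derive_Rcontinuous, HG.
Qed.

Lemma schwartz_RInt_lim (k : nat) (G : R -> R) : (1 <= k)%nat -> schwartz k G ->
  is_lim_seq (fun N => RInt G 0 (INR N)) (Jint G).
Proof.
intros Hk H. destruct (schwartz_decay k G 2 Hk H) as [C [_ HC]].
apply Jint_lim with C; [|easy]. now apply schwartz_continuous with k.
Qed.

(* Integration by parts: the boundary terms of [v * G v] vanish. *)
Lemma Jint_euler_operator (k : nat) (G G' : R -> R) (a b : R) : (1 <= k)%nat ->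
  schwartz k G -> schwartz k G' -> (forall v, is_derive G v (G' v)) ->
  schwartz k (fun v => a * G v + b * (v * G' v)) /\
  Jint (fun v => a * G v + b * (v * G' v)) = (a - b) * Jint G.
Proof.
intros Hk HG HG' Hd.
set (F := fun v => a * G v + b * (v * G' v)).
assert (HF : schwartz k F).
{ destruct HG as [u [Su Hu]]. destruct HG' as [u' [Su' Hu']].
  exists (fun v => a * u v + (b * v) * u' v). split.
  - repeat first [apply symbol_const | apply symbol_id | easy | apply symbol_mult | apply
    symbol_plus].
  - intros v. unfold F. rewrite Hu, Hu'. ring. }
split; [easy|].
assert (HL1 := schwartz_RInt_lim k F Hk HF).
assert (HL2 := schwartz_RInt_lim k G Hk HG).
assert (Hcont := schwartz_continuous k G HG).
assert (HcF := schwartz_continuous k F HF).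
assert (HE : forall N, RInt F 0 (INR N) = (a - b) * RInt G 0 (INR N) + b * (INR N * G (INR N))).
{ intros N. apply is_RInt_unique.
  apply is_RInt_ext with (fun v => plus (scal (a - b) (G v)) (scal b (1 * G v + v * G' v))).
  - intros v _. unfold F, plus, scal; simpl; unfold mult; simpl; ring.
  - apply @is_RInt_plus.
    + apply @is_RInt_scal. apply @RInt_correct. now apply ex_RInt_cont.
    + apply @is_RInt_scal.
      replace (INR N * G (INR N)) with (minus (INR N * G (INR N)) (0 * G 0))
        by (unfold minus, plus, opp; simpl; ring).
      apply (is_RInt_derive (fun v => v * G v)).
      * intros x _. apply (is_derive_mult (fun v => v) G); [apply @is_derive_id|apply Hd|].
        intros; apply Rmult_comm.
      * intros x _. apply (continuous_plus (fun v => 1 * G v) (fun v => v * G' v)).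
        -- apply (continuous_mult (fun _ => 1) G); [apply continuous_const|apply Hcont].
        -- apply (continuous_mult (fun v => v) G'); [apply continuous_id|].
           now apply schwartz_continuous with k. }
assert (HB : is_lim_seq (fun N => INR N * G (INR N)) 0).
{ destruct (schwartz_decay k G 2 Hk HG) as [C [HC Hdec]].
  apply is_lim_seq_abs_0.
  apply is_lim_seq_le_le with (fun _ => 0) (fun N => C * / INR (S N)).
  - intros N. split; [apply Rabs_pos|]. pose proof (pos_INR N).
    rewrite Rabs_mult, (Rabs_pos_eq (INR N)), S_INR by easy.
    specialize (Hdec (INR N) H).
    apply Rle_trans with (INR N * (C / (1 + INR N) ^ 2)).
    + now apply Rmult_le_compat_l.
    + apply Rle_trans with ((1 + INR N) * (C / (1 + INR N) ^ 2)).
      * apply Rmult_le_compat_r; [|lra]. apply Rdiv_le_0_compat; [easy|apply pow_lt; lra].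
      * right. field. lra.
  - apply is_lim_seq_const.
  - replace (Finite 0) with (Rbar_mult C 0) by (simpl; now rewrite Rmult_0_r).
    apply is_lim_seq_scal_l. apply (is_lim_seq_incr_1 (fun n => / INR n)).
    replace (Finite 0) with (Rbar_inv p_infty) by reflexivity.
    apply is_lim_seq_inv; [apply is_lim_seq_INR|easy]. }
assert (HL3 : is_lim_seq (fun N => RInt F 0 (INR N)) ((a - b) * Jint G + b * 0)).
{ apply is_lim_seq_ext with (fun N => (a - b) * RInt G 0 (INR N) + b * (INR N * G (INR N))).
  - intros N. now rewrite HE.
  - apply is_lim_seq_plus'.
    + apply (is_lim_seq_scal_l _ (a - b) (Jint G)). exact HL2.
    + apply (is_lim_seq_scal_l _ b 0). exact HB. }
apply is_lim_seq_unique in HL1, HL3. rewrite HL1 in HL3. injection HL3. lra.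
Qed.

(* The integral of [psi i (v ^ k)] over [v >= 0]; for [i = 0] this is [c_k]. *)
Fixpoint saddle_const (k i : nat) : R :=
  match i with
  | O => Jint (fun v => Hfun (v ^ k))
  | S j => (INR i + / INR k) * saddle_const k j
  end.

(** The formula for [psi i] gives 0 at [t = 0], which is not its limit there, so the equality is
    restricted to [v > 0]. The smooth continuation [G] takes the value [i!] at 0, and this is the
    source of the second term of the Euler-Maclaurin formula. *)
Lemma psi_schwartz (k i : nat) : (1 <= k)%nat ->
  exists G, schwartz k G /\ (forall v, 0 < v -> psi i (v ^ k) = G v) /\
    G 0 = INR (fact i) /\ Jint G = saddle_const k i.
Proof.
intros Hk. induction i as [|i [G [HG [Hpsi [H0 HJ]]]]].
- exists (fun v => Hfun (v ^ k)). split; [|split; [|split]].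
  + exists (fun _ => 1). split; [constructor|intros; ring].
  + intros v Hv. apply psi0_Hfun. now apply pow_lt.
  + rewrite pow_i by lia. unfold Hfun. rewrite Efun0_at0. simpl. field.
  + reflexivity.
- destruct (schwartz_derive k G HG) as [G' [HG' Hd]].
  destruct (Jint_euler_operator k G G' (INR (S i)) (- / INR k) Hk HG HG' Hd) as [HF HJF].
  exists (fun v => INR (S i) * G v + - / INR k * (v * G' v)). split; [easy|].
  split; [|split].
  + intros v Hv.
    assert (Hkk : 0 < INR k) by (apply lt_0_INR; lia).
    assert (Hvk : 0 < v ^ k) by now apply pow_lt.
    (* With [t = v ^ k] the operator [t d/dt] becomes [(v / k) d/dv], which explains the coefficient
       [- / INR k]. *)
    assert (Hd2 : is_derive G v (scal (INR k * 1 * v ^ pred k)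
       ((INR (S i) * psi i (v ^ k) - psi (S i) (v ^ k)) / v ^ k))).
    { apply is_derive_ext_loc with (fun v => psi i (v ^ k)).
      - exists (mkposreal v Hv). intros y Hy. apply Hpsi.
        change (Rabs (y - v) < v) in Hy. apply Rabs_def2 in Hy. lra.
      - apply (is_derive_comp (psi i) (fun v => v ^ k)).
        + now apply is_derive_psi.
        + apply (is_derive_pow (fun v => v)). apply @is_derive_id. }
    apply is_derive_unique in Hd2.
    rewrite (is_derive_unique _ _ _ (Hd v)) in Hd2. rewrite Hd2, <- (Hpsi v Hv).
    unfold scal; simpl; unfold mult; simpl.
    replace (v ^ k) with (v * v ^ pred k) by (destruct k; [lia|reflexivity]).
    assert (0 < v ^ pred k) by now apply pow_lt.
    set (A := psi i _). set (B := psi (S i) _). field. lra.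
  + rewrite H0, fact_simpl, mult_INR. ring.
  + rewrite HJF, HJ. cbn [saddle_const]. ring.
Qed.

(** This is [(- x) ^ (i + 1)] times the derivative of order [i + 1] of [log F_M] at [x = X ^ -k],
    where [F_M] generates the partitions into the [M] smallest [k]th powers. *)
Definition psi_sum (k i : nat) (X : R) (M : nat) : R :=
  rsum (fun m => psi i ((INR (S m) / X) ^ k)) M.

Lemma psi_sum_asymptotic (k i : nat) : (1 <= k)%nat ->
  exists C, 0 <= C /\ forall (X : R) (M : nat), 1 <= X -> X ^ 3 <= INR M ->
  Rabs (psi_sum k i X M - (saddle_const k i * X - INR (fact i) / 2)) <= C / X.
Proof.
intros Hk. destruct (psi_schwartz k i Hk) as [G [HG [Hpsi [H0 HJ]]]].
destruct (euler_maclaurin k G Hk HG) as [C [HC HE]].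
exists C. split; [easy|]. intros X M HX HM.
specialize (HE X M HX HM). rewrite HJ, H0 in HE.
unfold psi_sum. rewrite (rsum_ext _ (fun m => G (INR (S m) / X))).
- now rewrite (Rmult_comm _ X).
- intros m _. apply Hpsi. apply Rdiv_lt_0_compat; [apply lt_0_INR; lia|lra].
Qed.

(** * Taylor bounds for the cosine and the sine *)

Lemma derive_bound_pow (f f' : R -> R) (n : nat) : f 0 = 0 ->
  (forall x, is_derive f x (f' x)) -> (forall x, 0 <= x -> Rabs (f' x) <= x ^ n) ->
  forall x, 0 <= x -> Rabs (f x) <= x ^ S n.
Proof.
intros H0 Hd Hb x Hx.
destruct (MVT_gen f 0 x f') as [xi [Hxi HE]].
- intros; apply Hd.
- intros. apply continuity_pt_filterlim. eapply is_derive_Rcontinuous, Hd.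
- rewrite Rmin_left, Rmax_right in Hxi by lra.
  replace (f x) with (f' xi * x) by lra.
  rewrite Rabs_mult, (Rabs_pos_eq x) by lra. simpl. rewrite Rmult_comm.
  apply Rmult_le_compat_l; [easy|]. eapply Rle_trans; [apply Hb; lra|].
  apply pow_incr; lra.
Qed.

Lemma cos_sin_taylor5 (x : R) :
  Rabs (cos x - (1 - x ^ 2 / 2 + x ^ 4 / 24)) <= Rabs x ^ 5 /\
  Rabs (sin x - (x - x ^ 3 / 6)) <= Rabs x ^ 5.
Proof.
assert (D1 : forall x, 0 <= x -> Rabs (cos x - 1) <= x ^ 1).
{ apply (derive_bound_pow (fun x => cos x - 1) (fun x => - sin x)).
  - rewrite cos_0; ring.
  - intros y; auto_derive; [easy|ring].
  - intros y _. simpl. rewrite Rabs_Ropp. apply Rabs_le, SIN_bound. }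
assert (D2 : forall x, 0 <= x -> Rabs (sin x - x) <= x ^ 2).
{ apply (derive_bound_pow (fun x => sin x - x) (fun x => cos x - 1)); [|intros y; auto_derive;
  [easy|ring]|easy].
  rewrite sin_0; ring. }
assert (D3 : forall x, 0 <= x -> Rabs (cos x - (1 - x ^ 2 / 2)) <= x ^ 3).
{ apply (derive_bound_pow (fun x => cos x - (1 - x ^ 2 / 2)) (fun x => - (sin x - x))).
  - rewrite cos_0; field.
  - intros y; auto_derive; [easy|field].
  - intros y Hy. rewrite Rabs_Ropp. now apply D2. }
assert (D4 : forall x, 0 <= x -> Rabs (sin x - (x - x ^ 3 / 6)) <= x ^ 4).
{ apply (derive_bound_pow (fun x => sin x - (x - x ^ 3 / 6)) (fun x => cos x - (1 - x ^ 2 / 2)));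
  [|intros y; auto_derive; [easy|field]|easy].
  rewrite sin_0; field. }
assert (D5 : forall x, 0 <= x -> Rabs (cos x - (1 - x ^ 2 / 2 + x ^ 4 / 24)) <= x ^ 5).
{ apply (derive_bound_pow (fun x => cos x - (1 - x ^ 2 / 2 + x ^ 4 / 24)) (fun x => - (sin x - (x
  - x ^ 3 / 6)))).
  - rewrite cos_0; field.
  - intros y; auto_derive; [easy|field].
  - intros y Hy. rewrite Rabs_Ropp. now apply D4. }
(* The chain started from [|sin x| <= 1] reaches only [x ^ 4] for the sine. Restarting one
   derivative earlier, from [|cos x| <= 1], gains the missing power. *)
assert (D4b : forall x, 0 <= x -> Rabs (cos x - (1 - x ^ 2 / 2)) <= x ^ 4).
{ apply (derive_bound_pow (fun x => cos x - (1 - x ^ 2 / 2)) (fun x => - (sin x - x))).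
  - rewrite cos_0; field.
  - intros y; auto_derive; [easy|field].
  - intros y Hy. rewrite Rabs_Ropp. revert y Hy.
    apply (derive_bound_pow (fun x => sin x - x) (fun x => cos x - 1)); [rewrite sin_0;
      ring|intros y; auto_derive; [easy|ring]|].
    apply (derive_bound_pow (fun x => cos x - 1) (fun x => - sin x)); [rewrite cos_0;
      ring|intros y; auto_derive; [easy|ring]|].
    intros y Hy. rewrite Rabs_Ropp. revert y Hy.
    apply (derive_bound_pow sin cos); [apply sin_0|intros y; apply is_derive_sin|].
    intros y _. simpl. apply Rabs_le, COS_bound. }
assert (D5b : forall x, 0 <= x -> Rabs (sin x - (x - x ^ 3 / 6)) <= x ^ 5).
{ apply (derive_bound_pow (fun x => sin x - (x - x ^ 3 / 6)) (fun x => cos x - (1 - x ^ 2 / 2)));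
  [|intros y; auto_derive; [easy|field]|easy].
  rewrite sin_0; field. }
destruct (Rle_dec 0 x) as [H|H].
- rewrite (Rabs_pos_eq x) by easy. split; [now apply D5|now apply D5b].
- rewrite (Rabs_left x) by lra. specialize (D5 (- x) ltac:(lra)). specialize (D5b (- x) ltac:(lra)).
  rewrite cos_neg in D5. rewrite sin_neg in D5b. split.
  + replace (x ^ 2) with ((- x) ^ 2) by ring. now replace (x ^ 4) with ((- x) ^ 4) by ring.
  + rewrite <- Rabs_Ropp. replace (- (sin x - (x - x ^ 3 / 6))) with (- sin x - (- x - (- x) ^ 3
    / 6)) by field.
    easy.
Qed.

(** * Taylor expansion off the real axis *)

(** The number [q * exp (- i th)] in coordinates. *)
Definition geom_ratio (q th : R) : C := (q * cos th, - (q * sin th)).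

Lemma Cmod_polar (r th : R) : 0 <= r -> Cmod (r * cos th, - (r * sin th)) = r.
Proof.
intros Hr. unfold Cmod; cbn [fst snd].
replace ((r * cos th) ^ 2 + (- (r * sin th)) ^ 2) with (r ^ 2 * ((sin th)² + (cos th)²))
  by (unfold Rsqr; ring).
rewrite sin2_cos2, Rmult_1_r. replace (r ^ 2) with (Rsqr r) by (unfold Rsqr; ring).
now apply sqrt_Rsqr.
Qed.

Lemma geom_denom_neq0 (q th : R) : 0 < q < 1 -> Cminus 1 (geom_ratio q th) <> 0.
Proof.
intros Hq H. apply (f_equal Re) in H. cbn in H.
pose proof (COS_bound th). nra.
Qed.

Lemma geom_denom_sqr (q th : R) :
  (1 - q * cos th) ^ 2 + (q * sin th) ^ 2 = (1 - q) ^ 2 + 2 * q * (1 - cos th).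
Proof.
pose proof (sin2_cos2 th) as H. unfold Rsqr in H.
replace ((1 - q * cos th) ^ 2 + (q * sin th) ^ 2)
  with (1 - 2 * q * cos th + q ^ 2 * (sin th * sin th + cos th * cos th)) by ring.
rewrite H. ring.
Qed.

Lemma geom_denom_sqr_pos (q th : R) : 0 < q < 1 ->
  0 < (1 - q * cos th) ^ 2 + (q * sin th) ^ 2.
Proof.
intros Hq. pose proof (COS_bound th). assert (0 < 1 - q * cos th) by nra.
assert (0 < (1 - q * cos th) ^ 2) by now apply pow_lt.
assert (0 <= (q * sin th) ^ 2) by apply pow2_ge_0. lra.
Qed.

Definition geom_sum (q th : R) : C := Cdiv (geom_ratio q th) (Cminus 1 (geom_ratio q th)).

Lemma geom_partial (q th : R) (L : nat) : 0 < q < 1 ->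
  ((rsum (fun l => q ^ S l * cos (INR (S l) * th)) L,
    rsum (fun l => - (q ^ S l * sin (INR (S l) * th))) L) : C)
  = Cminus (geom_sum q th)
     (Cdiv (geom_ratio (q ^ S L) (INR (S L) * th)) (Cminus 1 (geom_ratio q th))).
Proof.
intros Hq. pose proof (geom_denom_neq0 q th Hq) as H0.
induction L as [|L IH].
- cbn [rsum]. unfold geom_sum. rewrite pow_1. simpl INR. rewrite Rmult_1_l.
  change ((0, 0) : C) with (RtoC 0). field. easy.
- cbn [rsum].
  set (z := geom_ratio (q ^ S L) (INR (S L) * th)) in *.
  match goal with |- ?x = _ => replace x with (Cplus (rsum (fun l => q ^ S l * cos (INR (S l) *
    th)) L,
    rsum (fun l => - (q ^ S l * sin (INR (S l) * th))) L) z) by reflexivity end.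
  rewrite IH. set (Q := geom_ratio q th) in *.
  replace (geom_ratio (q ^ S (S L)) (INR (S (S L)) * th)) with (Cmult Q z).
  + field. easy.
  + unfold Q, z, geom_ratio, Cmult; cbn [fst snd].
    rewrite (S_INR (S L)), (Rmult_plus_distr_r (INR (S L))), Rmult_1_l, cos_plus, sin_plus.
    f_equal; simpl; ring.
Qed.

Lemma Re_le_Cmod (z : C) : Rabs (Re z) <= Cmod z.
Proof. eapply Rle_trans; [|apply Rmax_Cmod]. apply Rmax_l. Qed.

Lemma Im_le_Cmod (z : C) : Rabs (Im z) <= Cmod z.
Proof. eapply Rle_trans; [|apply Rmax_Cmod]. apply Rmax_r. Qed.

Lemma geom_sum_lim (q th : R) : 0 < q < 1 ->
  is_lim_seq (rsum (fun l => q ^ S l * cos (INR (S l) * th))) (Re (geom_sum q th)) /\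
  is_lim_seq (rsum (fun l => - (q ^ S l * sin (INR (S l) * th)))) (Im (geom_sum q th)).
Proof.
intros Hq. set (D := Cminus 1 (geom_ratio q th)).
assert (HD : 0 < Cmod D) by (apply Cmod_gt_0, geom_denom_neq0; easy).
assert (Hz : is_lim_seq (fun L => q ^ S L / Cmod D) 0).
{ replace (Finite 0) with (Rbar_mult 0 (/ Cmod D)) by (simpl; now rewrite Rmult_0_l).
  apply is_lim_seq_scal_r. apply (is_lim_seq_incr_1 (fun n => q ^ n)).
  apply is_lim_seq_geom. rewrite Rabs_pos_eq; lra. }
assert (Hmod : forall L, Cmod (Cdiv (geom_ratio (q ^ S L) (INR (S L) * th)) D) = q ^ S L / Cmod D).
{ intros L. rewrite Cmod_div by (apply geom_denom_neq0; easy).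
  unfold geom_ratio. rewrite Cmod_polar; [easy|]. apply pow_le; lra. }
assert (HL : forall (u : nat -> R) l, (forall L, Rabs (u L - l) <= q ^ S L / Cmod D) ->
  is_lim_seq u l).
{ intros u l Hu. apply is_lim_seq_ext with (fun L => l + (u L - l)); [intros; ring|].
  replace (Finite l) with (Finite (l + 0)) by (now rewrite Rplus_0_r).
  apply is_lim_seq_plus'; [apply is_lim_seq_const|].
  apply is_lim_seq_abs_0. apply is_lim_seq_le_le with (fun _ => 0) (fun L => q ^ S L / Cmod D);
    try easy.
  - intros L; split; [apply Rabs_pos|apply Hu].
  - apply is_lim_seq_const. }
split; apply HL; intros L; pose proof (geom_partial q th L Hq) as H;
  rewrite <- (Hmod L); fold D in H.
- apply (f_equal Re) in H. cbn [Re fst] in H. rewrite H.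
  eapply Rle_trans; [|apply Re_le_Cmod]. right.
  rewrite <- Rabs_Ropp. f_equal. cbn; ring.
- apply (f_equal Im) in H. cbn [Im snd] in H. rewrite H.
  eapply Rle_trans; [|apply Im_le_Cmod]. right.
  rewrite <- Rabs_Ropp. f_equal. cbn; ring.
Qed.

Lemma is_lim_seq_Rabs_le (u v : nat -> R) (a b : R) :
  is_lim_seq u a -> is_lim_seq v b -> (forall n, Rabs (u n) <= v n) -> Rabs a <= b.
Proof.
intros Hu Hv H.
apply (is_lim_seq_le (fun n => Rabs (u n)) v (Rabs a) b); [easy| |easy].
now apply (is_lim_seq_abs _ a).
Qed.

Lemma rsum_lin3 (f g h r : nat -> R) (a b : R) (n : nat) :
  rsum f n - (rsum g n + a * rsum h n + b * rsum r n)
  = rsum (fun m => f m - (g m + a * h m + b * r m)) n.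
Proof. induction n as [|n IH]; simpl; [ring|]. rewrite <- IH. ring. Qed.

Lemma rsum_lin2 (f g h : nat -> R) (a b : R) (n : nat) :
  rsum f n - (a * rsum g n + b * rsum h n)
  = rsum (fun m => f m - (a * g m + b * h m)) n.
Proof. induction n as [|n IH]; simpl; [ring|]. rewrite <- IH. ring. Qed.

(** Expanding [cos (l t th)] and [sin (l t th)] term by term turns the powers of [l t] into the
    functions [psi i], and the common remainder [|l t th| ^ 5] into [psi 5 t]. The inequality is
    proved for partial sums over [l] and passes to the limit. *)
Lemma geom_sum_taylor (t th : R) : 0 < t ->
  Rabs (t * Re (geom_sum (exp (- t)) (t * th))
     - (psi 0 t + - th ^ 2 / 2 * psi 2 t + th ^ 4 / 24 * psi 4 t)) <= Rabs th ^ 5 * psi 5 t /\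
  Rabs (t * Im (geom_sum (exp (- t)) (t * th))
     - (- th * psi 1 t + th ^ 3 / 6 * psi 3 t)) <= Rabs th ^ 5 * psi 5 t.
Proof.
intros Ht. pose proof (exp_neg_lt1 t Ht) as Hq.
destruct (geom_sum_lim (exp (- t)) (t * th) Hq) as [HR HI].
assert (Hlim : forall u l, is_lim_seq (rsum u) (Finite l) -> forall a, is_lim_seq (fun n => a *
  rsum u n) (a * l)).
{ intros u l Hu a. now apply (is_lim_seq_scal_l _ a l). }
pose proof (fun i => psi_lim i t Ht) as HP.
split.
- apply is_lim_seq_Rabs_le with (2 := Hlim _ _ (HP 5%nat) (Rabs th ^ 5))
   (u := fun n => t * rsum (fun l => exp (- t) ^ S l * cos (INR (S l) * (t * th))) n -
     (rsum (fun l => t ^ 1 * (INR (S l) ^ 0 * exp (- t) ^ S l)) n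
      + - th ^ 2 / 2 * rsum (fun l => t ^ 3 * (INR (S l) ^ 2 * exp (- t) ^ S l)) n
      + th ^ 4 / 24 * rsum (fun l => t ^ 5 * (INR (S l) ^ 4 * exp (- t) ^ S l)) n)).
  + apply is_lim_seq_minus'; [now apply Hlim|].
    apply is_lim_seq_plus'; [apply is_lim_seq_plus'|];
      [apply (HP 0%nat)|apply Hlim, (HP 2%nat)|apply Hlim, (HP 4%nat)].
  + intros n. rewrite <- rsum_scal, rsum_lin3, <- rsum_scal.
    eapply Rle_trans; [apply rsum_Rabs|]. apply rsum_le. intros m _.
    set (l := INR (S m)). set (Q := exp (- t) ^ S m).
    assert (0 <= Q) by (apply pow_le; lra). assert (0 <= l) by apply pos_INR.
    destruct (cos_sin_taylor5 (l * (t * th))) as [Hc _].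
    replace (t * (Q * cos (l * (t * th))) - (t ^ 1 * (l ^ 0 * Q)
       + - th ^ 2 / 2 * (t ^ 3 * (l ^ 2 * Q)) + th ^ 4 / 24 * (t ^ 5 * (l ^ 4 * Q))))
     with (t * Q * (cos (l * (t * th)) - (1 - (l * (t * th)) ^ 2 / 2 + (l * (t * th)) ^ 4 / 24)))
       by field.
    rewrite Rabs_mult, (Rabs_pos_eq (t * Q)) by (apply Rmult_le_pos; lra).
    eapply Rle_trans; [apply Rmult_le_compat_l; [apply Rmult_le_pos; lra|apply Hc]|].
    rewrite !Rabs_mult, (Rabs_pos_eq l), (Rabs_pos_eq t) by lra. right. ring.
- apply is_lim_seq_Rabs_le with (2 := Hlim _ _ (HP 5%nat) (Rabs th ^ 5))
   (u := fun n => t * rsum (fun l => - (exp (- t) ^ S l * sin (INR (S l) * (t * th)))) n -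
     (- th * rsum (fun l => t ^ 2 * (INR (S l) ^ 1 * exp (- t) ^ S l)) n
      + th ^ 3 / 6 * rsum (fun l => t ^ 4 * (INR (S l) ^ 3 * exp (- t) ^ S l)) n)).
  + apply is_lim_seq_minus'; [now apply Hlim|].
    apply is_lim_seq_plus'; [apply Hlim, (HP 1%nat)|apply Hlim, (HP 3%nat)].
  + intros n. rewrite <- rsum_scal, rsum_lin2, <- rsum_scal.
    eapply Rle_trans; [apply rsum_Rabs|]. apply rsum_le. intros m _.
    set (l := INR (S m)). set (Q := exp (- t) ^ S m).
    assert (0 <= Q) by (apply pow_le; lra). assert (0 <= l) by apply pos_INR.
    destruct (cos_sin_taylor5 (l * (t * th))) as [_ Hc].
    replace (t * - (Q * sin (l * (t * th))) - (- th * (t ^ 2 * (l ^ 1 * Q)) + th ^ 3 / 6 * (t ^ 4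
      * (l ^ 3 * Q))))
     with (- (t * Q) * (sin (l * (t * th)) - (l * (t * th) - (l * (t * th)) ^ 3 / 6))) by field.
    rewrite Rabs_mult, Rabs_Ropp, (Rabs_pos_eq (t * Q)) by (apply Rmult_le_pos; lra).
    eapply Rle_trans; [apply Rmult_le_compat_l; [apply Rmult_le_pos; lra|apply Hc]|].
    rewrite !Rabs_mult, (Rabs_pos_eq l), (Rabs_pos_eq t) by lra. right. ring.
Qed.

Definition is_Cderive (f : R -> C) (y : R) (l : C) : Prop :=
  is_derive (fun y => Re (f y)) y (Re l) /\ is_derive (fun y => Im (f y)) y (Im l).

Lemma is_derive_Rplus (f g : R -> R) (x a b : R) : is_derive f x a -> is_derive g x b ->
  is_derive (fun y => f y + g y) x (a + b).
Proof. exact (is_derive_plus f g x a b). Qed.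

Lemma is_derive_Rminus (f g : R -> R) (x a b : R) : is_derive f x a -> is_derive g x b ->
  is_derive (fun y => f y - g y) x (a - b).
Proof. exact (is_derive_minus f g x a b). Qed.

Lemma is_derive_Rmult (f g : R -> R) (x a b : R) : is_derive f x a -> is_derive g x b ->
  is_derive (fun y => f y * g y) x (a * g x + f x * b).
Proof. intros Hf Hg. apply (is_derive_mult f g x a b Hf Hg Rmult_comm). Qed.

Lemma is_Cderive_mult (f g : R -> C) (y : R) (lf lg : C) :
  is_Cderive f y lf -> is_Cderive g y lg ->
  is_Cderive (fun y => Cmult (f y) (g y)) y (Cplus (Cmult lf (g y)) (Cmult (f y) lg)).
Proof.
intros [f1 f2] [g1 g2]. split.
- replace (Re (Cplus (Cmult lf (g y)) (Cmult (f y) lg))) with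
    (Re lf * Re (g y) + Re (f y) * Re lg - (Im lf * Im (g y) + Im (f y) * Im lg))
    by (unfold Re, Im, Cplus, Cmult; simpl; ring).
  apply (is_derive_Rminus (fun y => Re (f y) * Re (g y)) (fun y => Im (f y) * Im (g y)));
    now apply is_derive_Rmult.
- replace (Im (Cplus (Cmult lf (g y)) (Cmult (f y) lg))) with
    (Re lf * Im (g y) + Re (f y) * Im lg + (Im lf * Re (g y) + Im (f y) * Re lg))
    by (unfold Re, Im, Cplus, Cmult; simpl; ring).
  apply (is_derive_Rplus (fun y => Re (f y) * Im (g y)) (fun y => Im (f y) * Re (g y)));
    now apply is_derive_Rmult.
Qed.

Definition cis (b : R) : C := (cos b, sin b).

Lemma is_Cderive_cis (a y : R) : is_Cderive (fun y => cis (a * y)) y (Cmult (cis (a * y)) (0, a)).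
Proof.
split; cbn.
- auto_derive; [easy|ring].
- auto_derive; [easy|ring].
Qed.

(** The Euler factor of one part, divided by its value on the real axis. *)
Definition geom_factor (q th : R) : C := Cdiv (RtoC (1 - q)) (Cminus 1 (geom_ratio q th)).

(** With [Q = q * exp (- i a y)] one has [Q' = - i a Q], so the logarithmic derivative of
    [(1 - q) / (1 - Q)] is [- i a Q / (1 - Q)]. *)
Lemma is_Cderive_geom_factor (q a y : R) : 0 < q < 1 ->
  is_Cderive (fun y => geom_factor q (y * a)) y
   (Cmult (geom_factor q (y * a)) (Cmult (0, - a) (geom_sum q (y * a)))).
Proof.
intros Hq. pose proof (geom_denom_sqr_pos q (y * a) Hq) as HD.
set (f1 := fun y => (1 - q) * (1 - q * cos (y * a)) / ((1 - q * cos (y * a)) ^ 2 + (q * sin (y *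
  a)) ^ 2)).
set (f2 := fun y => - ((1 - q) * (q * sin (y * a)) / ((1 - q * cos (y * a)) ^ 2 + (q * sin (y *
  a)) ^ 2))).
assert (E1 : forall y, Re (geom_factor q (y * a)) = f1 y).
{ intros u. pose proof (geom_denom_sqr_pos q (u * a) Hq).
  unfold f1, geom_factor, Cdiv, Cinv; cbn. field.
  apply Rgt_not_eq; lra. }
assert (E2 : forall y, Im (geom_factor q (y * a)) = f2 y).
{ intros u. pose proof (geom_denom_sqr_pos q (u * a) Hq).
  unfold f2, geom_factor, Cdiv, Cinv; cbn. field.
  apply Rgt_not_eq; lra. }
assert (E3 : Re (geom_sum q (y * a)) = (q * cos (y * a) * (1 - q * cos (y * a)) - (q * sin (y *
  a)) ^ 2)
   / ((1 - q * cos (y * a)) ^ 2 + (q * sin (y * a)) ^ 2)).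
{ unfold geom_sum, Cdiv, Cinv; cbn. field. apply Rgt_not_eq; lra. }
assert (E4 : Im (geom_sum q (y * a)) = - (q * sin (y * a)) / ((1 - q * cos (y * a)) ^ 2 + (q *
  sin (y * a)) ^ 2)).
{ unfold geom_sum, Cdiv, Cinv; cbn. field. apply Rgt_not_eq; lra. }
split.
- apply is_derive_ext with f1; [intros; symmetry; apply E1|].
  replace (Re (Cmult (geom_factor q (y * a)) (Cmult (0, - a) (geom_sum q (y * a)))))
   with (Re (geom_factor q (y * a)) * (a * Im (geom_sum q (y * a))) + Im (geom_factor q (y * a))
     * (a * Re (geom_sum q (y * a))))
   by (cbn; ring).
  rewrite E1, E2, E3, E4. unfold f1, f2.
  auto_derive; [lra|]. field. lra.
- apply is_derive_ext with f2; [intros; symmetry; apply E2|].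
  replace (Im (Cmult (geom_factor q (y * a)) (Cmult (0, - a) (geom_sum q (y * a)))))
   with (- Re (geom_factor q (y * a)) * (a * Re (geom_sum q (y * a))) + Im (geom_factor q (y *
     a)) * (a * Im (geom_sum q (y * a))))
   by (cbn; ring).
  rewrite E1, E2, E3, E4. unfold f1, f2.
  auto_derive; [lra|]. field. lra.
Qed.

(** * The weight on the vertical line *)

Fixpoint Cprod (f : nat -> C) (n : nat) : C :=
  match n with O => 1 | S m => Cmult (Cprod f m) (f m) end.

Definition part_scale (k : nat) (X : R) (m : nat) : R := (INR (S m) / X) ^ k.

(* With [x = X ^ -k] and [z = x * (1 + i * Y / sqrt X)] this is
   [F_M z * exp (n z) / (F_M x * exp (n x))] for [n = c * X ^ (k + 1)], where
   [F_M] generates the partitions into the [M] smallest [k]th powers. *)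
Definition weight (k : nat) (c X : R) (M : nat) (Y : R) : C :=
  Cmult (cis (c * sqrt X * Y))
    (Cprod (fun m => geom_factor (exp (- part_scale k X m)) (Y * (part_scale k X m / sqrt X))) M).

(** Together with [log_weight_im], the real and imaginary parts of the logarithmic derivative of
    [weight] in [Y], not of its logarithm. *)
Definition log_weight_re (k : nat) (X : R) (M : nat) (Y : R) : R :=
  rsum (fun m => part_scale k X m / sqrt X *
    Im (geom_sum (exp (- part_scale k X m)) (Y * (part_scale k X m / sqrt X)))) M.

Definition log_weight_im (k : nat) (c X : R) (M : nat) (Y : R) : R :=
  c * sqrt X - rsum (fun m => part_scale k X m / sqrt X *
    Re (geom_sum (exp (- part_scale k X m)) (Y * (part_scale k X m / sqrt X)))) M.

Lemma part_scale_pos (k : nat) (X : R) (m : nat) : 0 < X -> 0 < part_scale k X m.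
Proof.
intros HX. apply pow_lt, Rdiv_lt_0_compat; [apply lt_0_INR; lia|easy].
Qed.

Lemma is_Cderive_weight (k : nat) (c X : R) (M : nat) (Y : R) : 0 < X ->
  is_Cderive (weight k c X M) Y
    (Cmult (weight k c X M Y) (log_weight_re k X M Y, log_weight_im k c X M Y)).
Proof.
intros HX. unfold log_weight_re, log_weight_im.
induction M as [|M IH].
- cbn [rsum]. rewrite Rminus_0_r.
  replace (Cmult (weight k c X 0 Y) (0, c * sqrt X))
    with (Cmult (cis (c * sqrt X * Y)) (0, c * sqrt X)) by (unfold weight; cbn [Cprod]; ring).
  destruct (is_Cderive_cis (c * sqrt X) Y) as [H1 H2]. split.
  + eapply is_derive_ext; [|exact H1]. intros t. unfold weight; cbn [Cprod]. now rewrite Cmult_1_r.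
  + eapply is_derive_ext; [|exact H2]. intros t. unfold weight; cbn [Cprod]. now rewrite Cmult_1_r.
- set (g := fun y => geom_factor (exp (- part_scale k X M)) (y * (part_scale k X M / sqrt X))).
  assert (Hg := is_Cderive_geom_factor (exp (- part_scale k X M)) (part_scale k X M / sqrt X) Y
    (exp_neg_lt1 _ (part_scale_pos k X M HX))). fold g in Hg. fold (g Y) in Hg.
  assert (HE : forall y, weight k c X (S M) y = Cmult (weight k c X M y) (g y)).
  { intros y. unfold weight, g. cbn [Cprod]. now rewrite Cmult_assoc. }
  destruct (is_Cderive_mult _ _ _ _ _ IH Hg) as [H1 H2].
  match type of H1 with is_derive _ _ (Re ?l) => set (L := l) in * end.
  match goal with |- is_Cderive _ _ ?l => replace l with L end.
  + split.
    * eapply is_derive_ext; [|exact H1]. intros t. now rewrite HE.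
    * eapply is_derive_ext; [|exact H2]. intros t. now rewrite HE.
  + unfold L. rewrite HE. cbn [rsum].
    set (w := weight k c X M Y). set (G := geom_sum _ _).
    set (a := part_scale k X M / sqrt X). set (A := rsum _ M). set (B := rsum _ M).
    destruct w, G, (g Y). unfold Cmult, Cplus, Re, Im; cbn [fst snd]. f_equal; ring.
Qed.

Lemma rsum_approx (u v p : nat -> R) (n : nat) :
  (forall m, (m < n)%nat -> Rabs (u m - v m) <= p m) ->
  Rabs (rsum u n - rsum v n) <= rsum p n.
Proof.
intros H. replace (rsum u n - rsum v n) with (rsum (fun m => u m + -1 * v m) n)
  by (rewrite rsum_plus, rsum_scal; ring).
eapply Rle_trans; [apply rsum_Rabs|]. apply rsum_le. intros m Hm.
replace (u m + -1 * v m) with (u m - v m) by ring. now apply H.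
Qed.

(** The one-part expansions are summed with [th = e * Y]. The polynomial for the real part is odd in
    [Y] and that for the imaginary part even; this is the parity exploited later. The constant
    [e * (c * X - psi_sum k 0 X M)] would vanish at the exact saddle point. *)
Lemma log_weight_taylor (k : nat) (c X : R) (M : nat) (Y : R) : 0 < X ->
  let e := / sqrt X in let S i := psi_sum k i X M / X in
  Rabs (log_weight_re k X M Y - (- S 1%nat * Y + e ^ 2 * S 3%nat / 6 * Y ^ 3))
     <= e ^ 4 * S 5%nat * Rabs Y ^ 5 /\
  Rabs (log_weight_im k c X M Y - (e * (c * X - psi_sum k 0 X M) + e * S 2%nat / 2 * Y ^ 2
       - e ^ 3 * S 4%nat / 24 * Y ^ 4)) <= e ^ 4 * S 5%nat * Rabs Y ^ 5.
Proof.
intros HX e S.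
assert (Hs : 0 < sqrt X) by now apply sqrt_lt_R0.
assert (He : 0 < e) by now apply Rinv_0_lt_compat.
assert (HXe : / X = e ^ 2).
{ unfold e. rewrite pow_inv. now rewrite pow2_sqrt by lra. }
assert (HsX : sqrt X = e * X).
{ rewrite <- (sqrt_sqrt X) at 2 by lra. unfold e. field. lra. }
assert (Hth : forall m, Y * (part_scale k X m / sqrt X) = part_scale k X m * (e * Y)).
{ intros m. unfold e. field. lra. }
assert (HY5 : Rabs (e * Y) ^ 5 = e ^ 5 * Rabs Y ^ 5).
{ rewrite Rabs_mult, (Rabs_pos_eq e) by lra. ring. }
assert (Hrs : forall i a, rsum (fun m => a * psi i (part_scale k X m)) M = a * psi_sum k i X M).
{ intros i a. now rewrite rsum_scal. }
assert (HS5 : e ^ 4 * S 5%nat * Rabs Y ^ 5 = rsum (fun m => e * (e ^ 5 * Rabs Y ^ 5) * psi 5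
  (part_scale k X m)) M).
{ rewrite (Hrs 5%nat). unfold S, Rdiv. rewrite HXe. ring. }
rewrite HS5. split.
- replace (- S 1%nat * Y + e ^ 2 * S 3%nat / 6 * Y ^ 3) with
   (rsum (fun m => (- e ^ 2 * Y) * psi 1 (part_scale k X m) + (e ^ 4 * Y ^ 3 / 6) * psi 3
     (part_scale k X m)) M).
  2: { rewrite rsum_plus, !Hrs. unfold S, Rdiv. rewrite HXe. ring. }
  apply rsum_approx. intros m _. rewrite Hth.
  destruct (geom_sum_taylor (part_scale k X m) (e * Y) (part_scale_pos k X m HX)) as [_ HT].
  rewrite HY5 in HT.
  match goal with |- Rabs ?x <= _ => replace x with
   (e * (part_scale k X m * Im (geom_sum (exp (- part_scale k X m)) (part_scale k X m * (e * Y)))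
      - (- (e * Y) * psi 1 (part_scale k X m) + (e * Y) ^ 3 / 6 * psi 3 (part_scale k X m))))
   by (unfold Rdiv; fold e; ring) end.
  rewrite Rabs_mult, (Rabs_pos_eq e), (Rmult_assoc e) by lra. apply Rmult_le_compat_l; lra.
- unfold log_weight_im.
  match goal with |- Rabs (?a - ?r - ?b) <= _ => replace (a - r - b) with
   (- (r - rsum (fun m => e * psi 0 (part_scale k X m)
      + ((- e ^ 3 * Y ^ 2 / 2) * psi 2 (part_scale k X m) + (e ^ 5 * Y ^ 4 / 24) * psi 4
        (part_scale k X m))) M)) end.
  2: { rewrite rsum_plus, rsum_plus, !Hrs. unfold S, Rdiv. rewrite HXe, HsX. field. }
  rewrite Rabs_Ropp. apply rsum_approx. intros m _. rewrite Hth.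
  destruct (geom_sum_taylor (part_scale k X m) (e * Y) (part_scale_pos k X m HX)) as [HT _].
  rewrite HY5 in HT.
  match goal with |- Rabs ?x <= _ => replace x with
   (e * (part_scale k X m * Re (geom_sum (exp (- part_scale k X m)) (part_scale k X m * (e * Y)))
      - (psi 0 (part_scale k X m) + - (e * Y) ^ 2 / 2 * psi 2 (part_scale k X m) + (e * Y) ^ 4 /
        24 * psi 4 (part_scale k X m))))
   by (unfold Rdiv; fold e; ring) end.
  rewrite Rabs_mult, (Rabs_pos_eq e), (Rmult_assoc e) by lra. apply Rmult_le_compat_l; lra.
Qed.

(** * The modulus of the weight *)

Lemma Cmod_cis (b : R) : Cmod (cis b) = 1.
Proof.
unfold cis, Cmod; cbn [fst snd].
replace (cos b ^ 2 + sin b ^ 2) with ((sin b)² + (cos b)²) by (unfold Rsqr; ring).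
rewrite sin2_cos2. apply sqrt_1.
Qed.

Lemma Cmod_geom_factor_sqr (q th : R) : 0 < q < 1 ->
  Cmod (geom_factor q th) ^ 2 = (1 - q) ^ 2 / ((1 - q) ^ 2 + 4 * q * sin (th / 2) ^ 2).
Proof.
intros Hq. unfold geom_factor. rewrite Cmod_div by now apply geom_denom_neq0.
unfold Rdiv at 1. rewrite Rpow_mult_distr, pow_inv, Cmod_R, pow2_abs.
unfold Cmod. rewrite pow2_sqrt.
- unfold Rdiv. f_equal. f_equal. cbn [fst snd geom_ratio Cminus Cplus Copp RtoC].
  replace (1 + - (q * cos th)) with (1 - q * cos th) by ring.
  replace (0 + - - (q * sin th)) with (q * sin th) by ring.
  rewrite geom_denom_sqr. replace th with (2 * (th / 2)) at 1 by field.
  rewrite cos_2a_sin. unfold Rdiv; ring.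
- apply Rplus_le_le_0_compat; apply pow2_ge_0.
Qed.

Lemma Cmod_geom_factor_le1 (q th : R) : 0 < q < 1 -> Cmod (geom_factor q th) <= 1.
Proof.
intros Hq. assert (H := Cmod_geom_factor_sqr q th Hq).
assert (0 < (1 - q) ^ 2) by (apply pow_lt; lra).
pose proof (pow2_ge_0 (sin (th / 2))).
assert (Hd : 0 <= 4 * q * sin (th / 2) ^ 2) by (apply Rmult_le_pos; lra).
assert (Cmod (geom_factor q th) ^ 2 <= 1).
{ rewrite H. apply Rmult_le_reg_r with ((1 - q) ^ 2 + 4 * q * sin (th / 2) ^ 2); [lra|].
  unfold Rdiv. rewrite Rmult_assoc, Rinv_l by lra. lra. }
pose proof (Cmod_ge_0 (geom_factor q th)). nra.
Qed.

(** For [t <= 1] one has [1 - q <= t] and [q >= 1 / 3], so [4 q >= 1]. For large [t] the factor is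
    close to 1 and gives no saving, hence the restriction. *)
Lemma Cmod_geom_factor_small (t th : R) : 0 < t <= 1 ->
  Cmod (geom_factor (exp (- t)) th) ^ 2 <= / (1 + sin (th / 2) ^ 2 / t ^ 2).
Proof.
intros Ht. assert (Hq := exp_neg_lt1 t ltac:(lra)).
rewrite Cmod_geom_factor_sqr by easy.
set (q := exp (- t)) in *. set (s := sin (th / 2) ^ 2).
assert (Hs : 0 <= s) by apply pow2_ge_0.
assert (H1 : 1 - q <= t).
{ pose proof (exp_ineq1_le (- t)). unfold q. lra. }
assert (H2 : / 3 <= q).
{ apply Rle_trans with (exp (- (1))).
  - rewrite exp_Ropp. apply Rinv_le_contravar; [apply exp_pos|apply exp_le_3].
  - unfold q. destruct (Req_dec t 1) as [->|]; [lra|]. left. apply exp_increasing; lra. }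
assert (H3 : 0 < (1 - q) ^ 2) by (apply pow_lt; lra).
assert (H4 : (1 - q) ^ 2 <= t ^ 2) by (apply pow_incr; lra).
replace ((1 - q) ^ 2 / ((1 - q) ^ 2 + 4 * q * s)) with (/ (1 + 4 * q * s / (1 - q) ^ 2)).
2: { field. split; [|lra]. assert (0 <= 4 * q * s) by (apply Rmult_le_pos; lra). lra. }
assert (0 <= s / t ^ 2) by (apply Rdiv_le_0_compat; [easy|apply pow_lt; lra]).
apply Rinv_le_contravar; [lra|]. apply Rplus_le_compat_l.
apply Rle_trans with (s / (1 - q) ^ 2).
- apply Rmult_le_compat_l; [easy|]. now apply Rinv_le_contravar.
- apply Rmult_le_compat_r; [left; now apply Rinv_0_lt_compat|]. nra.
Qed.

Fixpoint rprod (f : nat -> R) (n : nat) : R :=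
  match n with O => 1 | S m => rprod f m * f m end.

Lemma Cmod_Cprod_le (f : nat -> C) (N M : nat) : (N <= M)%nat ->
  (forall m, Cmod (f m) <= 1) -> Cmod (Cprod f M) <= Cmod (Cprod f N).
Proof.
intros H Hf. induction H as [|M H IH]; [lra|].
cbn [Cprod]. rewrite Cmod_mult. specialize (Hf M).
pose proof (Cmod_ge_0 (Cprod f M)). pose proof (Cmod_ge_0 (f M)). nra.
Qed.

Lemma Cmod_Cprod_sqr_le (f : nat -> C) (g : nat -> R) (N : nat) :
  (forall m, (m < N)%nat -> Cmod (f m) ^ 2 <= g m) -> Cmod (Cprod f N) ^ 2 <= rprod g N.
Proof.
induction N as [|N IH]; intros H.
- simpl. rewrite Cmod_1. lra.
- cbn [Cprod rprod]. rewrite Cmod_mult, Rpow_mult_distr.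
  apply Rmult_le_compat; try apply pow2_ge_0; [apply IH; intros; apply H; lia|apply H; lia].
Qed.

(** Every factor has modulus at most 1, so those beyond the first [N] may be dropped; [N <= X] keeps
    the scales [(m / X) ^ k] in the range [(0, 1]] of the previous estimate. *)
Lemma Cmod_weight_le (k : nat) (c X : R) (M N : nat) (Y : R) : (1 <= k)%nat -> 0 < X ->
  (N <= M)%nat -> INR N <= X ->
  Cmod (weight k c X M Y) ^ 2 <=
  rprod (fun m => / (1 + sin (Y * (part_scale k X m / sqrt X) / 2) ^ 2 / part_scale k X m ^ 2)) N.
Proof.
intros Hk HX HNM HN. unfold weight. rewrite Cmod_mult, Cmod_cis, Rmult_1_l.
eapply Rle_trans; [|apply Cmod_Cprod_sqr_le with (f := fun m =>
  geom_factor (exp (- part_scale k X m)) (Y * (part_scale k X m / sqrt X)))].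
- apply pow_incr. split; [apply Cmod_ge_0|].
  apply Cmod_Cprod_le; [easy|]. intros m. apply Cmod_geom_factor_le1, exp_neg_lt1.
  now apply part_scale_pos.
- intros m Hm. apply Cmod_geom_factor_small. split; [now apply part_scale_pos|].
  unfold part_scale. rewrite <- (pow1 k). apply pow_incr. split.
  + left. apply Rdiv_lt_0_compat; [apply lt_0_INR; lia|easy].
  + apply Rmult_le_reg_r with X; [easy|]. unfold Rdiv.
    rewrite Rmult_assoc, Rinv_l, Rmult_1_l by lra.
    rewrite Rmult_1_r. apply Rle_trans with (INR N); [apply le_INR; lia|easy].
Qed.

Lemma Cmod_weight_le1 (k : nat) (c X : R) (M : nat) (Y : R) : 0 < X ->
  Cmod (weight k c X M Y) <= 1.
Proof.
intros HX. unfold weight. rewrite Cmod_mult, Cmod_cis, Rmult_1_l, <- Cmod_1.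
apply (Cmod_Cprod_le _ 0 M); [lia|]. intros m. apply Cmod_geom_factor_le1, exp_neg_lt1.
now apply part_scale_pos.
Qed.

(** * Minor arcs *)

Definition fin_diff (d : R) (f : R -> R) : R -> R := fun x => f (x + d) - f x.

(* [has_leading p a f]: [f x = a * x ^ p] plus a polynomial of smaller degree. *)
Fixpoint has_leading (p : nat) (a : R) (f : R -> R) : Prop :=
  match p with
  | O => forall x, f x = a
  | S q => exists b g, has_leading q b g /\ forall x, f x = a * x ^ p + g x
  end.

Lemma has_leading_plus (p : nat) (a b : R) (f g : R -> R) :
  has_leading p a f -> has_leading p b g -> has_leading p (a + b) (fun x => f x + g x).
Proof.
revert a b f g; induction p as [|p IH]; intros a b f g.
- intros Hf Hg x. now rewrite Hf, Hg.
- intros [c [u [Hu Hf]]] [d [v [Hv Hg]]].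
  exists (c + d), (fun x => u x + v x). split; [now apply IH|].
  intros x. rewrite Hf, Hg. ring.
Qed.

Lemma has_leading_scal (p : nat) (a c : R) (f : R -> R) :
  has_leading p a f -> has_leading p (c * a) (fun x => c * f x).
Proof.
revert a f; induction p as [|p IH]; intros a f.
- intros Hf x. now rewrite Hf.
- intros [b [g [Hg Hf]]]. exists (c * b), (fun x => c * g x). split; [now apply IH|].
  intros x. rewrite Hf. ring.
Qed.

Lemma has_leading_shift (p : nat) (a : R) (f : R -> R) :
  has_leading p a f -> has_leading (S p) a (fun x => x * f x).
Proof.
revert a f; induction p as [|p IH]; intros a f.
- intros Hf. exists 0, (fun _ => 0). split; [intros x; reflexivity|].
  intros x. rewrite Hf. ring.
- intros [b [g [Hg Hf]]]. exists b, (fun x => x * g x). split; [now apply IH|].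
  intros x. rewrite Hf. simpl; ring.
Qed.

Lemma has_leading_weaken (p : nat) (a : R) (f : R -> R) :
  has_leading p a f -> has_leading (S p) 0 f.
Proof. intros H. exists a, f. split; [easy|intros; ring]. Qed.

Lemma has_leading_ext (p : nat) (a b : R) (f g : R -> R) : (forall x, f x = g x) -> a = b ->
  has_leading p a f -> has_leading p b g.
Proof.
intros H <-. destruct p as [|p].
- intros Hf x. now rewrite <- H.
- intros [b' [u [Hu Hf]]]. exists b', u. split; [easy|]. intros x. now rewrite <- H.
Qed.

Lemma has_leading_mono (p : nat) : has_leading p 1 (fun x => x ^ p).
Proof.
induction p as [|p IH]; [easy|]. now apply (has_leading_shift p 1 (fun x => x ^ p)).
Qed.

Lemma fin_diff_mono (d : R) (p : nat) :
  has_leading p (INR (S p) * d) (fin_diff d (fun x => x ^ S p)).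
Proof.
induction p as [|p IH].
- intros x. unfold fin_diff. simpl. ring.
(* Leibniz rule for the difference of [x * x ^ (p + 1)]. Its three terms contribute [(p + 1) * d],
   [0] and [d] to the leading coefficient. *)
- apply has_leading_ext with (a := INR (S p) * d + (0 + d * 1))
    (f := fun x => x * fin_diff d (fun x => x ^ S p) x
       + (d * fin_diff d (fun x => x ^ S p) x + d * x ^ S p)).
  + intros x. unfold fin_diff. simpl. ring.
  + rewrite (S_INR (S p)). ring.
  + apply has_leading_plus; [now apply has_leading_shift|].
    apply (has_leading_plus (S p) 0 (d * 1)).
    * eapply has_leading_weaken, has_leading_scal, IH.
    * apply has_leading_scal, has_leading_mono.
Qed.

Lemma fin_diff_has_leading (d : R) (p : nat) (a : R) (f : R -> R) :
  has_leading (S p) a f -> has_leading p (INR (S p) * d * a) (fin_diff d f).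
Proof.
revert a f; induction p as [|p IH]; intros a f [b [g [Hg Hf]]].
- intros x. unfold fin_diff. rewrite !Hf, !Hg. simpl; ring.
- apply has_leading_ext with (a := a * (INR (S (S p)) * d) + 0)
    (f := fun x => a * fin_diff d (fun x => x ^ S (S p)) x + fin_diff d g x).
  + intros x. unfold fin_diff. rewrite !Hf. ring.
  + ring.
  + apply has_leading_plus.
    * apply has_leading_scal, fin_diff_mono.
    * eapply has_leading_weaken, IH, Hg.
Qed.

Fixpoint fin_diff_iter (d : R) (i : nat) (f : R -> R) : R -> R :=
  match i with O => f | S j => fin_diff d (fin_diff_iter d j f) end.

Lemma fin_diff_iter_S (d : R) (i : nat) (f : R -> R) :
  fin_diff_iter d (S i) f = fin_diff_iter d i (fin_diff d f).
Proof.
induction i as [|i IH]; [easy|].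
cbn [fin_diff_iter] in *. now rewrite IH.
Qed.

Lemma fin_diff_iter_leading (d : R) (p : nat) (a : R) (f : R -> R) :
  has_leading p a f -> forall x, fin_diff_iter d p f x = INR (fact p) * d ^ p * a.
Proof.
revert a f; induction p as [|p IH]; intros a f Hf x.
- simpl. rewrite Hf. ring.
- rewrite fin_diff_iter_S, (IH _ _ (fin_diff_has_leading d p a f Hf)).
  rewrite fact_simpl, mult_INR. simpl pow. ring.
Qed.

Lemma sin2_sub (a b : R) : sin (a - b) ^ 2 <= 2 * (sin a ^ 2 + sin b ^ 2).
Proof.
rewrite sin_minus. set (u := sin a * cos b). set (v := cos a * sin b).
assert (H : (u - v) ^ 2 <= 2 * (u ^ 2 + v ^ 2)).
{ pose proof (pow2_ge_0 (u + v)). nra. }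
assert (Hc : forall x, cos x ^ 2 <= 1).
{ intros x. pose proof (COS_bound x). nra. }
assert (u ^ 2 <= sin a ^ 2).
{ unfold u. rewrite Rpow_mult_distr. pose proof (Hc b). pose proof (pow2_ge_0 (sin a)).
  rewrite <- (Rmult_1_r (sin a ^ 2)) at 2. now apply Rmult_le_compat_l. }
assert (v ^ 2 <= sin b ^ 2).
{ unfold v. rewrite Rpow_mult_distr. pose proof (Hc a). pose proof (pow2_ge_0 (sin b)).
  rewrite <- (Rmult_1_l (sin b ^ 2)) at 2. now apply Rmult_le_compat_r. }
lra.
Qed.

Lemma rsum_shift (f : nat -> R) (n : nat) : rsum f (S n) = f O + rsum (fun j => f (S j)) n.
Proof. induction n as [|n IH]; [simpl; ring|]. cbn [rsum] in *. rewrite IH. ring. Qed.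

(** Subadditivity of [|sin|] replaces exponential sums. Each differencing costs a factor 2 from
    [sin2_sub] and another 2 because the two shifted windows of nodes are both bounded by the full
    window. *)
Lemma sin2_fin_diff_iter (d : R) (f : R -> R) (i : nat) (x : R) :
  sin (fin_diff_iter d i f x) ^ 2 <= 4 ^ i * rsum (fun j => sin (f (x + INR j * d)) ^ 2) (S i).
Proof.
revert x; induction i as [|i IH]; intros x.
- simpl. rewrite Rmult_0_l, Rplus_0_r. lra.
- cbn [fin_diff_iter]. unfold fin_diff at 1.
  eapply Rle_trans; [apply sin2_sub|].
  set (g := fun j => sin (f (x + INR j * d)) ^ 2).
  assert (H1 := IH x). fold g in H1.
  assert (H2 := IH (x + d)).
  rewrite (rsum_ext _ (fun j => g (S j))) in H2.
  2: { intros m _. unfold g. rewrite S_INR. do 3 f_equal. ring. }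
  assert (Hg : forall j, 0 <= g j) by (intros; apply pow2_ge_0).
  assert (rsum (fun j => g (S j)) (S i) <= rsum g (S (S i))).
  { rewrite (rsum_shift g). specialize (Hg O). lra. }
  assert (rsum g (S i) <= rsum g (S (S i))) by (apply rsum_le_len; [lia|easy]).
  assert (0 < 4 ^ i) by (apply pow_lt; lra).
  simpl (4 ^ S i).
  assert (4 ^ i * rsum g (S i) <= 4 ^ i * rsum g (S (S i))) by (apply Rmult_le_compat_l; lra).
  assert (4 ^ i * rsum (fun j => g (S j)) (S i) <= 4 ^ i * rsum g (S (S i)))
    by (apply Rmult_le_compat_l; lra).
  lra.
Qed.

Definition weyl_sum (k : nat) (z : R) (N : nat) : R :=
  rsum (fun m => sin (z * INR (S m) ^ k) ^ 2) N.

Lemma rsum_nat_shift_le (f : nat -> R) (M N s : nat) : (forall m, 0 <= f m) ->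
  (M + s <= N)%nat -> rsum (fun m => f (m + s)%nat) M <= rsum f N.
Proof.
intros Hf H. apply Rle_trans with (rsum f (M + s)); [|now apply rsum_le_len].
clear H N. induction M as [|M IH]; simpl.
- now apply rsum_nonneg.
- lra.
Qed.

Lemma rsum_exchange (f : nat -> nat -> R) (n p : nat) :
  rsum (fun i => rsum (fun j => f i j) p) n = rsum (fun j => rsum (fun i => f i j) n) p.
Proof.
induction n as [|n IH]; simpl.
- rewrite rsum_const. ring.
- rewrite IH. now rewrite <- rsum_plus.
Qed.

(* Weyl differencing: the [k]th difference with step [d] of [z * x ^ k] is the
   constant [k! d ^ k z]. *)
Lemma weyl_sum_lower (k d M N : nat) (z : R) : (M + k * d <= N)%nat ->
  INR M * sin (INR (fact k) * INR d ^ k * z) ^ 2 <= 4 ^ k * INR (S k) * weyl_sum k z N.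
Proof.
intros H.
set (s := fun m => sin (z * INR (S m) ^ k) ^ 2).
assert (Hs : forall m, 0 <= s m) by (intros; apply pow2_ge_0).
assert (Hm : forall m, sin (INR (fact k) * INR d ^ k * z) ^ 2
  <= 4 ^ k * rsum (fun j => s (m + j * d)%nat) (S k)).
{ intros m.
  pose proof (sin2_fin_diff_iter (INR d) (fun x => z * x ^ k) k (INR (S m))) as Hd.
  assert (HL : has_leading k z (fun x => z * x ^ k)).
  { apply has_leading_ext with (a := z * 1) (f := fun x => z * x ^ k); [easy|ring|].
    apply has_leading_scal, has_leading_mono. }
  rewrite (fin_diff_iter_leading _ _ _ _ HL) in Hd.
  rewrite (rsum_ext _ (fun j => s (m + j * d)%nat)) in Hd; [easy|].
  intros j _. unfold s. do 4 f_equal. rewrite !S_INR, plus_INR, mult_INR. ring. }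
rewrite <- rsum_const.
eapply Rle_trans; [apply rsum_le; intros m _; apply (Hm m)|].
rewrite (rsum_scal (4 ^ k)), rsum_exchange, Rmult_assoc.
apply Rmult_le_compat_l; [apply pow_le; lra|].
rewrite <- rsum_const. apply rsum_le. intros j Hj.
apply (rsum_nat_shift_le s); [easy|].
assert (j * d <= k * d)%nat by (apply Nat.mul_le_mono_r; lia). lia.
Qed.

(** * Distance to the multiples of pi *)

Lemma sin2_shift (a : Z) (x : R) : sin (x + IZR a * PI) ^ 2 = sin x ^ 2.
Proof.
revert x. induction a using Z.peano_ind; intros x.
- now rewrite Rmult_0_l, Rplus_0_r.
- rewrite succ_IZR. replace (x + (IZR a + 1) * PI) with ((x + IZR a * PI) + PI) by ring.
  rewrite neg_sin, <- (IHa x). ring.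
- rewrite <- (IHa x). replace (x + IZR a * PI) with ((x + IZR (Z.pred a) * PI) + PI).
  + rewrite neg_sin. ring.
  + unfold Z.pred. rewrite plus_IZR. ring.
Qed.

(** The bound [PI <= 4] gives [x ^ 2 <= 4], hence [x - x ^ 3 / 6 >= x / 3]; the next two terms of
    the Taylor polynomial are together nonnegative. *)
Lemma sin_ge_third (x : R) : 0 <= x <= PI / 2 -> x / 3 <= sin x.
Proof.
intros Hx. pose proof PI_4 as HPI.
pose proof (SIN x ltac:(lra) ltac:(lra)) as [H1 _].
unfold sin_lb, sin_approx, sin_term in H1. simpl in H1.
eapply Rle_trans; [|apply H1].
assert (Hx2 : 0 <= x * x <= 4) by nra.
assert (H5 : 0 <= x * (x * x) * (x * x)) by (repeat apply Rmult_le_pos; lra).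
assert (H3 : 0 <= x * (x * x)) by (repeat apply Rmult_le_pos; lra).
replace (1 * (x * 1 / 1) + -1 * 1 * (x * (x * (x * 1)) / (1 + 1 + 1 + 1 + 1 + 1)) + 0) with (x -
  x * (x * x) / 6) by field.
match goal with |- _ <= ?e => replace e with
  (x - x * (x * x) / 6 + x * (x * x) * (x * x) / 120 * (1 - (x * x) / 42)) by field end.
assert (0 <= x * (x * x) * (x * x) / 120 * (1 - x * x / 42)) by (apply Rmult_le_pos; lra).
assert (x * (x * x) <= x * 4) by (apply Rmult_le_compat_l; lra).
lra.
Qed.

Lemma sin2_ge_ninth (x : R) : Rabs x <= PI / 2 -> x ^ 2 / 9 <= sin x ^ 2.
Proof.
intros Hx. destruct (Rle_dec 0 x) as [H|H].
- rewrite Rabs_pos_eq in Hx by easy. pose proof (sin_ge_third x ltac:(lra)). nra.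
- rewrite Rabs_left in Hx by lra. pose proof (sin_ge_third (- x) ltac:(lra)) as H1.
  rewrite sin_neg in H1. nra.
Qed.

Lemma sin_ge_between (x d : R) : 0 <= d -> d <= x <= PI - d -> d / 3 <= sin x.
Proof.
intros Hd Hx. destruct (Rle_dec x (PI / 2)) as [H|H].
- pose proof (sin_ge_third x ltac:(lra)). lra.
- rewrite <- sin_PI_x. pose proof (sin_ge_third (PI - x) ltac:(lra)). lra.
Qed.

Lemma nearest_PI_multiple (x : R) : exists (a : Z) (b : R), x = b + IZR a * PI /\ Rabs b <= PI / 2.
Proof.
pose proof PI_RGT_0. set (a := up (x / PI - / 2)). exists a, (x - IZR a * PI).
split; [ring|].
destruct (archimed (x / PI - / 2)) as [H1 H2]. fold a in H1, H2.
assert (Hx : x = x / PI * PI) by (field; lra).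
set (r := x / PI) in *. rewrite Hx. apply Rabs_le. split; nra.
Qed.

Lemma pow_lt_mono (n : nat) (x y : R) : (1 <= n)%nat -> 0 <= x < y -> x ^ n < y ^ n.
Proof.
intros Hn Hxy. destruct n as [|n]; [lia|]. clear Hn. induction n as [|n IH]; [simpl; lra|].
change (x * x ^ S n < y * y ^ S n). apply Rmult_le_0_lt_compat; try lra.
apply pow_le; lra.
Qed.

Lemma nat_threshold (P : nat -> Prop) (N : nat) : P 1%nat -> ~ P (S N) ->
  exists d, (1 <= d <= N)%nat /\ P d /\ ~ P (S d).
Proof.
intros H1. induction N as [|N IH]; intros HN; [easy|].
destruct (Classical_Prop.classic (P (S N))) as [H|H].
- exists (S N). repeat split; try easy; lia.
- destruct (IH H) as [d [Hd H']]. exists d. split; [lia|easy].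
Qed.

(** Take the last [d] with [d ^ k * |b| <= 1], or [d = 1] if [|b| >= 1]. Since [d + 1 <= 2 d],
    failure at [d + 1] costs only the factor [2 ^ k]; the hypothesis on [Y] makes the condition fail
    before [d] exceeds [Y]. *)
Lemma dilate_to_unit (k : nat) (b Y : R) : (1 <= k)%nat -> 1 <= Y -> Rabs b <= PI / 2 ->
  1 <= Y ^ k * Rabs b ->
  exists d, (1 <= d)%nat /\ INR d <= Y /\ Rabs (INR d ^ k * b) <= PI / 2 /\ / 2 ^ k <= Rabs (INR
    d ^ k * b).
Proof.
intros Hk HY Hb HYb.
assert (H2k : 1 <= 2 ^ k) by (apply pow_R1_Rle; lra).
assert (Hinv : / 2 ^ k <= 1) by (rewrite <- Rinv_1; apply Rinv_le_contravar; lra).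
destruct (Rle_dec 1 (Rabs b)) as [H1|H1].
- exists 1%nat. simpl INR. rewrite pow1, Rmult_1_l. repeat split; try lra; lia.
- destruct (nfloor_ex Y ltac:(lra)) as [N HN].
  destruct (nat_threshold (fun d => INR d ^ k * Rabs b <= 1) N) as [d [Hd [Hd1 Hd2]]].
  + simpl INR. rewrite pow1. lra.
  + intros H. rewrite S_INR in H.
    assert (Y ^ k < (INR N + 1) ^ k).
    { apply pow_lt_mono; [easy|lra]. }
    assert (0 < Rabs b).
    { destruct (Rle_lt_or_eq_dec 0 (Rabs b) (Rabs_pos b)) as [|E]; [easy|].
      rewrite <- E in HYb. lra. }
    nra.
  + assert (Hd0 : 1 <= INR d) by (apply (le_INR 1); lia).
    assert (INR d <= INR N) by (apply le_INR; lia).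
    assert (Habs : Rabs (INR d ^ k * b) = INR d ^ k * Rabs b).
    { rewrite Rabs_mult, Rabs_pos_eq; [easy|]. apply pow_le; lra. }
    exists d. rewrite Habs. pose proof PI2_1. repeat split; try lra; try lia.
    apply Rnot_le_lt in Hd2. rewrite S_INR in Hd2.
    assert (Hd3 : (INR d + 1) ^ k <= (2 * INR d) ^ k) by (apply pow_incr; lra).
    rewrite Rpow_mult_distr in Hd3. pose proof (Rabs_pos b).
    apply Rmult_le_reg_l with (2 ^ k); [lra|]. rewrite Rinv_r by lra. nra.
Qed.

Lemma rsum_subseq (f : nat -> R) (q I : nat) : (1 <= q)%nat -> (forall m, 0 <= f m) ->
  rsum (fun i => f (i * q)%nat) I <= rsum f (I * q).
Proof.
intros Hq Hf. induction I as [|I IH]; [simpl; lra|].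
apply Rle_trans with (rsum f (S (I * q))); [simpl; lra|].
apply rsum_le_len; [simpl; lia|easy].
Qed.

Lemma pow_mod_one (q i k : nat) : exists B, ((1 + i * q) ^ k = 1 + q * B)%nat.
Proof.
induction k as [|k [B HB]].
- exists 0%nat. simpl. lia.
- exists (B + i + i * q * B)%nat. rewrite Nat.pow_succ_r', HB. ring.
Qed.

(* Near [2 pi a / k!] with [a <> 0] the terms [m = 1 mod k!] stay away from
   multiples of [2 pi]. *)
Lemma weyl_sum_rational (k I N : nat) (z b Y : R) (a : Z) :
  INR (fact k) * z = b + IZR a * PI -> Rabs z <= PI / 2 -> a <> 0%Z -> 1 <= Y ->
  Y ^ k * Rabs b < 1 -> INR (I * fact k) <= Y -> (I * fact k <= N)%nat ->
  INR I * (/ (3 * INR (fact k))) ^ 2 <= weyl_sum k z N.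
Proof.
intros Hz Hz2 Ha HY Hb HI HN.
set (F := INR (fact k)) in *.
assert (HF : 1 <= F) by (apply (le_INR 1), lt_O_fact).
assert (HYk : 1 <= Y ^ k) by (apply pow_R1_Rle; lra).
pose proof PI2_1 as HPI.
pose proof (Rabs_pos b) as Hb0.
assert (Hb1 : Rabs b < 1) by nra.
assert (HA1 : 1 <= Rabs (IZR a)).
{ rewrite <- abs_IZR. apply IZR_le. lia. }
(* From [|z| <= PI / 2] one gets [|a| * PI <= F * PI / 2 + 1], hence [0 < |a| < F]: the fraction
   [a / k!] is not an integer. *)
assert (HA2 : Rabs (IZR a) <= F - 1).
{ unfold F. rewrite INR_IZR_INZ, <- abs_IZR, <- minus_IZR. apply IZR_le.
  enough (Z.abs a < Z.of_nat (fact k))%Z by lia.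
  apply lt_IZR. rewrite abs_IZR, <- INR_IZR_INZ. fold F.
  assert (Rabs (IZR a * PI) <= F * (PI / 2) + 1).
  { replace (IZR a * PI) with (F * z - b) by lra.
    eapply Rle_trans; [apply Rabs_triang|]. rewrite Rabs_Ropp, Rabs_mult, (Rabs_pos_eq F) by lra.
    apply Rplus_le_compat; [|lra]. apply Rmult_le_compat_l; lra. }
  rewrite Rabs_mult, (Rabs_pos_eq PI) in H by lra. nra. }
unfold weyl_sum. set (s := fun m => sin (z * INR (S m) ^ k) ^ 2).
assert (Hs : forall m, 0 <= s m) by (intros; apply pow2_ge_0).
apply Rle_trans with (rsum s (I * fact k)); [|now apply rsum_le_len].
apply Rle_trans with (rsum (fun i => s (i * fact k)%nat) I).
2: { apply rsum_subseq; [apply lt_O_fact|easy]. }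
rewrite <- rsum_const. apply rsum_le. intros i Hi.
destruct (pow_mod_one (fact k) i k) as [B HB].
apply (f_equal INR) in HB. rewrite pow_INR, (plus_INR 1 (fact k * B)), mult_INR in HB.
change (INR 1) with 1 in HB. fold F in HB.
unfold s. change (S (i * fact k)) with (1 + i * fact k)%nat.
set (P := INR (1 + i * fact k) ^ k) in *.
assert (HP : 1 <= P <= Y ^ k).
{ split.
  - apply pow_R1_Rle. apply (le_INR 1). lia.
  - apply pow_incr. split; [apply pos_INR|].
    eapply Rle_trans; [|apply HI]. apply le_INR.
    apply Nat.le_trans with (S i * fact k)%nat.
    + pose proof (lt_O_fact k). simpl. lia.
    + apply Nat.mul_le_mono_r. lia. }
assert (HbP : Rabs (b * P) <= 1).
{ rewrite Rabs_mult, (Rabs_pos_eq P) by lra. nra. }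
apply Rabs_le_between in HbP.
(* Since [P = 1 + k! * B], the integral part [a * B] splits off and disappears by periodicity. *)
replace (z * P) with ((b * P + IZR a * PI) / F + IZR (a * Z.of_nat B) * PI).
2: { rewrite mult_IZR, <- INR_IZR_INZ. replace z with ((b + IZR a * PI) / F) by (rewrite <- Hz;
  field; lra).
     rewrite HB. field. lra. }
rewrite sin2_shift.
replace (/ (3 * F)) with (/ F / 3) by (field; lra).
assert (HFi : 0 < / F) by (apply Rinv_0_lt_compat; lra).
(* The argument stays at distance at least [/ F] from both 0 and [PI], because [PI - 1 >= 1]. *)
assert (key : forall u c, 1 <= u <= F - 1 -> -1 <= c <= 1 -> (/ F / 3) ^ 2 <= sin ((c + u * PI) /
  F) ^ 2).
{ intros u c Hu Hc. apply pow_incr. split; [lra|].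
  apply sin_ge_between; [lra|].
  split.
  - unfold Rdiv. rewrite <- (Rmult_1_l (/ F)) at 1. apply Rmult_le_compat_r; nra.
  - apply Rmult_le_reg_r with F; [lra|].
    replace ((c + u * PI) / F * F) with (c + u * PI) by (field; lra).
    replace ((PI - / F) * F) with (PI * F - 1) by (field; lra). nra. }
destruct (Rle_dec 0 (IZR a)) as [H|H].
- rewrite Rabs_pos_eq in HA1, HA2 by easy. apply key; lra.
- rewrite Rabs_left in HA1, HA2 by lra.
  replace (sin ((b * P + IZR a * PI) / F) ^ 2) with (sin ((- (b * P) + - IZR a * PI) / F) ^ 2).
  + apply key; lra.
  + replace ((- (b * P) + - IZR a * PI) / F) with (- ((b * P + IZR a * PI) / F)) by (field; lra).
    rewrite sin_neg. ring.
Qed.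

(** Write [k! * y / 2 = b + a * PI] with [b] reduced. If [|b|] is at least [Y ^ -k], a dilation [d]
    makes the [k]th difference of order 1 and differencing applies. If [|b|] is smaller, either
    [a = 0] and [y] itself is of order [X ^ -k], or [a <> 0] and the residue class of 1 modulo [k!]
    already gives a positive proportion. *)
Lemma weyl_sum_minor (k : nat) : (1 <= k)%nat ->
  exists C0 c X0, 1 <= C0 /\ 0 < c /\ 1 <= X0 /\
  forall (X : R) (N : nat) (y : R), X0 <= X -> X - 1 <= INR N <= X -> Rabs y <= PI ->
  Rabs y * X ^ k <= C0 \/ c * X <= weyl_sum k (y / 2) N.
Proof.
intros Hk.
set (F := INR (fact k)). assert (HF : 1 <= F) by (apply (le_INR 1), lt_O_fact).
assert (Hk1 : 1 <= INR k) by (apply (le_INR 1); lia).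
(* For [d <= eta * X] differencing consumes [k * d <= X / 4] indices, so at least [X / 2] of the
   [N >= X - 1] remain once [X >= 4]. *)
set (eta := / (4 * INR (S k))).
assert (HSk : 2 <= INR (S k)) by (rewrite S_INR; lra).
assert (Heta : 0 < eta) by (apply Rinv_0_lt_compat; lra).
assert (Heta4 : eta * (4 * INR (S k)) = 1) by (unfold eta; field; lra).
set (W := 4 ^ k * INR (S k)).
assert (HW : 0 < W) by (apply Rmult_lt_0_compat; [apply pow_lt|]; lra).
assert (H2k : 0 < / 2 ^ k) by (apply Rinv_0_lt_compat, pow_lt; lra).
set (c1 := (/ 2 ^ k) ^ 2 / 9 / 2 / W).
set (c2 := eta / (2 * F) * (/ (3 * F)) ^ 2).
assert (Hc1 : 0 < c1).
{ unfold c1. repeat apply Rdiv_lt_0_compat; try lra. apply pow_lt; lra. }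
assert (Hc2 : 0 < c2).
{ unfold c2. apply Rmult_lt_0_compat; [apply Rdiv_lt_0_compat; lra|].
  apply pow_lt, Rinv_0_lt_compat; lra. }
assert (HC0 : 1 <= 2 * (/ eta) ^ k).
{ assert (1 <= (/ eta) ^ k); [|lra]. apply pow_R1_Rle.
  unfold eta. rewrite Rinv_inv. lra. }
exists (2 * (/ eta) ^ k), (Rmin c1 c2), (4 + 2 * F / eta).
assert (HFe : 0 < F / eta) by (apply Rdiv_lt_0_compat; lra).
split; [easy|]. split; [now apply Rmin_pos|]. split; [lra|].
intros X N y HX HN Hy.
set (Y := eta * X).
assert (HYF : 2 * F <= Y).
{ unfold Y. apply Rle_trans with (eta * (2 * F / eta)); [right; field; lra|].
  apply Rmult_le_compat_l; lra. }
destruct (nearest_PI_multiple (F * (y / 2))) as [a [b [Hab Hb]]].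
destruct (Rle_dec 1 (Y ^ k * Rabs b)) as [H1|H1].
- right. destruct (dilate_to_unit k b Y Hk ltac:(lra) Hb H1) as [d [Hd1 [HdY [Hds Hdl]]]].
  assert (HkY : INR k * INR d <= X / 4).
  { apply Rle_trans with (INR (S k) * Y).
    - apply Rmult_le_compat; try apply pos_INR; [rewrite S_INR; lra|easy].
    - unfold Y. replace (INR (S k) * (eta * X)) with (eta * (4 * INR (S k)) * (X / 4)) by field.
      rewrite Heta4. lra. }
  assert (HkN : (k * d <= N)%nat).
  { apply INR_le. rewrite mult_INR. lra. }
  pose proof (weyl_sum_lower k d (N - k * d) N (y / 2) ltac:(lia)) as HL.
  rewrite minus_INR, mult_INR in HL by easy. fold F W in HL.
  replace (F * INR d ^ k * (y / 2)) with (INR d ^ k * b + IZR (Z.of_nat d ^ Z.of_nat k * a) * PI)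
    in HL.
  2: { rewrite mult_IZR, <- pow_IZR, <- INR_IZR_INZ.
       replace (F * INR d ^ k * (y / 2)) with (INR d ^ k * (F * (y / 2))) by ring.
       rewrite Hab. ring. }
  rewrite sin2_shift in HL.
  assert (Hs := sin2_ge_ninth _ Hds).
  assert (Hsq : (/ 2 ^ k) ^ 2 <= (INR d ^ k * b) ^ 2).
  { rewrite <- (pow2_abs (INR d ^ k * b)). apply pow_incr. lra. }
  apply Rmult_le_reg_l with W; [easy|].
  eapply Rle_trans; [|apply HL].
  apply Rle_trans with (X / 2 * ((/ 2 ^ k) ^ 2 / 9)).
  + apply Rle_trans with (W * (c1 * X)).
    * apply Rmult_le_compat_l; [lra|]. apply Rmult_le_compat_r; [lra|apply Rmin_l].
    * right. unfold c1. field. split; [apply pow_nonzero; lra|lra].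
  + apply Rmult_le_compat; try lra. pose proof (pow2_ge_0 (/ 2 ^ k)). lra.
- apply Rnot_le_lt in H1.
  destruct (Z.eq_dec a 0) as [Ha|Ha].
  + left. subst a. rewrite Rmult_0_l, Rplus_0_r in Hab.
    assert (Hyb : Rabs y <= 2 * Rabs b).
    { rewrite <- Hab, Rabs_mult, (Rabs_pos_eq F) by lra.
      unfold Rdiv. rewrite Rabs_mult, (Rabs_pos_eq (/ 2)) by lra. pose proof (Rabs_pos y). nra. }
    assert (HXY : X ^ k = (/ eta) ^ k * Y ^ k).
    { rewrite <- Rpow_mult_distr. f_equal. unfold Y. field. lra. }
    rewrite HXY.
    assert (0 <= (/ eta) ^ k) by lra. assert (0 <= Y ^ k) by (apply pow_le; lra).
    apply Rle_trans with (2 * Rabs b * ((/ eta) ^ k * Y ^ k)).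
    * apply Rmult_le_compat_r; [now apply Rmult_le_pos|easy].
    * nra.
  + right.
    destruct (nfloor_ex (Y / F)) as [I HI].
    { apply Rdiv_le_0_compat; lra. }
    assert (HYF2 : Y / F * F = Y) by (field; lra).
    assert (HIF : INR (I * fact k) <= Y).
    { rewrite mult_INR. fold F. nra. }
    eapply Rle_trans; [|apply (weyl_sum_rational k I N (y / 2) b Y a); try easy].
    * fold F. apply Rle_trans with (c2 * X).
      -- apply Rmult_le_compat_r; [lra|apply Rmin_r].
      -- unfold c2. replace (eta / (2 * F) * (/ (3 * F)) ^ 2 * X) with (Y / F / 2 * (/ (3 * F)) ^ 2)
           by (unfold Y; field; lra).
         apply Rmult_le_compat_r; [apply pow2_ge_0|].
         assert (2 <= Y / F) by nra. lra.
    * unfold Rdiv. rewrite Rabs_mult, (Rabs_pos_eq (/ 2)) by lra. lra.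
    * lra.
    * apply INR_le. apply Rle_trans with (X - 1); [|lra].
      eapply Rle_trans; [apply HIF|]. unfold Y.
      assert (eta <= / 8) by (unfold eta; apply Rinv_le_contravar; lra). nra.
Qed.

(** * Decay of the weight *)

Lemma exp_ge_pow (p : nat) (t : R) : 0 <= t -> t ^ p / INR (fact p) <= exp t.
Proof.
intros Ht. destruct p as [|p].
- simpl. pose proof (exp_ineq1_le t). lra.
- rewrite Efun0_exp. pose proof (Efun0_ge p t Ht).
  replace (t ^ S p / INR (fact (S p))) with (t * (t ^ p / INR (fact (S p)))) by (simpl;
    unfold Rdiv; ring).
  assert (t * (t ^ p / INR (fact (S p))) <= t * Efun 0 t) by now apply Rmult_le_compat_l.
  lra.
Qed.

Lemma exp_half_le (s : R) : 0 <= s <= 1 -> exp (s / 2) <= 1 + s.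
Proof.
intros Hs. pose proof (exp_ineq1_le (- (s / 2))) as H.
assert (He : exp (s / 2) * exp (- (s / 2)) = 1).
{ rewrite <- exp_plus. replace (s / 2 + - (s / 2)) with 0 by ring. apply exp_0. }
pose proof (exp_pos (s / 2)).
apply Rmult_le_reg_r with (1 - s / 2); [lra|].
apply Rle_trans with 1; [|nra]. rewrite <- He. apply Rmult_le_compat_l; lra.
Qed.

Lemma rprod_le (f g : nat -> R) (n : nat) :
  (forall m, (m < n)%nat -> 0 <= f m <= g m) -> 0 <= rprod f n <= rprod g n.
Proof.
induction n as [|n IH]; intros H; simpl; [lra|].
assert (H1 := H n (Nat.lt_succ_diag_r n)).
assert (H2 : 0 <= rprod f n <= rprod g n) by (apply IH; intros; apply H; lia).
split; [apply Rmult_le_pos; lra|apply Rmult_le_compat; lra].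
Qed.

Lemma rprod_exp (f : nat -> R) (n : nat) : rprod (fun m => exp (f m)) n = exp (rsum f n).
Proof.
induction n as [|n IH]; simpl; [now rewrite exp_0|]. now rewrite IH, exp_plus.
Qed.

Lemma rprod_const (a : R) (n : nat) : rprod (fun _ => a) n = a ^ n.
Proof. induction n as [|n IH]; simpl; [easy|]. rewrite IH; ring. Qed.

Lemma sin_sqr_le1 (x : R) : 0 <= sin x ^ 2 <= 1.
Proof. split; [apply pow2_ge_0|]. pose proof (SIN_bound x). nra. Qed.

(** About [X / C0] factors are each at most [/ (1 + th ^ 2 / 36)] in squared modulus. Grouping them
    into [q] blocks of length [j] and applying Bernoulli's inequality to each block gives
    [(1 + j * th ^ 2 / 36) ^ q], and [j * th ^ 2] is of order [Y ^ 2]. *)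
Lemma weight_decay_major (k q : nat) (C0 : R) : (1 <= k)%nat -> (1 <= q)%nat -> 1 <= C0 ->
  exists K, 0 <= K /\ forall (c X : R) (M : nat) (Y : R), 2 * C0 * INR q <= X -> X <= INR M ->
  Rabs (Y / sqrt X) <= C0 -> Cmod (weight k c X M Y) ^ 2 <= K / (1 + Y ^ 2) ^ q.
Proof.
intros Hk Hq HC0.
assert (Hq1 : 1 <= INR q) by (apply (le_INR 1); lia).
set (kap := / (72 * C0 * INR q)).
assert (HCq : 1 <= C0 * INR q) by nra.
assert (Hkap : 0 < kap <= 1).
{ unfold kap. split; [apply Rinv_0_lt_compat; lra|]. rewrite <- Rinv_1.
  apply Rinv_le_contravar; lra. }
exists ((/ kap) ^ q). split; [apply pow_le; left; now apply Rinv_0_lt_compat|].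
intros c X M Y HX HM Hth.
assert (HX0 : 2 <= X) by lra.
assert (Hs : 0 < sqrt X) by (apply sqrt_lt_R0; lra).
set (th := Y / sqrt X) in *.
(* Using only the first [j * q <= X / C0] parts keeps [t * |th| / 2] at most [1 / 2], where the sine
   is bounded below linearly. The lower bound [j >= X / (2 C0 q)] explains [72 = 2 * 36] in
   [kap]. *)
destruct (nfloor_ex (X / (C0 * INR q))) as [j Hj].
{ apply Rdiv_le_0_compat; lra. }
assert (Hj1 : INR j * INR q * C0 <= X).
{ replace X with (X / (C0 * INR q) * (C0 * INR q)) by (field; lra). nra. }
assert (Hj2 : X <= INR j * (2 * (C0 * INR q))).
{ assert (2 <= X / (C0 * INR q)).
  { apply Rmult_le_reg_r with (C0 * INR q); [lra|].
    replace (X / (C0 * INR q) * (C0 * INR q)) with X by (field; lra). lra. }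
  replace X with (X / (C0 * INR q) * (C0 * INR q)) by (field; lra). nra. }
assert (HjqX : INR (j * q) <= X).
{ rewrite mult_INR. pose proof (pos_INR j). nra. }
eapply Rle_trans; [apply (Cmod_weight_le k c X M (j * q)); try easy; [lra|]|].
{ apply INR_le. lra. }
set (a := th ^ 2 / 36).
assert (Ha : 0 <= a) by (unfold a; pose proof (pow2_ge_0 th); lra).
apply Rle_trans with (rprod (fun _ => / (1 + a)) (j * q)).
- apply rprod_le. intros m Hm.
  set (t := part_scale k X m).
  assert (Ht : 0 < t) by (apply part_scale_pos; lra).
  assert (HtC : t * C0 <= 1).
  { assert (H : INR (S m) / X <= / C0).
    { apply Rmult_le_reg_r with (X * C0); [nra|].
      replace (INR (S m) / X * (X * C0)) with (INR (S m) * C0) by (field; lra).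
      replace (/ C0 * (X * C0)) with X by (field; lra).
      apply Rle_trans with (INR (j * q) * C0); [|rewrite mult_INR; lra].
      apply Rmult_le_compat_r; [lra|apply le_INR; lia]. }
    assert (H0 : 0 <= INR (S m) / X) by (apply Rdiv_le_0_compat; [apply pos_INR|lra]).
    assert (H1 : / C0 <= 1) by (rewrite <- Rinv_1; apply Rinv_le_contravar; lra).
    assert (t <= INR (S m) / X).
    { unfold t, part_scale. destruct k; [lia|]. set (u := INR (S m) / X) in *.
      change (u * u ^ k <= u). rewrite <- (Rmult_1_r u) at 3. apply Rmult_le_compat_l; [easy|].
      rewrite <- (pow1 k). apply pow_incr; lra. }
    apply Rle_trans with (/ C0 * C0); [apply Rmult_le_compat_r; lra|]. right; field; lra. }
  replace (Y * (t / sqrt X) / 2) with (t * th / 2) by (unfold th; field; lra).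
  assert (Hthm : Rabs (t * th / 2) <= PI / 2).
  { unfold Rdiv. rewrite !Rabs_mult, (Rabs_pos_eq t), (Rabs_pos_eq (/ 2)) by lra.
    pose proof PI2_1. assert (t * Rabs th <= t * C0) by (apply Rmult_le_compat_l; lra). lra. }
  apply sin2_ge_ninth in Hthm.
  assert (Hat : a <= sin (t * th / 2) ^ 2 / t ^ 2).
  { apply Rmult_le_reg_r with (t ^ 2); [now apply pow_lt|].
    set (u := sin (t * th / 2) ^ 2) in *.
    replace (u / t ^ 2 * t ^ 2) with u by (field; lra).
    unfold a. replace (th ^ 2 / 36 * t ^ 2) with ((t * th / 2) ^ 2 / 9) by field. easy. }
  split; [left; apply Rinv_0_lt_compat; lra|]. apply Rinv_le_contravar; lra.
- rewrite rprod_const, pow_inv.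
  assert (HB : (kap * (1 + Y ^ 2)) ^ q <= (1 + a) ^ (j * q)).
  { rewrite pow_mult. pose proof (pow2_ge_0 Y). apply pow_incr. split; [apply Rmult_le_pos; lra|].
    apply Rle_trans with (1 + INR j * a).
    - assert (HY2 : Y ^ 2 = th ^ 2 * X).
      { unfold th. rewrite <- (pow2_sqrt X) at 2 by lra. field. lra. }
      assert (kap * Y ^ 2 <= INR j * a); [|lra].
      rewrite HY2. unfold a.
      apply Rle_trans with (kap * (th ^ 2 * (INR j * (2 * (C0 * INR q))))).
      + apply Rmult_le_compat_l; [lra|]. apply Rmult_le_compat_l; [apply pow2_ge_0|easy].
      + right. unfold kap. field. lra.
    - destruct Ha as [Ha|<-].
      + now apply poly.
      + rewrite Rmult_0_r, !Rplus_0_r, pow1. lra. }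
  rewrite Rpow_mult_distr in HB.
  assert (0 < kap ^ q) by (apply pow_lt; lra).
  assert (0 < (1 + Y ^ 2) ^ q) by (apply pow_lt; pose proof (pow2_ge_0 Y); lra).
  rewrite pow_inv. unfold Rdiv. rewrite <- Rinv_mult.
  apply Rinv_le_contravar; [now apply Rmult_lt_0_compat|easy].
Qed.

(** From [/ (1 + s) <= exp (- s / 2)] the weight is exponentially small in [X], whereas [|Y|] is at
    most a power of [X] on a period; any power of [1 + Y ^ 2] is thus absorbed. *)
Lemma weight_decay_minor (k q : nat) (c1 : R) : (1 <= k)%nat -> 0 < c1 ->
  exists K, 0 <= K /\ forall (c X : R) (M N : nat) (Y : R), 1 <= X -> X <= INR M -> INR N <= X ->
  Rabs Y <= PI * sqrt X * X ^ k -> c1 * X <= weyl_sum k (Y / sqrt X / X ^ k / 2) N ->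
  Cmod (weight k c X M Y) ^ 2 <= K / (1 + Y ^ 2) ^ q.
Proof.
intros Hk Hc1.
set (p := ((2 * k + 1) * q)%nat). set (K := 17 ^ q * (INR (fact p) / (c1 / 2) ^ p)).
assert (Hcp : 0 < (c1 / 2) ^ p) by (apply pow_lt; lra).
assert (Hfp := INR_fact_lt_0 p).
exists K. split.
{ unfold K. apply Rmult_le_pos; [apply pow_le; lra|]. left. now apply Rdiv_lt_0_compat. }
intros c X M N Y HX HM HN HY HW.
assert (Hs : 0 < sqrt X) by (apply sqrt_lt_R0; lra).
assert (HXk : 0 < X ^ k) by (apply pow_lt; lra).
eapply Rle_trans; [apply (Cmod_weight_le k c X M N); try easy; [lra|]|].
{ apply INR_le. lra. }
set (z := Y / sqrt X / X ^ k / 2) in *.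
assert (HE : rprod (fun m => / (1 + sin (Y * (part_scale k X m / sqrt X) / 2) ^ 2 / part_scale k
  X m ^ 2)) N
   <= exp (- (c1 * X / 2))).
{ apply Rle_trans with (rprod (fun m => exp (- / 2 * sin (z * INR (S m) ^ k) ^ 2)) N).
  - apply rprod_le. intros m Hm. set (t := part_scale k X m).
    assert (Ht : 0 < t) by (apply part_scale_pos; lra).
    assert (Ht1 : t <= 1).
    { unfold t, part_scale. rewrite <- (pow1 k). apply pow_incr. split.
      - apply Rdiv_le_0_compat; [apply pos_INR|lra].
      - apply Rmult_le_reg_r with X; [lra|]. unfold Rdiv.
        rewrite Rmult_assoc, Rinv_l, Rmult_1_l, Rmult_1_r by lra.
        apply Rle_trans with (INR N); [apply le_INR; lia|easy]. }
    replace (Y * (t / sqrt X) / 2) with (z * INR (S m) ^ k).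
    2: { assert (Htt : t = INR (S m) ^ k / X ^ k)
         by (unfold t, part_scale, Rdiv; now rewrite Rpow_mult_distr, pow_inv).
       rewrite Htt. unfold z. field. lra. }
    set (s := sin (z * INR (S m) ^ k) ^ 2).
    assert (Hs1 : 0 <= s <= 1) by apply sin_sqr_le1.
    assert (Hst : s <= s / t ^ 2).
    { apply Rmult_le_reg_r with (t ^ 2); [now apply pow_lt|].
      unfold Rdiv. rewrite Rmult_assoc, Rinv_l, Rmult_1_r by (apply pow_nonzero; lra).
      assert (t ^ 2 <= 1) by nra. nra. }
    split; [left; apply Rinv_0_lt_compat; lra|].
    replace (- / 2 * s) with (- (s / 2)) by field. rewrite exp_Ropp.
    apply Rinv_le_contravar; [apply exp_pos|]. pose proof (exp_half_le s Hs1). lra.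
  - rewrite rprod_exp, rsum_scal. fold (weyl_sum k z N).
    destruct (Rle_lt_or_eq_dec _ _ HW) as [H|H].
    + left. apply exp_increasing. lra.
    + rewrite <- H. right. f_equal. field. }
eapply Rle_trans; [apply HE|].
(* The constant 17 bounds [1 + PI ^ 2], through [PI <= 4]. *)
assert (HY2 : (1 + Y ^ 2) ^ q <= 17 ^ q * X ^ p).
{ unfold p. rewrite pow_mult, <- Rpow_mult_distr. apply pow_incr.
  pose proof (pow2_ge_0 Y). split; [lra|].
  assert (H1 : 1 <= X ^ (2 * k + 1)) by (now apply pow_R1_Rle).
  assert (H2 : Y ^ 2 <= PI ^ 2 * X ^ (2 * k + 1)).
  { rewrite <- (pow2_abs Y). apply Rle_trans with ((PI * sqrt X * X ^ k) ^ 2).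
    - apply pow_incr. split; [apply Rabs_pos|easy].
    - right. rewrite !Rpow_mult_distr, pow2_sqrt, pow_add, pow_1, <- pow_mult, (Nat.mul_comm k 2)
      by lra. ring. }
  pose proof PI_4. pose proof PI_RGT_0. assert (PI ^ 2 <= 16) by nra. nra. }
assert (HX2 : 0 <= c1 * X / 2) by nra.
pose proof (exp_ge_pow p _ HX2) as Hexp.
replace ((c1 * X / 2) ^ p) with ((c1 / 2) ^ p * X ^ p) in Hexp by (rewrite <- Rpow_mult_distr;
  f_equal; field).
assert (0 < (1 + Y ^ 2) ^ q) by (apply pow_lt; pose proof (pow2_ge_0 Y); lra).
apply Rmult_le_reg_r with ((1 + Y ^ 2) ^ q); [easy|].
replace (K / (1 + Y ^ 2) ^ q * (1 + Y ^ 2) ^ q) with K by (field; lra).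
rewrite exp_Ropp. pose proof (exp_pos (c1 * X / 2)) as Hep.
apply Rmult_le_reg_l with (exp (c1 * X / 2)); [easy|].
rewrite <- Rmult_assoc, Rinv_r, Rmult_1_l by lra.
eapply Rle_trans; [apply HY2|].
apply Rle_trans with ((c1 / 2) ^ p * X ^ p / INR (fact p) * K).
- right. unfold K. field. split; [apply pow_nonzero|]; lra.
- apply Rmult_le_compat_r; [|easy]. unfold K. apply Rmult_le_pos; [apply pow_le; lra|].
  left. now apply Rdiv_lt_0_compat.
Qed.

(** The quantity [Y / sqrt X / X ^ k] is the angle attached to the part 1 and runs over
    [[- PI, PI]]; the dichotomy for [weyl_sum] sends it to one of the two preceding bounds. *)
Lemma weight_decay (k q : nat) : (1 <= k)%nat ->
  exists K X0, 0 <= K /\ 1 <= X0 /\ forall (c X : R) (M : nat) (Y : R), X0 <= X -> X <= INR M ->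
  Rabs Y <= PI * sqrt X * X ^ k -> Cmod (weight k c X M Y) <= K / (1 + Y ^ 2) ^ q.
Proof.
intros Hk.
destruct (weyl_sum_minor k Hk) as [C0 [c1 [X1 [HC0 [Hc1 [HX1 Hminor]]]]]].
(* The squared modulus needs exponent [2 q]; [2 q + 1] stays positive when [q = 0], as the major arc
   bound requires. *)
destruct (weight_decay_major k (S (2 * q)) C0 Hk ltac:(lia) HC0) as [K1 [HK1 Hmaj]].
destruct (weight_decay_minor k (S (2 * q)) c1 Hk Hc1) as [K2 [HK2 Hmin]].
exists (1 + K1 + K2), (X1 + 2 * C0 * INR (S (2 * q))).
assert (HCq : 0 < C0 * INR (S (2 * q))) by (apply Rmult_lt_0_compat; [lra|apply lt_0_INR; lia]).
split; [lra|]. split; [lra|].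
intros c X M Y HX HM HY.
assert (Hs : 0 < sqrt X) by (apply sqrt_lt_R0; lra).
assert (HXk : 0 < X ^ k) by (apply pow_lt; lra).
assert (HY2 := pow2_ge_0 Y).
assert (Hsq : Cmod (weight k c X M Y) ^ 2 <= (1 + K1 + K2) / (1 + Y ^ 2) ^ (S (2 * q))).
{ destruct (nfloor_ex X ltac:(lra)) as [N HN].
  destruct (Hminor X N (Y / sqrt X / X ^ k)) as [H|H]; try lra.
  - unfold Rdiv. rewrite !Rabs_mult, (Rabs_pos_eq (/ sqrt X)), (Rabs_pos_eq (/ X ^ k))
      by (left; now apply Rinv_0_lt_compat).
    apply Rmult_le_reg_r with (sqrt X * X ^ k); [now apply Rmult_lt_0_compat|].
    replace (Rabs Y * / sqrt X * / X ^ k * (sqrt X * X ^ k)) with (Rabs Y) by (field; lra). lra.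
  - eapply Rle_trans; [apply Hmaj; try easy; [lra|]|].
    + replace (Y / sqrt X) with (Y / sqrt X / X ^ k * X ^ k) by (field; lra).
      rewrite Rabs_mult, (Rabs_pos_eq (X ^ k)) by lra. easy.
    + apply Rmult_le_compat_r; [|lra]. left. apply Rinv_0_lt_compat, pow_lt. lra.
  - eapply Rle_trans; [apply (Hmin c X M N Y); try easy; lra|].
    apply Rmult_le_compat_r; [|lra]. left. apply Rinv_0_lt_compat, pow_lt. lra. }
apply Rsqr_incr_0_var.
2: { apply Rdiv_le_0_compat; [lra|]. apply pow_lt; lra. }
unfold Rsqr. replace (Cmod (weight k c X M Y) * Cmod (weight k c X M Y)) with (Cmod (weight k c X
  M Y) ^ 2) by ring.
eapply Rle_trans; [apply Hsq|].
assert (Hp : 1 <= (1 + Y ^ 2) ^ (2 * q)) by (apply pow_R1_Rle; lra).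
replace ((1 + K1 + K2) / (1 + Y ^ 2) ^ q * ((1 + K1 + K2) / (1 + Y ^ 2) ^ q))
  with ((1 + K1 + K2) ^ 2 / (1 + Y ^ 2) ^ (2 * q)).
2: { replace (2 * q)%nat with (q + q)%nat by lia. rewrite pow_add. field. apply pow_nonzero; lra. }
apply Rmult_le_compat.
- lra.
- left. apply Rinv_0_lt_compat, pow_lt. lra.
- nra.
- apply Rinv_le_contravar; [lra|]. apply Rle_pow; [lra|lia].
Qed.

(** * Moments of the weight *)

(* [rot j z = Re (i ^ j * z)]. *)
Fixpoint rot (j : nat) (z : C) : R :=
  match j with O => Re z | S p => rot p (Cmult Ci z) end.

Lemma rot_SS (j : nat) (z : C) : rot (S (S j)) z = - rot j z.
Proof.
revert z; induction j as [|j IH]; intros z.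
- destruct z. unfold rot, Re, Cmult, Ci; simpl. ring.
- change (rot (S (S j)) (Cmult Ci z) = - rot j (Cmult Ci z)). apply IH.
Qed.

Lemma rot_Rabs_le (j : nat) (z : C) : Rabs (rot j z) <= Cmod z.
Proof.
revert z; induction j as [|j IH]; intros z; [apply Re_le_Cmod|].
cbn [rot]. eapply Rle_trans; [apply IH|]. rewrite Cmod_mult.
replace (Cmod Ci) with 1; [lra|].
unfold Cmod, Ci; cbn [fst snd]. replace (0 ^ 2 + 1 ^ 2) with 1 by ring. now rewrite sqrt_1.
Qed.

Lemma rot_mult (j : nat) (a b : R) (z : C) :
  rot j (Cmult z (a, b)) = a * rot j z + b * rot (S j) z.
Proof.
revert z; induction j as [|j IH]; intros z.
- destruct z. unfold rot, Re, Cmult, Ci; simpl. ring.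
- cbn [rot]. rewrite Cmult_assoc. rewrite IH. reflexivity.
Qed.

Lemma is_derive_rot (j : nat) (f : R -> C) (y : R) (l : C) :
  is_Cderive f y l -> is_derive (fun y => rot j (f y)) y (rot j l).
Proof.
revert f l; induction j as [|j IH]; intros f l [H1 H2]; [exact H1|].
cbn [rot]. apply (IH (fun y => Cmult Ci (f y))). split.
- replace (Re (Cmult Ci l)) with (- Im l) by (unfold Re, Im, Cmult, Ci; simpl; ring).
  eapply is_derive_ext; [|apply (is_derive_opp _ _ _ H2)].
  intros t. unfold opp, Re, Im, Cmult, Ci; simpl. ring.
- replace (Im (Cmult Ci l)) with (Re l) by (unfold Re, Im, Cmult, Ci; simpl; ring).
  eapply is_derive_ext; [|apply H1]. intros t. unfold Re, Im, Cmult, Ci; simpl. ring.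
Qed.

Lemma is_derive_rot_weight (k j : nat) (c X : R) (M : nat) (Y : R) : 0 < X ->
  is_derive (fun Y => rot j (weight k c X M Y)) Y
    (log_weight_re k X M Y * rot j (weight k c X M Y)
     + log_weight_im k c X M Y * rot (S j) (weight k c X M Y)).
Proof.
intros HX. rewrite <- rot_mult. apply is_derive_rot. now apply is_Cderive_weight.
Qed.

Lemma continuous_rot_weight (k j : nat) (c X : R) (M : nat) (Y : R) : 0 < X ->
  continuous (fun Y => rot j (weight k c X M Y)) Y.
Proof. intros HX. eapply is_derive_Rcontinuous, is_derive_rot_weight, HX. Qed.

Lemma continuous_Rpow (j : nat) (y : R) : continuous (fun y => y ^ j) y.
Proof. apply @ex_derive_continuous. auto_derive. easy. Qed.

Lemma continuous_Rmult (f g : R -> R) (y : R) :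
  continuous f y -> continuous g y -> continuous (fun y => f y * g y) y.
Proof. exact (continuous_mult f g y). Qed.

Lemma continuous_Rplus (f g : R -> R) (y : R) :
  continuous f y -> continuous g y -> continuous (fun y => f y + g y) y.
Proof. exact (continuous_plus f g y). Qed.

(** The majorant has integral at most [PI * K] over every interval, so the bound is uniform as the
    period grows. *)
Lemma RInt_arctan_bound (f : R -> R) (K P : R) : 0 <= P -> (forall y, continuous f y) ->
  (forall y, Rabs y <= P -> Rabs (f y) <= K / (1 + y ^ 2)) -> Rabs (RInt f (- P) P) <= 4 * K.
Proof.
intros HP Hc Hf.
assert (HK : 0 <= K).
{ specialize (Hf 0). rewrite Rabs_R0 in Hf. specialize (Hf HP). pose proof (Rabs_pos (f 0)).
  replace (K / (1 + 0 ^ 2)) with K in Hf by field. lra. }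
assert (HI : is_RInt (fun y => K / (1 + y ^ 2)) (- P) P (K * atan P - K * atan (- P))).
{ apply (is_RInt_derive (fun y => K * atan y)).
  - intros x _. auto_derive; [easy|]. unfold Rsqr. field. pose proof (pow2_ge_0 x). nra.
  - intros x _. apply @ex_derive_continuous. auto_derive. pose proof (pow2_ge_0 x). nra. }
assert (Hle : Rabs (RInt f (- P) P) <= K * atan P - K * atan (- P)).
{ rewrite <- (is_RInt_unique _ _ _ _ HI).
  assert (ex_RInt f (- P) P) by now apply ex_RInt_cont.
  eapply Rle_trans; [apply abs_RInt_le; [lra|easy]|].
  apply RInt_le; [lra| |now exists (K * atan P - K * atan (- P))|].
  - apply ex_RInt_cont. intros v. apply (continuous_comp f Rabs); [apply Hc|apply continuous_Rabs].
  - intros x Hx. apply Hf. apply Rabs_le. lra. }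
pose proof (atan_bound P). pose proof (atan_bound (- P)). pose proof PI_4. nra.
Qed.

Definition half_period (k : nat) (X : R) : R := PI * sqrt X * X ^ k.

(* [moment j = Re (int (i * Y) ^ j * weight Y dY)]. *)
Definition moment (k : nat) (c X : R) (M j : nat) : R :=
  RInt (fun Y => Y ^ j * rot j (weight k c X M Y)) (- half_period k X) (half_period k X).

Lemma half_period_pos (k : nat) (X : R) : 0 < X -> 0 < half_period k X.
Proof.
intros HX. unfold half_period. apply Rmult_lt_0_compat; [|now apply pow_lt].
apply Rmult_lt_0_compat; [apply PI_RGT_0|now apply sqrt_lt_R0].
Qed.

(** Consequently [(1 + Y ^ 2) ^ -2] is [O(X ^ -2)] at the ends of the period, which is the accuracy
    [e ^ 4] kept in the moment equations. *)
Lemma half_period_sqr_ge (k : nat) (X : R) : 1 <= X -> X <= half_period k X ^ 2.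
Proof.
intros HX. unfold half_period. rewrite !Rpow_mult_distr, pow2_sqrt by lra.
assert (1 <= X ^ k) by (now apply pow_R1_Rle). pose proof PI2_1.
assert (1 <= PI ^ 2) by nra. assert (1 <= (X ^ k) ^ 2) by nra.
assert (X <= PI ^ 2 * X) by nra. nra.
Qed.

Lemma Rabs_pow_le_quad (y : R) (j : nat) : Rabs y ^ j <= (1 + y ^ 2) ^ j.
Proof.
apply pow_incr. split; [apply Rabs_pos|]. rewrite <- (pow2_abs y).
pose proof (pow2_ge_0 (Rabs y - 1)). pose proof (pow2_ge_0 (Rabs y)). nra.
Qed.

Lemma weight_pow_bound (k j q : nat) : (1 <= k)%nat ->
  exists K X0, 0 <= K /\ 1 <= X0 /\ forall (c X : R) (M : nat) (Y : R), X0 <= X -> X <= INR M ->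
  Rabs Y <= half_period k X -> Rabs Y ^ j * Cmod (weight k c X M Y) <= K / (1 + Y ^ 2) ^ q.
Proof.
intros Hk. destruct (weight_decay k (j + q) Hk) as [K [X0 [HK [HX0 H]]]].
exists K, X0. split; [easy|]. split; [easy|]. intros c X M Y HX HM HY.
specialize (H c X M Y HX HM HY).
pose proof (Rabs_pow_le_quad Y j) as Hj.
assert (H1 : 0 < 1 + Y ^ 2) by (pose proof (pow2_ge_0 Y); lra).
apply Rle_trans with ((1 + Y ^ 2) ^ j * (K / (1 + Y ^ 2) ^ (j + q))).
- apply Rmult_le_compat; try easy; [apply pow_le, Rabs_pos|apply Cmod_ge_0].
- right. rewrite pow_add. field. split; apply pow_nonzero; lra.
Qed.

Lemma cube_ge (X : R) (M : nat) : 1 <= X -> X ^ 3 <= INR M -> X <= INR M.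
Proof. intros HX HM. assert (X <= X ^ 3); [|lra]. simpl. nra. Qed.

Lemma moment_bound (k j : nat) (c : R) : (1 <= k)%nat ->
  exists K X0, 0 <= K /\ 1 <= X0 /\ forall (X : R) (M : nat), X0 <= X -> X ^ 3 <= INR M ->
  Rabs (moment k c X M j) <= K.
Proof.
intros Hk. destruct (weight_pow_bound k j 1 Hk) as [K [X0 [HK [HX0 H]]]].
exists (4 * K), X0. split; [lra|]. split; [easy|]. intros X M HX HM.
apply RInt_arctan_bound.
- left. apply half_period_pos. lra.
- intros y. apply continuous_Rmult; [apply continuous_Rpow|apply continuous_rot_weight; lra].
- intros y Hy. specialize (H c X M y HX (cube_ge X M ltac:(lra) HM) Hy). rewrite pow_1 in H.
  eapply Rle_trans; [|apply H]. rewrite Rabs_mult, <- RPow_abs.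
  apply Rmult_le_compat_l; [apply pow_le, Rabs_pos|apply rot_Rabs_le].
Qed.

Lemma psi_sum_bounded (k i : nat) : (1 <= k)%nat -> exists K, 0 <= K /\
  forall (X : R) (M : nat), 1 <= X -> X ^ 3 <= INR M -> 0 <= psi_sum k i X M / X <= K.
Proof.
intros Hk. destruct (psi_sum_asymptotic k i Hk) as [C [HC H]].
exists (Rabs (saddle_const k i) + C). split; [pose proof (Rabs_pos (saddle_const k i)); lra|].
intros X M HX HM. specialize (H X M HX HM).
assert (HX1 : 0 < / X <= 1).
{ split; [apply Rinv_0_lt_compat; lra|]. rewrite <- Rinv_1. apply Rinv_le_contravar; lra. }
split.
- apply Rdiv_le_0_compat; [|lra]. apply rsum_nonneg. intros m _. apply psi_nonneg.
  apply pow_lt, Rdiv_lt_0_compat; [apply lt_0_INR; lia|lra].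
- apply Rmult_le_reg_r with X; [lra|]. unfold Rdiv. rewrite Rmult_assoc, Rinv_l, Rmult_1_r by lra.
  pose proof (pos_INR (fact i)). pose proof (Rle_abs (saddle_const k i)).
  apply Rabs_le_between in H. unfold Rdiv in H.
  assert (C * / X <= C * 1) by (apply Rmult_le_compat_l; lra). nra.
Qed.

Lemma rsum_continuous (f : nat -> R -> R) (n : nat) (y : R) :
  (forall m, continuous (f m) y) -> continuous (fun y => rsum (fun m => f m y) n) y.
Proof.
intros H. induction n as [|n IH]; [apply continuous_const|].
cbn [rsum]. now apply continuous_Rplus.
Qed.

Lemma continuous_log_weight (k : nat) (c X : R) (M : nat) (Y : R) : 0 < X ->
  continuous (log_weight_re k X M) Y /\ continuous (log_weight_im k c X M) Y.
Proof.
intros HX.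
assert (Hg : forall q a, 0 < q < 1 -> continuous (fun y => Re (geom_sum q (y * a))) Y
   /\ continuous (fun y => Im (geom_sum q (y * a))) Y).
{ intros q a Hq. pose proof (geom_denom_sqr_pos q (Y * a) Hq) as HD.
  split; apply @ex_derive_continuous; unfold geom_sum, Cdiv, Cinv; cbn; auto_derive;
    (repeat split; apply Rgt_not_eq; lra). }
split.
- apply (rsum_continuous (fun m y => part_scale k X m / sqrt X *
    Im (geom_sum (exp (- part_scale k X m)) (y * (part_scale k X m / sqrt X))))).
  intros m. apply continuous_Rmult; [apply continuous_const|].
  exact (proj2 (Hg _ (part_scale k X m / sqrt X) (exp_neg_lt1 _ (part_scale_pos k X m HX)))).
- apply (continuous_minus (fun _ => c * sqrt X)); [apply continuous_const|].
  apply (rsum_continuous (fun m y => part_scale k X m / sqrt X *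
    Re (geom_sum (exp (- part_scale k X m)) (y * (part_scale k X m / sqrt X))))).
  intros m. apply continuous_Rmult; [apply continuous_const|].
  exact (proj1 (Hg _ (part_scale k X m / sqrt X) (exp_neg_lt1 _ (part_scale_pos k X m HX)))).
Qed.

(* Integrating the derivative of [Y ^ j * rot (j + 1) (weight Y)] over the period. *)
Lemma moment_equation (k j : nat) (c : R) : (1 <= k)%nat ->
  exists K X0, 0 <= K /\ 1 <= X0 /\ forall (X : R) (M : nat), X0 <= X -> X ^ 3 <= INR M ->
  let e := / sqrt X in let S i := psi_sum k i X M / X in let A := moment k c X M in
  Rabs (S 1%nat * A (j + 1)%nat -
    (- INR j * A (pred j) - e * (c * X - psi_sum k 0 X M) * A j + e * S 2%nat / 2 * A (j + 2)%nat
     - e ^ 2 * S 3%nat / 6 * A (j + 3)%nat + e ^ 3 * S 4%nat / 24 * A (j + 4)%nat)) <= K * e ^ 4.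
Proof.
intros Hk.
(* Decay is used twice: with exponent 2 at the ends of the period, where no cancellation is
   available since [c] is arbitrary, and with exponent 1 for the Taylor remainder, which brings the
   factor [|Y| ^ 5]. *)
destruct (weight_pow_bound k j 2 Hk) as [K1 [X1 [HK1 [HX1 HB1]]]].
destruct (weight_pow_bound k (j + 5) 1 Hk) as [K2 [X2 [HK2 [HX2 HB2]]]].
destruct (psi_sum_bounded k 5 Hk) as [K3 [HK3 HS5]].
exists (2 * K1 + 4 * (2 * K3 * K2)), (X1 + X2).
assert (0 <= K3 * K2) by now apply Rmult_le_pos.
split; [lra|]. split; [lra|].
intros X M HX HM e S A.
assert (HX0 : 0 < X) by lra.
assert (Hs : 0 < sqrt X) by now apply sqrt_lt_R0.
assert (He : 0 < e) by now apply Rinv_0_lt_compat.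
assert (HMX := cube_ge X M ltac:(lra) HM).
set (P := half_period k X).
assert (HP : 0 < P) by now apply half_period_pos.
set (w := weight k c X M).
set (f := fun Y => Y ^ j * rot (j + 1) (w Y)).
set (lr := log_weight_re k X M). set (li := log_weight_im k c X M).
set (pr := fun Y => - S 1%nat * Y + e ^ 2 * S 3%nat / 6 * Y ^ 3).
set (qr := fun Y => e * (c * X - psi_sum k 0 X M) + e * S 2%nat / 2 * Y ^ 2 - e ^ 3 * S 4%nat /
  24 * Y ^ 4).
set (df := fun Y => INR j * Y ^ pred j * rot (j + 1) (w Y)
  + Y ^ j * (lr Y * rot (j + 1) (w Y) + li Y * rot (j + 2) (w Y))).
assert (Hcr : forall i y, continuous (fun Y => rot i (w Y)) y).
{ intros i y. now apply continuous_rot_weight. }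
assert (Hcl : forall y, continuous lr y /\ continuous li y).
{ intros y. now apply continuous_log_weight. }
assert (Hdf : forall Y, is_derive f Y (df Y)).
{ intros Y. unfold f, df. replace (INR j * Y ^ pred j) with (INR j * 1 * Y ^ pred j) by ring.
  apply is_derive_Rmult.
  - apply (is_derive_pow (fun y => y)). apply @is_derive_id.
  - replace (j + 2)%nat with (Datatypes.S (j + 1)) by lia. now apply is_derive_rot_weight. }
assert (Hcdf : forall Y, continuous df Y).
{ intros Y. unfold df. apply continuous_Rplus.
  - apply continuous_Rmult; [|apply Hcr].
    apply continuous_Rmult; [apply continuous_const|apply continuous_Rpow].
  - apply continuous_Rmult; [apply continuous_Rpow|].
    exact (continuous_Rplus _ _ _ (continuous_Rmult _ _ _ (proj1 (Hcl Y)) (Hcr _ Y))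
      (continuous_Rmult _ _ _ (proj2 (Hcl Y)) (Hcr _ Y))). }
assert (HI : is_RInt df (- P) P (f P - f (- P))).
{ apply (is_RInt_derive f); intros; [apply Hdf|apply Hcdf]. }
assert (HE : RInt df (- P) P = f P - f (- P)) by now apply is_RInt_unique.
set (er := fun Y => Y ^ j * ((lr Y - pr Y) * rot (j + 1) (w Y) + (li Y - qr Y) * rot (j + 2) (w
  Y))).
assert (Hcpq : forall Y, continuous pr Y /\ continuous qr Y).
{ intros Y. split; apply @ex_derive_continuous; unfold pr, qr; auto_derive; easy. }
assert (Hcer : forall Y, continuous er Y).
{ intros Y. unfold er. apply continuous_Rmult; [apply continuous_Rpow|].
  exact (continuous_Rplus _ _ _
    (continuous_Rmult _ _ _ (continuous_minus lr pr Y (proj1 (Hcl Y)) (proj1 (Hcpq Y))) (Hcr _ Y))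
    (continuous_Rmult _ _ _ (continuous_minus li qr Y (proj2 (Hcl Y)) (proj2 (Hcpq Y))) (Hcr _
      Y))). }
assert (Hmain : RInt df (- P) P - RInt er (- P) P =
   - INR j * A (pred j) - S 1%nat * A (j + 1)%nat - e ^ 2 * S 3%nat / 6 * A (j + 3)%nat
   - e * (c * X - psi_sum k 0 X M) * A j + e * S 2%nat / 2 * A (j + 2)%nat
   + e ^ 3 * S 4%nat / 24 * A (j + 4)%nat).
{ set (g := fun i Y => Y ^ i * rot i (w Y)).
  assert (Hg : forall i, is_RInt (g i) (- P) P (A i)).
  { intros i. apply @RInt_correct. apply ex_RInt_cont. intros v.
    apply continuous_Rmult; [apply continuous_Rpow|apply Hcr]. }
  assert (Hlin : forall a b u v iu iv, is_RInt u (- P) P iu -> is_RInt v (- P) P iv ->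
    is_RInt (fun y => a * u y + b * v y) (- P) P (a * iu + b * iv)).
  { intros a b u v iu iv Hu Hv.
    apply (is_RInt_plus (fun y => a * u y) (fun y => b * v y)).
    - now apply (is_RInt_scal u _ _ a).
    - now apply (is_RInt_scal v _ _ b). }
  assert (Hdf' : is_RInt df (- P) P (RInt df (- P) P)) by (apply @RInt_correct;
    now apply ex_RInt_cont).
  assert (Her' : is_RInt er (- P) P (RInt er (- P) P)) by (apply @RInt_correct;
    now apply ex_RInt_cont).
  pose proof (Hlin 1 (-1) _ _ _ _ Hdf' Her') as H1.
  pose proof (Hlin (- INR j) (- S 1%nat) _ _ _ _ (Hg (pred j)) (Hg (j + 1)%nat)) as H2.
  pose proof (Hlin (- (e ^ 2 * S 3%nat / 6)) (- (e * (c * X - psi_sum k 0 X M))) _ _ _ _ (Hg (j +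
    3)%nat) (Hg j)) as H3.
  pose proof (Hlin (e * S 2%nat / 2) (e ^ 3 * S 4%nat / 24) _ _ _ _ (Hg (j + 2)%nat) (Hg (j +
    4)%nat)) as H4.
  pose proof (Hlin 1 1 _ _ _ _ (Hlin 1 1 _ _ _ _ H2 H3) H4) as H5.
  assert (HH : is_RInt (fun y => 1 * df y + -1 * er y) (- P) P
    (1 * (1 * (- INR j * A (pred j) + - S 1%nat * A (j + 1)%nat) +
        1 * (- (e ^ 2 * S 3%nat / 6) * A (j + 3)%nat + - (e * (c * X - psi_sum k 0 X M)) * A j)) +
     1 * (e * S 2%nat / 2 * A (j + 2)%nat + e ^ 3 * S 4%nat / 24 * A (j + 4)%nat))).
  { eapply is_RInt_ext; [|exact H5]. intros y _. unfold g, df, er, pr, qr.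
    replace (j + 1)%nat with (Datatypes.S j) by lia.
    replace (j + 2)%nat with (Datatypes.S (Datatypes.S j)) by lia.
    replace (j + 3)%nat with (Datatypes.S (Datatypes.S (Datatypes.S j))) by lia.
    replace (j + 4)%nat with (Datatypes.S (Datatypes.S (Datatypes.S (Datatypes.S j)))) by lia.
    rewrite !rot_SS.
    (* For [j = 0] the truncated predecessor is harmless, its coefficient being 0. *)
    assert (Hpred : INR j * y ^ pred j * rot (Datatypes.S j) (w y) = - (INR j * y ^ pred j * rot
      (pred j) (w y))).
    { destruct j as [|j']; [simpl; ring|]. rewrite rot_SS. simpl pred. ring. }
    match goal with |- ?a = ?b => change (@eq R a b) end.
    rewrite Hpred. cbn [pow]. ring. }
  pose proof (is_RInt_unique (V := R_CompleteNormedModule) _ _ _ _ H1) as U1.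
  pose proof (is_RInt_unique (V := R_CompleteNormedModule) _ _ _ _ HH) as U2.
  rewrite U2 in U1. lra. }
assert (Hbd : forall Y, Rabs Y = P -> Rabs (f Y) <= K1 * e ^ 4).
{ intros Y HY. unfold f. rewrite Rabs_mult, <- RPow_abs.
  apply Rle_trans with (Rabs Y ^ j * Cmod (w Y)).
  - apply Rmult_le_compat_l; [apply pow_le, Rabs_pos|apply rot_Rabs_le].
  - eapply Rle_trans; [apply HB1; try easy; [lra|fold P; lra]|].
    apply Rmult_le_compat_l; [easy|]. unfold e. rewrite pow_inv.
    apply Rinv_le_contravar; [now apply pow_lt|].
    replace (sqrt X ^ 4) with (X ^ 2) by (rewrite <- (pow2_sqrt X) at 1 by lra; ring).
    apply pow_incr. split; [lra|]. rewrite <- (pow2_abs Y), HY.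
    pose proof (half_period_sqr_ge k X ltac:(lra)). fold P in H0. lra. }
assert (Her : Rabs (RInt er (- P) P) <= 4 * (2 * K3 * K2 * e ^ 4)).
{ apply RInt_arctan_bound; [lra|easy|]. intros Y HY.
  destruct (log_weight_taylor k c X M Y HX0) as [T1 T2]. fold e lr li in T1, T2.
  destruct (HS5 X M ltac:(lra) HM) as [Ha Hb].
  assert (HB := HB2 c X M Y ltac:(lra) HMX HY). rewrite pow_1 in HB. fold w in HB.
  unfold er. rewrite Rabs_mult, <- RPow_abs.
  set (W := Cmod (w Y)) in *. assert (HW : 0 <= W) by apply Cmod_ge_0.
  set (E := e ^ 4 * K3 * Rabs Y ^ 5).
  assert (HY5 : 0 <= Rabs Y ^ 5) by (apply pow_le, Rabs_pos).
  assert (He4 : 0 < e ^ 4) by now apply pow_lt.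
  assert (HEt : e ^ 4 * (psi_sum k 5 X M / X) * Rabs Y ^ 5 <= E).
  { unfold E. apply Rmult_le_compat_r; [easy|]. apply Rmult_le_compat_l; lra. }
  assert (Hsum : Rabs ((lr Y - pr Y) * rot (j + 1) (w Y) + (li Y - qr Y) * rot (j + 2) (w Y)) <=
    2 * E * W).
  { eapply Rle_trans; [apply Rabs_triang|]. rewrite !Rabs_mult.
    pose proof (rot_Rabs_le (j + 1) (w Y)). pose proof (rot_Rabs_le (j + 2) (w Y)).
    assert (Rabs (lr Y - pr Y) * Rabs (rot (j + 1) (w Y)) <= E * W).
    { apply Rmult_le_compat; try apply Rabs_pos; [|easy]. eapply Rle_trans; [apply T1|easy]. }
    assert (Rabs (li Y - qr Y) * Rabs (rot (j + 2) (w Y)) <= E * W).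
    { apply Rmult_le_compat; try apply Rabs_pos; [|easy]. eapply Rle_trans; [apply T2|easy]. }
    lra. }
  apply Rle_trans with (Rabs Y ^ j * (2 * E * W)).
  - apply Rmult_le_compat_l; [apply pow_le, Rabs_pos|easy].
  - replace (Rabs Y ^ j * (2 * E * W)) with (2 * K3 * e ^ 4 * (Rabs Y ^ (j + 5) * W))
      by (unfold E; rewrite pow_add; ring).
    replace (2 * K3 * K2 * e ^ 4 / (1 + Y ^ 2)) with (2 * K3 * e ^ 4 * (K2 / (1 + Y ^ 2)))
      by (unfold Rdiv; ring).
    apply Rmult_le_compat_l; [|easy]. apply Rmult_le_pos; lra. }
assert (B1 := Hbd P (Rabs_pos_eq P ltac:(lra))).
assert (B2 := Hbd (- P) ltac:(rewrite Rabs_Ropp; apply Rabs_pos_eq; lra)).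
rewrite HE in Hmain.
match goal with |- Rabs ?x <= _ => replace x with (- (f P) + f (- P) + RInt er (- P) P) by lra end.
eapply Rle_trans; [apply Rabs_triang|].
replace ((2 * K1 + 4 * (2 * K3 * K2)) * e ^ 4) with (K1 * e ^ 4 + K1 * e ^ 4 + 4 * (2 * K3 * K2 *
  e ^ 4)) by ring.
apply Rplus_le_compat; [|easy].
eapply Rle_trans; [apply Rabs_triang|]. rewrite Rabs_Ropp. lra.
Qed.

(** * Lower bound on the total mass *)

Lemma inv_sqrt_le (d X : R) : 0 < d -> 1 <= X -> / d ^ 2 <= X -> / sqrt X <= d.
Proof.
intros Hd HX H. assert (Hs : 0 < sqrt X) by (apply sqrt_lt_R0; lra).
assert (H1 : / d <= sqrt X).
{ rewrite <- (sqrt_Rsqr (/ d)) by (left; now apply Rinv_0_lt_compat).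
  apply sqrt_le_1_alt. unfold Rsqr. rewrite <- Rinv_mult. simpl in H. rewrite Rmult_1_r in H.
  easy. }
rewrite <- (Rinv_inv d). apply Rinv_le_contravar; [now apply Rinv_0_lt_compat|easy].
Qed.

Lemma inv_sqrt_bounds (X : R) : 1 <= X -> 0 < / sqrt X <= 1.
Proof.
intros HX. assert (1 <= sqrt X) by (rewrite <- sqrt_1; now apply sqrt_le_1_alt).
split; [apply Rinv_0_lt_compat; lra|]. rewrite <- Rinv_1. apply Rinv_le_contravar; lra.
Qed.

Lemma inv_sqrt_sqr (X : R) : 0 < X -> (/ sqrt X) ^ 2 = / X.
Proof. intros HX. rewrite pow_inv, pow2_sqrt; lra. Qed.

Lemma inv_sqrt_div (X : R) : 0 < X -> / sqrt X = sqrt X / X.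
Proof.
intros HX. assert (Hs : 0 < sqrt X) by now apply sqrt_lt_R0.
rewrite <- (sqrt_sqrt X) at 3 by lra. field. lra.
Qed.

Lemma Cprod_one (f : nat -> C) (n : nat) : (forall m, f m = 1%C) -> Cprod f n = 1%C.
Proof.
intros H. induction n as [|n IH]; [easy|]. cbn [Cprod]. rewrite IH, H. ring.
Qed.

Lemma weight_at0 (k : nat) (c X : R) (M : nat) : 0 < X -> weight k c X M 0 = 1%C.
Proof.
intros HX. unfold weight. rewrite Cprod_one.
- rewrite Rmult_0_r. unfold cis. rewrite cos_0, sin_0. now rewrite Cmult_1_r.
- intros m. rewrite Rmult_0_l. unfold geom_factor, geom_ratio.
  rewrite cos_0, sin_0, Rmult_1_r, Rmult_0_r, Ropp_0.
  destruct (exp_neg_lt1 _ (part_scale_pos k X m HX)).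
  set (q := exp _) in *. change ((q, 0) : C) with (RtoC q).
  rewrite <- RtoC_minus, <- RtoC_div by lra. now rewrite Rdiv_diag by lra.
Qed.

Lemma main_term_bounded (k : nat) : (1 <= k)%nat -> exists K, 0 <= K /\
  forall (X : R) (M : nat), 1 <= X -> X ^ 3 <= INR M ->
  Rabs (saddle_const k 0 * X - psi_sum k 0 X M) <= K.
Proof.
intros Hk. destruct (psi_sum_asymptotic k 0 Hk) as [C [HC H]].
exists (1 + C). split; [lra|]. intros X M HX HM. specialize (H X M HX HM).
assert (C / X <= C).
{ apply Rle_trans with (C * / 1); [|lra]. apply Rmult_le_compat_l; [easy|].
  apply Rinv_le_contravar; lra. }
simpl fact in H. simpl INR in H. apply Rabs_le_between in H. apply Rabs_le. lra.
Qed.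

(* The quotient of [weight Y] by [exp (- s Y ^ 2 / 2)], with [s = psi_sum k 1 X M / X],
   has a small derivative on [|Y| <= T]. *)
Lemma weight_gaussian_lower (k : nat) : (1 <= k)%nat ->
  exists B, 0 <= B /\ forall T, 1 <= T -> exists X0, 1 <= X0 /\
  forall (X : R) (M : nat) (Y : R), X0 <= X -> X ^ 3 <= INR M ->
  Rabs Y <= T -> / 2 * exp (- (B * Y ^ 2 / 2)) <= Re (weight k (saddle_const k 0) X M Y).
Proof.
intros Hk.
destruct (main_term_bounded k Hk) as [B0 [HB0 H0]].
destruct (psi_sum_bounded k 1 Hk) as [B1 [HB1 H1]].
destruct (psi_sum_bounded k 2 Hk) as [B2 [HB2 H2]].
destruct (psi_sum_bounded k 3 Hk) as [B3 [HB3 H3]].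
destruct (psi_sum_bounded k 4 Hk) as [B4 [HB4 H4]].
destruct (psi_sum_bounded k 5 Hk) as [B5 [HB5 H5]].
set (B := B0 + B1 + B2 + B3 + B4 + B5). assert (HB : 0 <= B) by (unfold B; lra).
(* [B] is fixed before [T], because [T] will be chosen in terms of [exp (- B / 2)]. *)
exists B. split; [easy|]. intros T HT.
set (D := exp (B * T ^ 2 / 2) * (5 * B * T ^ 5)).
assert (HT5 : 1 <= T ^ 5) by now apply pow_R1_Rle.
assert (HD : 0 <= D).
{ unfold D. apply Rmult_le_pos; [left; apply exp_pos|]. repeat apply Rmult_le_pos; lra. }
(* The derivative of the quotient is at most [D * e] on [|Y| <= T]. With [e <= d] the quotient,
   which is 1 at 0, moves by at most 1/2. *)
set (d := / (2 * (T * D + 1))).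
assert (HTD : 0 <= T * D) by (apply Rmult_le_pos; lra).
assert (Hd : 0 < d) by (apply Rinv_0_lt_compat; lra).
assert (Hd2 : 0 < / d ^ 2) by (apply Rinv_0_lt_compat, pow_lt; easy).
exists (1 + / d ^ 2). split; [lra|].
intros X M Y HX HM HY.
assert (HX1 : 1 <= X) by lra.
specialize (H0 X M HX1 HM). specialize (H1 X M HX1 HM). specialize (H2 X M HX1 HM).
specialize (H3 X M HX1 HM). specialize (H4 X M HX1 HM). specialize (H5 X M HX1 HM).
set (e := / sqrt X). assert (He : 0 < e <= 1) by now apply inv_sqrt_bounds.
assert (Hed : e <= d) by (apply inv_sqrt_le; lra).
set (c := saddle_const k 0) in *. set (w := weight k c X M).
set (s := psi_sum k 1 X M / X) in *.
set (h := fun y => Re (w y) * exp (s * y ^ 2 / 2)).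
set (h' := fun y => exp (s * y ^ 2 / 2) * ((log_weight_re k X M y + s * y) * rot 0 (w y) +
  log_weight_im k c X M y * rot 1 (w y))).
assert (Hh : forall y, is_derive h y (h' y)).
{ intros y. unfold h, h'.
  pose proof (is_derive_rot_weight k 0 c X M y ltac:(lra)) as Hw. fold w in Hw. cbn [rot] in Hw.
  replace (exp (s * y ^ 2 / 2) * ((log_weight_re k X M y + s * y) * rot 0 (w y) + log_weight_im k
    c X M y * rot 1 (w y)))
   with ((log_weight_re k X M y * Re (w y) + log_weight_im k c X M y * Re (Cmult Ci (w y))) * exp
     (s * y ^ 2 / 2)
     + Re (w y) * (s * y * exp (s * y ^ 2 / 2))) by (cbn [rot]; ring).
  apply (is_derive_Rmult (fun y => Re (w y)) (fun y => exp (s * y ^ 2 / 2))); [exact Hw|].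
  auto_derive; [easy|]. unfold Rdiv. simpl pow. field. }
assert (Hbound : forall y, Rabs y <= T -> Rabs (h' y) <= D * e).
{ intros y Hy. unfold h'. rewrite Rabs_mult, (Rabs_pos_eq (exp _)) by (left; apply exp_pos).
  destruct (log_weight_taylor k c X M y ltac:(lra)) as [T1 T2]. fold e s in T1, T2.
  assert (Hy0 := Rabs_pos y).
  assert (Hpw : forall i, (i <= 5)%nat -> 0 <= Rabs y ^ i <= T ^ 5).
  { intros i Hi. split; [now apply pow_le|]. apply Rle_trans with (T ^ i); [apply pow_incr; lra|].
    apply Rle_pow; [lra|easy]. }
  assert (Hep : forall i, (1 <= i)%nat -> 0 <= e ^ i <= e).
  { intros i Hi. split; [apply pow_le; lra|]. destruct i; [lia|]. simpl.
    assert (e ^ i <= 1) by (rewrite <- (pow1 i); apply pow_incr; lra). nra. }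
  assert (Hterm : forall i j a K, (1 <= i)%nat -> (j <= 5)%nat -> 0 <= a <= K -> 0 <= e ^ i * a *
    Rabs y ^ j <= e * (K * T ^ 5)).
  { intros i j a K Hi Hj Ha. specialize (Hpw j Hj). specialize (Hep i Hi). split.
    - repeat apply Rmult_le_pos; lra.
    - rewrite Rmult_assoc. apply Rmult_le_compat; try lra; [apply Rmult_le_pos; lra|].
      apply Rmult_le_compat; lra. }
  assert (Q1 := Hterm 2%nat 3%nat _ _ ltac:(lia) ltac:(lia) H3).
  assert (Q2 := Hterm 4%nat 5%nat _ _ ltac:(lia) ltac:(lia) H5).
  assert (Q3 := Hterm 1%nat 2%nat _ _ ltac:(lia) ltac:(lia) H2).
  assert (Q4 := Hterm 3%nat 4%nat _ _ ltac:(lia) ltac:(lia) H4).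
  set (S2 := psi_sum k 2 X M / X) in *. set (S3 := psi_sum k 3 X M / X) in *.
  set (S4 := psi_sum k 4 X M / X) in *. set (S5 := psi_sum k 5 X M / X) in *.
  assert (Hlr : Rabs (log_weight_re k X M y + s * y) <= e * (2 * B * T ^ 5)).
  { replace (log_weight_re k X M y + s * y) with
      ((log_weight_re k X M y - (- s * y + e ^ 2 * S3 / 6 * y ^ 3)) + e ^ 2 * S3 / 6 * y ^ 3) by
        ring.
    eapply Rle_trans; [apply Rabs_triang|].
    assert (Rabs (e ^ 2 * S3 / 6 * y ^ 3) = e ^ 2 * S3 * Rabs y ^ 3 / 6).
    { rewrite Rabs_mult, <- RPow_abs, Rabs_pos_eq; [field|]. apply Rdiv_le_0_compat; [|lra].
      apply Rmult_le_pos; [apply pow_le|]; lra. }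
    assert (e * (B3 * T ^ 5) <= e * (B * T ^ 5)) by (apply Rmult_le_compat_l; [lra|];
      apply Rmult_le_compat_r; unfold B; lra).
    assert (e * (B5 * T ^ 5) <= e * (B * T ^ 5)) by (apply Rmult_le_compat_l; [lra|];
      apply Rmult_le_compat_r; unfold B; lra).
    lra. }
  assert (Hli : Rabs (log_weight_im k c X M y) <= e * (3 * B * T ^ 5)).
  { replace (log_weight_im k c X M y) with
      ((log_weight_im k c X M y - (e * (c * X - psi_sum k 0 X M) + e * S2 / 2 * y ^ 2 - e ^ 3 *
        S4 / 24 * y ^ 4))
       + e * (c * X - psi_sum k 0 X M) + (e * S2 / 2 * y ^ 2) + - (e ^ 3 * S4 / 24 * y ^ 4)) by
         ring.
    eapply Rle_trans; [apply Rabs_triang|]. eapply Rle_trans;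
      [apply Rplus_le_compat_r, Rabs_triang|].
    eapply Rle_trans; [apply Rplus_le_compat_r, Rplus_le_compat_r, Rabs_triang|].
    rewrite Rabs_Ropp.
    assert (Rabs (e * S2 / 2 * y ^ 2) = e ^ 1 * S2 * Rabs y ^ 2 / 2).
    { rewrite Rabs_mult, <- RPow_abs, Rabs_pos_eq; [field|]. apply Rdiv_le_0_compat; [|lra].
      apply Rmult_le_pos; lra. }
    assert (Rabs (e ^ 3 * S4 / 24 * y ^ 4) = e ^ 3 * S4 * Rabs y ^ 4 / 24).
    { rewrite Rabs_mult, <- RPow_abs, Rabs_pos_eq; [field|]. apply Rdiv_le_0_compat; [|lra].
      apply Rmult_le_pos; [apply pow_le|]; lra. }
    assert (Rabs (e * (c * X - psi_sum k 0 X M)) <= e * (B0 * T ^ 5)).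
    { rewrite Rabs_mult, (Rabs_pos_eq e) by lra. apply Rmult_le_compat_l; [lra|]. nra. }
    assert (Hmon : forall b, b <= B -> e * (b * T ^ 5) <= e * (B * T ^ 5)).
    { intros b Hb. apply Rmult_le_compat_l; [lra|]. apply Rmult_le_compat_r; lra. }
    assert (e * (B0 * T ^ 5) + e * (B2 * T ^ 5) + e * (B4 * T ^ 5) <= e * (B * T ^ 5)).
    { rewrite <- !Rmult_plus_distr_l, <- !Rmult_plus_distr_r. apply Hmon. unfold B; lra. }
    assert (e * (B5 * T ^ 5) <= e * (B * T ^ 5)) by (apply Hmon; unfold B; lra).
    lra. }
  assert (Hw1 : forall j, Rabs (rot j (w y)) <= 1).
  { intros j. eapply Rle_trans; [apply rot_Rabs_le|]. apply Cmod_weight_le1. lra. }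
  assert (Hexp : exp (s * y ^ 2 / 2) <= exp (B * T ^ 2 / 2)).
  { assert (s * y ^ 2 <= B * T ^ 2).
    { rewrite <- (pow2_abs y). apply Rmult_le_compat; try lra; [apply pow2_ge_0|unfold B;
      lra|apply pow_incr; lra]. }
    destruct (Rle_lt_or_eq_dec _ _ H) as [Hl| ->]; [|lra]. left. apply exp_increasing. lra. }
  unfold D. rewrite Rmult_assoc. apply Rmult_le_compat; try apply Rabs_pos; [left;
    apply exp_pos|easy|].
  eapply Rle_trans; [apply Rabs_triang|]. rewrite !Rabs_mult.
  assert (Hm : forall a b K, Rabs a <= K -> Rabs b <= 1 -> Rabs a * Rabs b <= K).
  { intros a b K Ha Hb. pose proof (Rabs_pos a). nra. }
  pose proof (Hm _ _ _ Hlr (Hw1 0%nat)). pose proof (Hm _ _ _ Hli (Hw1 1%nat)). lra. }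
assert (HhY : / 2 <= h Y).
{ assert (Hh0 : h 0 = 1).
  { unfold h, w. rewrite weight_at0 by lra. replace (s * 0 ^ 2 / 2) with 0 by field.
    rewrite exp_0. cbn. ring. }
  destruct (MVT_gen h 0 Y h') as [xi [Hxi HE]].
  - intros; apply Hh.
  - intros. apply continuity_pt_filterlim. eapply is_derive_Rcontinuous, Hh.
  - assert (Hxi' : Rabs xi <= T).
    { apply Rabs_le. apply Rabs_le_between in HY. revert Hxi. unfold Rmin, Rmax.
      destruct (Rle_dec 0 Y); lra. }
    specialize (Hbound xi Hxi').
    assert (Rabs (h Y - h 0) <= / 2).
    { rewrite HE, Rabs_mult. replace (Y - 0) with Y by ring.
      apply Rle_trans with (D * e * T); [apply Rmult_le_compat; try apply Rabs_pos; easy|].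
      apply Rle_trans with (D * d * T).
      - apply Rmult_le_compat_r; [lra|]. now apply Rmult_le_compat_l.
      - unfold d. apply Rmult_le_reg_r with (2 * (T * D + 1)); [lra|].
        replace (D * / (2 * (T * D + 1)) * T * (2 * (T * D + 1))) with (T * D) by (field; lra).
        lra. }
    apply Rabs_le_between in H. lra. }
replace (Re (w Y)) with (h Y * exp (- (s * Y ^ 2 / 2))).
2: { unfold h. rewrite Rmult_assoc, <- exp_plus.
replace (s * Y ^ 2 / 2 + - (s * Y ^ 2 / 2)) with 0 by ring.
     rewrite exp_0. ring. }
apply Rmult_le_compat; [lra|left; apply exp_pos|easy|].
assert (s * Y ^ 2 <= B * Y ^ 2) by (apply Rmult_le_compat_r; [apply pow2_ge_0|unfold B; lra]).
destruct (Rle_lt_or_eq_dec _ _ H) as [Hl| ->]; [|lra]. left. apply exp_increasing. lra.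
Qed.

(** The real part of the weight may be negative far out. Adding [eta / (1 + y ^ 2)], with
    [eta = K / (1 + T ^ 2)], makes it nonnegative on the whole period: by the Gaussian bound for
    [|y| <= T], by decay beyond. The interval [[-1, 1]] then contributes at least [b], and the
    choice of [T] makes the added mass at most [b / 2]. *)
Lemma moment0_lower (k : nat) : (1 <= k)%nat ->
  exists b X0, 0 < b /\ 1 <= X0 /\ forall (X : R) (M : nat), X0 <= X -> X ^ 3 <= INR M ->
  b <= moment k (saddle_const k 0) X M 0.
Proof.
intros Hk. destruct (weight_gaussian_lower k Hk) as [B [HB HG]].
destruct (weight_pow_bound k 0 2 Hk) as [K [X1 [HK [HX1 HW]]]].
set (b := exp (- (B / 2))). assert (Hb : 0 < b) by apply exp_pos.
set (T := 1 + 8 * K / b). assert (HKb : 0 <= 8 * K / b) by (apply Rdiv_le_0_compat; lra).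
assert (HT : 1 <= T) by (unfold T; lra).
destruct (HG T HT) as [X2 [HX2 HGT]].
exists (b / 2), (X1 + X2). split; [lra|]. split; [lra|].
intros X M HX HM. assert (HMX := cube_ge X M ltac:(lra) HM).
set (c := saddle_const k 0) in *. set (P := half_period k X).
assert (HP : 1 <= P).
{ pose proof (half_period_sqr_ge k X ltac:(lra)). pose proof (half_period_pos k X ltac:(lra)).
  fold P in H, H0. nra. }
set (U := fun Y => Y ^ 0 * rot 0 (weight k c X M Y)).
assert (HcU : forall y, continuous U y).
{ intros y. apply continuous_Rmult; [apply continuous_Rpow|apply continuous_rot_weight; lra]. }
change (b / 2 <= RInt U (- P) P).
set (eta := K / (1 + T ^ 2)).
assert (HT2 : 0 < 1 + T ^ 2) by (pose proof (pow2_ge_0 T); lra).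
assert (Heta0 : 0 <= eta) by (apply Rdiv_le_0_compat; lra).
assert (Heta : 4 * eta <= b / 2).
{ unfold eta. apply Rmult_le_reg_r with (1 + T ^ 2); [easy|].
  replace (4 * (K / (1 + T ^ 2)) * (1 + T ^ 2)) with (4 * K) by (field; lra).
  assert (8 * K = (T - 1) * b) by (unfold T; field; lra). nra. }
set (V := fun y => U y + eta / (1 + y ^ 2)).
assert (Hce : forall y, continuous (fun y => eta / (1 + y ^ 2)) y).
{ intros y. apply @ex_derive_continuous. auto_derive. pose proof (pow2_ge_0 y). lra. }
assert (HcV : forall y, continuous V y) by (intros y; now apply continuous_Rplus).
assert (HU1 : forall y, Rabs y <= 1 -> / 2 * b <= U y).
{ intros y Hy. unfold U. rewrite pow_O, Rmult_1_l. eapply Rle_trans; [|apply HGT; [lra|easy|lra]].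
  apply Rmult_le_compat_l; [lra|]. unfold b.
  assert (y ^ 2 <= 1) by (rewrite <- (pow2_abs y), <- (pow1 2); apply pow_incr; split;
    [apply Rabs_pos|easy]).
  assert (B * y ^ 2 <= B * 1) by (apply Rmult_le_compat_l; lra).
  destruct (Rle_lt_or_eq_dec (- (B / 2)) (- (B * y ^ 2 / 2)) ltac:(lra)) as [Hl| ->]; [|lra].
  left. now apply exp_increasing. }
assert (HV : forall y, Rabs y <= P -> 0 <= V y).
{ intros y Hy. assert (Hy2 : 0 < 1 + y ^ 2) by (pose proof (pow2_ge_0 y); lra).
  unfold V. destruct (Rle_dec (Rabs y) T) as [H|H].
  - assert (0 <= U y).
    { unfold U. rewrite pow_O, Rmult_1_l. eapply Rle_trans; [|apply HGT; [lra|easy|easy]].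
      apply Rmult_le_pos; [lra|left; apply exp_pos]. }
    assert (0 <= eta / (1 + y ^ 2)) by now apply Rdiv_le_0_compat. lra.
  - assert (HU : Rabs (U y) <= eta / (1 + y ^ 2)).
    { unfold U. rewrite pow_O, Rmult_1_l. eapply Rle_trans; [apply rot_Rabs_le|].
      assert (H1 := HW c X M y ltac:(lra) HMX Hy). rewrite pow_O, Rmult_1_l in H1.
      eapply Rle_trans; [apply H1|].
      unfold eta. replace (K / (1 + T ^ 2) / (1 + y ^ 2)) with (K * / ((1 + T ^ 2) * (1 + y ^
        2))) by (field; lra).
      apply Rmult_le_compat_l; [easy|]. apply Rinv_le_contravar; [now apply Rmult_lt_0_compat|].
      assert (T ^ 2 <= y ^ 2) by (rewrite <- (pow2_abs y); apply pow_incr; lra). simpl. nra. }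
    apply Rabs_le_between in HU. lra. }
assert (Hsplit : RInt V (- P) P = RInt U (- P) P + RInt (fun y => eta / (1 + y ^ 2)) (- P) P).
{ apply (RInt_plus U (fun y => eta / (1 + y ^ 2))); now apply ex_RInt_cont. }
assert (H4 : Rabs (RInt (fun y => eta / (1 + y ^ 2)) (- P) P) <= 4 * eta).
{ apply RInt_arctan_bound; [lra|easy|]. intros y _. rewrite Rabs_pos_eq; [lra|].
  apply Rdiv_le_0_compat; [easy|]. pose proof (pow2_ge_0 y). lra. }
assert (Hnn : forall u v, - P <= u -> u <= v -> v <= P -> 0 <= RInt V u v).
{ intros u v Hu Huv Hv. apply RInt_ge_0; [easy|now apply ex_RInt_cont|].
  intros y Hy. apply HV, Rabs_le. lra. }
assert (HV1 : b <= RInt V (-1) 1).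
{ replace b with (RInt (fun _ => / 2 * b) (-1) 1).
  2: { rewrite RInt_const. unfold scal; simpl; unfold mult; simpl. field. }
  apply RInt_le; [lra|apply ex_RInt_cont; intros; apply continuous_const|now apply ex_RInt_cont|].
  intros y Hy. assert (Hy1 : Rabs y <= 1) by (apply Rabs_le; lra).
  specialize (HU1 y Hy1). unfold V.
  assert (0 <= eta / (1 + y ^ 2)) by (apply Rdiv_le_0_compat; [easy|pose proof (pow2_ge_0 y);
    lra]). lra. }
assert (Htot : b <= RInt V (- P) P).
{ rewrite (RInt_Chasles_cont V (- P) (-1) P), (RInt_Chasles_cont V (-1) 1 P) by easy.
  pose proof (Hnn (- P) (-1) ltac:(lra) ltac:(lra) ltac:(lra)).
  pose proof (Hnn 1 P ltac:(lra) ltac:(lra) ltac:(lra)). lra. }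
apply Rabs_le_between in H4. lra.
Qed.

(** * Asymptotic solution of the moment equations *)

(* [f = O(X ^ (- i / 2))], uniformly in [M >= X ^ 3]. *)
Definition bigO (i : nat) (f : R -> nat -> R) : Prop :=
  exists K X0, 0 <= K /\ 1 <= X0 /\ forall (X : R) (M : nat), X0 <= X -> X ^ 3 <= INR M ->
  Rabs (f X M) <= K * (/ sqrt X) ^ i.

Lemma bigO_ext (i : nat) (f g : R -> nat -> R) (X1 : R) :
  (forall X M, X1 <= X -> 1 <= X -> X ^ 3 <= INR M -> f X M = g X M) -> bigO i g -> bigO i f.
Proof.
intros H [K [X0 [HK [HX0 Hg]]]]. exists K, (Rmax X0 X1).
split; [easy|]. split; [pose proof (Rmax_l X0 X1); lra|].
intros X M HX HM. pose proof (Rmax_l X0 X1). pose proof (Rmax_r X0 X1).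
rewrite H by (try easy; lra). apply Hg; [lra|easy].
Qed.

Lemma bigO_eq (i : nat) (f g : R -> nat -> R) :
  (forall X M, 1 <= X -> X ^ 3 <= INR M -> f X M = g X M) -> bigO i g -> bigO i f.
Proof. intros H. apply (bigO_ext i f g 1). auto. Qed.

Lemma bigO_plus (i : nat) (f g : R -> nat -> R) :
  bigO i f -> bigO i g -> bigO i (fun X M => f X M + g X M).
Proof.
intros [K [X0 [HK [HX0 Hf]]]] [L [X1 [HL [HX1 Hg]]]]. exists (K + L), (X0 + X1).
split; [lra|]. split; [lra|]. intros X M HX HM.
specialize (Hf X M ltac:(lra) HM). specialize (Hg X M ltac:(lra) HM).
eapply Rle_trans; [apply Rabs_triang|]. lra.
Qed.

Lemma bigO_mult (i j : nat) (f g : R -> nat -> R) :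
  bigO i f -> bigO j g -> bigO (i + j) (fun X M => f X M * g X M).
Proof.
intros [K [X0 [HK [HX0 Hf]]]] [L [X1 [HL [HX1 Hg]]]]. exists (K * L), (X0 + X1).
split; [now apply Rmult_le_pos|]. split; [lra|]. intros X M HX HM.
specialize (Hf X M ltac:(lra) HM). specialize (Hg X M ltac:(lra) HM).
rewrite Rabs_mult, pow_add.
replace (K * L * ((/ sqrt X) ^ i * (/ sqrt X) ^ j)) with (K * (/ sqrt X) ^ i * (L * (/ sqrt X) ^
  j)) by ring.
apply Rmult_le_compat; auto using Rabs_pos.
Qed.

Lemma bigO_weaken (i j : nat) (f : R -> nat -> R) : (i <= j)%nat -> bigO j f -> bigO i f.
Proof.
intros Hij [K [X0 [HK [HX0 Hf]]]]. exists K, X0. split; [easy|]. split; [easy|].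
intros X M HX HM. eapply Rle_trans; [now apply Hf|]. apply Rmult_le_compat_l; [easy|].
pose proof (inv_sqrt_bounds X ltac:(lra)) as He. set (e := / sqrt X) in *.
replace j with (i + (j - i))%nat by lia. rewrite pow_add.
assert (0 <= e ^ i) by (apply pow_le; lra).
assert (e ^ (j - i) <= 1) by (rewrite <- (pow1 (j - i)); apply pow_incr; lra). nra.
Qed.

Lemma bigO_const (c : R) : bigO 0 (fun _ _ => c).
Proof.
exists (Rabs c), 1. split; [apply Rabs_pos|]. split; [lra|]. intros; simpl; lra.
Qed.

Lemma bigO_scal (c : R) (i : nat) (f : R -> nat -> R) : bigO i f -> bigO i (fun X M => c * f X M).
Proof. intros H. exact (bigO_mult 0 i _ _ (bigO_const c) H). Qed.

Lemma bigO_eps_pow (i : nat) : bigO i (fun X _ => (/ sqrt X) ^ i).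
Proof.
exists 1, 1. split; [lra|]. split; [lra|]. intros X M HX HM.
pose proof (inv_sqrt_bounds X HX). rewrite Rabs_pos_eq; [lra|]. apply pow_le; lra.
Qed.

Lemma bigO_eps (p i : nat) (f : R -> nat -> R) :
  bigO i f -> bigO (p + i) (fun X M => (/ sqrt X) ^ p * f X M).
Proof. intros H. exact (bigO_mult p i _ _ (bigO_eps_pow p) H). Qed.

Lemma bigO_inv_pos (b : R) (X0 : R) (f : R -> nat -> R) : 0 < b ->
  (forall X M, X0 <= X -> X ^ 3 <= INR M -> b <= f X M) -> bigO 0 (fun X M => / f X M).
Proof.
intros Hb H. exists (/ b), (1 + Rabs X0).
split; [left; now apply Rinv_0_lt_compat|]. split; [pose proof (Rabs_pos X0); lra|].
intros X M HX HM. pose proof (Rle_abs X0). specialize (H X M ltac:(lra) HM).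
rewrite Rabs_pos_eq by (left; apply Rinv_0_lt_compat; lra).
simpl. rewrite Rmult_1_r. apply Rinv_le_contravar; lra.
Qed.

Lemma bigO_psi_sum (k i : nat) : (1 <= k)%nat ->
  bigO 4 (fun X M => psi_sum k i X M / X - (saddle_const k i + - (INR (fact i) / 2) * (/ sqrt X)
    ^ 2)).
Proof.
intros Hk. destruct (psi_sum_asymptotic k i Hk) as [C [HC H]].
exists C, 1. split; [easy|]. split; [lra|]. intros X M HX HM. specialize (H X M HX HM).
assert (Hx : 0 < / X) by (apply Rinv_0_lt_compat; lra).
replace ((/ sqrt X) ^ 4) with (/ X * / X) by (rewrite <- inv_sqrt_sqr by lra; ring).
rewrite inv_sqrt_sqr by lra.
replace (psi_sum k i X M / X - (saddle_const k i + - (INR (fact i) / 2) * / X))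
  with (/ X * (psi_sum k i X M - (saddle_const k i * X - INR (fact i) / 2))) by (field; lra).
rewrite Rabs_mult, (Rabs_pos_eq (/ X)) by lra. unfold Rdiv in H. nra.
Qed.

Lemma bigO_shift_const (i : nat) (f : R -> nat -> R) (a b : R) :
  bigO (2 + i) (fun X M => f X M - (a + b * (/ sqrt X) ^ 2)) -> bigO 2 (fun X M => f X M - a).
Proof.
intros H. apply (bigO_eq 2 _ (fun X M => (f X M - (a + b * (/ sqrt X) ^ 2)) + b * (/ sqrt X) ^ 2)).
- intros; ring.
- apply bigO_plus; [apply (bigO_weaken 2 (2 + i)); [lia|easy]|]. apply bigO_scal, bigO_eps_pow.
Qed.

Lemma bigO_bounded (i : nat) (f : R -> nat -> R) (a : R) :
  bigO i (fun X M => f X M - a) -> bigO 0 f.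
Proof.
intros H. apply (bigO_eq 0 _ (fun X M => (f X M - a) + a)); [intros; ring|].
apply bigO_plus; [apply (bigO_weaken 0 i); [lia|easy]|apply bigO_const].
Qed.

Definition norm_moment (k j : nat) (X : R) (M : nat) : R :=
  moment k (saddle_const k 0) X M j / moment k (saddle_const k 0) X M 0.

Lemma bigO_moment_inv (k : nat) : (1 <= k)%nat ->
  bigO 0 (fun X M => / moment k (saddle_const k 0) X M 0).
Proof.
intros Hk. destruct (moment0_lower k Hk) as [b [X0 [Hb [HX0 H]]]].
now apply (bigO_inv_pos b X0).
Qed.

Lemma norm_moment_bounded (k j : nat) : (1 <= k)%nat -> bigO 0 (norm_moment k j).
Proof.
intros Hk. destruct (moment_bound k j (saddle_const k 0) Hk) as [K [X0 [HK [HX0 H]]]].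
apply (bigO_mult 0 0 (fun X M => moment k (saddle_const k 0) X M j)).
- exists K, X0. split; [easy|]. split; [easy|]. intros X M HX HM. simpl. rewrite Rmult_1_r.
  now apply H.
- now apply bigO_moment_inv.
Qed.

Lemma norm_moment_0 (k : nat) : (1 <= k)%nat -> exists X0,
  forall X M, X0 <= X -> X ^ 3 <= INR M -> norm_moment k 0 X M = 1.
Proof.
intros Hk. destruct (moment0_lower k Hk) as [b [X0 [Hb [HX0 H]]]].
exists X0. intros X M HX HM. specialize (H X M HX HM). unfold norm_moment. field. lra.
Qed.

Lemma norm_moment_equation (k j : nat) : (1 <= k)%nat ->
  bigO 4 (fun X M => let e := / sqrt X in let S i := psi_sum k i X M / X in
    let a j := norm_moment k j X M in
    S 1%nat * a (j + 1)%nat -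
    (- INR j * a (pred j) - e * (saddle_const k 0 * X - psi_sum k 0 X M) * a j + e * S 2%nat / 2
      * a (j + 2)%nat
     - e ^ 2 * S 3%nat / 6 * a (j + 3)%nat + e ^ 3 * S 4%nat / 24 * a (j + 4)%nat)).
Proof.
intros Hk.
destruct (moment_equation k j (saddle_const k 0) Hk) as [K [X0 [HK [HX0 H]]]].
assert (HE : bigO 4 (fun X M => let e := / sqrt X in let S i := psi_sum k i X M / X in
    let A := moment k (saddle_const k 0) X M in
    S 1%nat * A (j + 1)%nat -
    (- INR j * A (pred j) - e * (saddle_const k 0 * X - psi_sum k 0 X M) * A j + e * S 2%nat / 2
      * A (j + 2)%nat
     - e ^ 2 * S 3%nat / 6 * A (j + 3)%nat + e ^ 3 * S 4%nat / 24 * A (j + 4)%nat))).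
{ exists K, X0. split; [easy|]. split; [easy|]. exact H. }
pose proof (bigO_mult 0 4 _ _ (bigO_moment_inv k Hk) HE) as HM.
revert HM. apply bigO_eq. intros X M _ _. cbv zeta. unfold norm_moment, Rdiv. ring.
Qed.

(** The sums are replaced by their two-term asymptotics, so [c X - psi_sum k 0 X M] becomes [1 / 2].
    The exponent [p] records parity: the errors of order [e ^ 3] carry only the moments [j], [j + 2]
    and [j + 4], so they gain a factor [e] when these moments are [O(e)]. *)
Lemma norm_moment_recurrence (k j p : nat) : (1 <= k)%nat -> (p <= 1)%nat ->
  bigO p (norm_moment k j) -> bigO p (norm_moment k (j + 2)) -> bigO p (norm_moment k (j + 4)) ->
  bigO (3 + p) (fun X M => let e := / sqrt X in let a j := norm_moment k j X M in
    saddle_const k 1 * a (j + 1)%nat -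
    (- INR j * a (pred j) + e * (- (1 / 2) * a j + saddle_const k 2 / 2 * a (j + 2)%nat)
     + e ^ 2 * (1 / 2 * a (j + 1)%nat - saddle_const k 3 / 6 * a (j + 3)%nat))).
Proof.
intros Hk Hp H0 H2 H4.
pose proof (norm_moment_equation k j Hk) as HE.
assert (B1 := bigO_psi_sum k 1 Hk).
assert (B2 := bigO_shift_const 2 _ _ _ (bigO_psi_sum k 2 Hk)).
assert (B3 := bigO_shift_const 2 _ _ _ (bigO_psi_sum k 3 Hk)).
assert (B4 := bigO_bounded 2 _ _ (bigO_shift_const 2 _ _ _ (bigO_psi_sum k 4 Hk))).
assert (B0 : bigO 2 (fun X M => saddle_const k 0 * X - psi_sum k 0 X M - 1 / 2)).
{ destruct (psi_sum_asymptotic k 0 Hk) as [C [HC H]].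
  exists C, 1. split; [easy|]. split; [lra|]. intros X M HX HM. specialize (H X M HX HM).
  rewrite inv_sqrt_sqr by lra. simpl fact in H. simpl INR in H. rewrite <- Rabs_Ropp.
  replace (- (saddle_const k 0 * X - psi_sum k 0 X M - 1 / 2)) with (psi_sum k 0 X M -
    (saddle_const k 0 * X - 1 / 2)) by ring.
  easy. }
assert (T1 := bigO_mult 4 0 _ _ B1 (norm_moment_bounded k (j + 1) Hk)).
assert (T2 := bigO_mult 2 p _ _ B0 H0). apply (bigO_eps 1) in T2.
assert (T3 := bigO_mult 2 p _ _ B2 H2). apply (bigO_eps 1) in T3.
assert (T4 := bigO_mult 2 0 _ _ B3 (norm_moment_bounded k (j + 3) Hk)). apply (bigO_eps 2) in T4.
assert (T5 := bigO_mult 0 p _ _ B4 H4). apply (bigO_eps 3) in T5.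
apply (bigO_weaken (3 + p) 4) in HE, T1, T4; try lia.
apply (bigO_scal (-1)) in T1, T2. apply (bigO_scal (1 / 2)) in T3.
apply (bigO_scal (- (1 / 6))) in T4. apply (bigO_scal (1 / 24)) in T5.
pose proof (bigO_plus _ _ _ (bigO_plus _ _ _ (bigO_plus _ _ _ HE T1) (bigO_plus _ _ _ T2 T3))
  (bigO_plus _ _ _ T4 T5)) as HT.
revert HT. apply bigO_eq. intros X M HX _. cbv zeta beta.
assert (0 < sqrt X) by (apply sqrt_lt_R0; lra).
replace (INR (fact 1)) with 1 by reflexivity. field. lra.
Qed.

Lemma saddle_const0_pos (k : nat) : (1 <= k)%nat -> 0 < saddle_const k 0.
Proof.
intros Hk.
assert (HG : schwartz k (fun v => Hfun (v ^ k))).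
{ exists (fun _ => 1). split; [constructor|intros; ring]. }
assert (Hc := schwartz_continuous k _ HG). set (G := fun v => Hfun (v ^ k)) in *.
assert (H1 : 0 < RInt G 0 1).
{ apply RInt_gt_0; [lra|intros; apply Hfun_pos|intros; apply Hc]. }
enough (Rbar_le (RInt G 0 1) (saddle_const k 0)) by (simpl in *; lra).
apply is_lim_seq_le_loc with (u := fun _ => RInt G 0 1) (v := fun N => RInt G 0 (INR N)).
- exists 1%nat. intros n Hn. apply le_INR in Hn. simpl INR in Hn.
  rewrite (RInt_Chasles_cont G 0 1 (INR n)) by easy.
  assert (0 <= RInt G 1 (INR n)).
  { apply RInt_ge_0; [easy|now apply ex_RInt_cont|intros; left; apply Hfun_pos]. }
  lra.
- apply is_lim_seq_const.
- now apply schwartz_RInt_lim with k.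
Qed.

Lemma saddle_const_pos (k i : nat) : (1 <= k)%nat -> 0 < saddle_const k i.
Proof.
intros Hk. induction i as [|i IH]; [now apply saddle_const0_pos|].
cbn [saddle_const]. apply Rmult_lt_0_compat; [|easy].
assert (0 < INR (S i)) by (apply lt_0_INR; lia).
assert (0 < / INR k) by (apply Rinv_0_lt_compat, lt_0_INR; lia). lra.
Qed.

(** Used for even [j]: apart from the term with moment [j - 1], the right side of the recurrence has
    a factor [e]. Starting from [j = 0], where that term is absent, this shows that odd moments are
    [O(e)]. *)
Lemma norm_moment_odd_step (k j : nat) : (1 <= k)%nat ->
  bigO 1 (fun X M => INR j * norm_moment k (pred j) X M) -> bigO 1 (norm_moment k (j + 1)).
Proof.
intros Hk H. pose proof (saddle_const_pos k 1 Hk) as Hc.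
pose proof (norm_moment_recurrence k j 0 Hk ltac:(lia) (norm_moment_bounded k _ Hk)
  (norm_moment_bounded k _ Hk) (norm_moment_bounded k _ Hk)) as HG.
assert (Hb : forall j, bigO 0 (norm_moment k j)) by (intros; now apply norm_moment_bounded).
pose proof (bigO_eps 1 0 _ (bigO_plus _ _ _ (bigO_scal (- (1 / 2)) _ _ (Hb j))
  (bigO_scal (saddle_const k 2 / 2) _ _ (Hb (j + 2)%nat)))) as T1.
pose proof (bigO_eps 2 0 _ (bigO_plus _ _ _ (bigO_scal (1 / 2) _ _ (Hb (j + 1)%nat))
  (bigO_scal (- (saddle_const k 3 / 6)) _ _ (Hb (j + 3)%nat)))) as T2.
apply (bigO_weaken 1 3) in HG; [|lia]. apply (bigO_weaken 1 2) in T2; [|lia].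
pose proof (bigO_scal (/ saddle_const k 1) _ _ (bigO_plus _ _ _ (bigO_plus _ _ _ HG (bigO_scal
  (-1) _ _ H)) (bigO_plus _ _ _ T1 T2))) as HT.
revert HT. apply bigO_eq. intros X M HX _. cbv zeta beta.
assert (0 < sqrt X) by (apply sqrt_lt_R0; lra). field. lra.
Qed.

(** A bootstrap. The recurrences first give the Gaussian values [- / c1] and [3 / c1 ^ 2] of the
    second and fourth moments, then the coefficients [al1] and [al3] of [e] in the first and third,
    and finally, fed back into the equation [j = 1], the coefficient [al2] of [e ^ 2] in the second.
    The signs reflect that the variable is [i Y]. *)
Lemma norm_moment_variance (k : nat) : (1 <= k)%nat ->
  let c1 := saddle_const k 1 in let c2 := saddle_const k 2 in let c3 := saddle_const k 3 in
  let al1 := - (c1 + c2) / (2 * c1 ^ 2) in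
  let al3 := (- 2 * al1 + / (2 * c1) + 3 * c2 / (2 * c1 ^ 2)) / c1 in
  let al2 := (- al1 / 2 + c2 / 2 * al3 - / (2 * c1) - c3 / (2 * c1 ^ 2)) / c1 in
  bigO 1 (norm_moment k 1) /\ bigO 4 (fun X M => norm_moment k 2 X M - norm_moment k 1 X M ^ 2
    - (- / c1 + (al2 - al1 ^ 2) * / X)).
Proof.
intros Hk c1 c2 c3 al1 al3 al2.
pose proof (saddle_const_pos k 1 Hk : 0 < c1) as Hc.
assert (Hb : forall j, bigO 0 (norm_moment k j)) by (intros; now apply norm_moment_bounded).
assert (O1 : bigO 1 (norm_moment k 1)).
{ apply (norm_moment_odd_step k 0 Hk). apply (bigO_eq 1 _ (fun X _ => 0 * (/ sqrt X) ^ 1)).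
  - intros; simpl; ring.
  - apply bigO_scal, bigO_eps_pow. }
assert (O3 : bigO 1 (norm_moment k 3)) by (apply (norm_moment_odd_step k 2 Hk), bigO_scal, O1).
assert (O5 : bigO 1 (norm_moment k 5)) by (apply (norm_moment_odd_step k 4 Hk), bigO_scal, O3).
destruct (norm_moment_0 k Hk) as [X1 HX1].
assert (R0 := norm_moment_recurrence k 0 0 Hk ltac:(lia) (Hb _) (Hb _) (Hb _)).
assert (R1 := norm_moment_recurrence k 1 1 Hk ltac:(lia) O1 O3 O5).
assert (R2 := norm_moment_recurrence k 2 0 Hk ltac:(lia) (Hb _) (Hb _) (Hb _)).
assert (R3 := norm_moment_recurrence k 3 0 Hk ltac:(lia) (Hb _) (Hb _) (Hb _)).
cbv zeta in R0, R1, R2, R3. cbn [Nat.add Init.Nat.pred] in R0, R1, R2, R3.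
fold c1 c2 c3 in R0, R1, R2, R3.
replace (INR 0) with 0 in R0 by reflexivity. replace (INR 1) with 1 in R1 by reflexivity.
replace (INR 2) with 2 in R2 by (simpl; ring). replace (INR 3) with 3 in R3 by (simpl; ring).
assert (Hs : forall X, 1 <= X -> 0 < sqrt X) by (intros; apply sqrt_lt_R0; lra).
assert (L2 : bigO 2 (fun X M => norm_moment k 2 X M + / c1)).
{ pose proof (bigO_eps 1 1 _ (bigO_plus _ _ _ (bigO_scal (- (1 / 2)) _ _ O1) (bigO_scal (c2 / 2)
  _ _ O3))) as T1.
  pose proof (bigO_eps 2 0 _ (bigO_plus _ _ _ (bigO_scal (1 / 2) _ _ (Hb 2%nat)) (bigO_scal (-
    (c3 / 6)) _ _ (Hb 4%nat)))) as T2.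
  pose proof (bigO_weaken 2 4 _ ltac:(lia) R1) as R1'.
  pose proof (bigO_scal (/ c1) _ _ (bigO_plus _ _ _ R1' (bigO_plus _ _ _ T1 T2))) as HT.
  revert HT. apply (bigO_ext _ _ _ X1). intros X M HX HX2 HM. cbv beta.
  specialize (Hs X HX2). rewrite (HX1 X M HX HM). field. lra. }
assert (L4 : bigO 2 (fun X M => norm_moment k 4 X M - 3 / c1 ^ 2)).
{ pose proof (bigO_eps 1 1 _ (bigO_plus _ _ _ (bigO_scal (- (1 / 2)) _ _ O3) (bigO_scal (c2 / 2)
  _ _ O5))) as T1.
  pose proof (bigO_eps 2 0 _ (bigO_plus _ _ _ (bigO_scal (1 / 2) _ _ (Hb 4%nat)) (bigO_scal (-
    (c3 / 6)) _ _ (Hb 6%nat)))) as T2.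
  apply (bigO_weaken 2 3) in R3; [|lia].
  pose proof (bigO_scal (/ c1) _ _ (bigO_plus _ _ _ (bigO_plus _ _ _ R3 (bigO_scal (-3) _ _ L2))
    (bigO_plus _ _ _ T1 T2))) as HT.
  revert HT. apply bigO_eq. intros X M HX2 HM. cbv beta.
  specialize (Hs X HX2). field. lra. }
assert (L1 : bigO 3 (fun X M => norm_moment k 1 X M - al1 * / sqrt X)).
{ pose proof (bigO_eps 1 2 _ (bigO_scal (c2 / 2) _ _ L2)) as T1.
  pose proof (bigO_eps 2 1 _ (bigO_plus _ _ _ (bigO_scal (1 / 2) _ _ O1) (bigO_scal (- (c3 / 6))
    _ _ O3))) as T2.
  pose proof (bigO_scal (/ c1) _ _ (bigO_plus _ _ _ R0 (bigO_plus _ _ _ T1 T2))) as HT.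
  revert HT. apply (bigO_ext _ _ _ X1). intros X M HX HX2 HM. cbv beta.
  specialize (Hs X HX2). rewrite (HX1 X M HX HM). unfold al1. field. lra. }
assert (L3 : bigO 3 (fun X M => norm_moment k 3 X M - al3 * / sqrt X)).
{ pose proof (bigO_eps 1 2 _ (bigO_plus _ _ _ (bigO_scal (- (1 / 2)) _ _ L2) (bigO_scal (c2 / 2)
  _ _ L4))) as T1.
  pose proof (bigO_eps 2 1 _ (bigO_plus _ _ _ (bigO_scal (1 / 2) _ _ O3) (bigO_scal (- (c3 / 6))
    _ _ O5))) as T2.
  pose proof (bigO_scal (/ c1) _ _ (bigO_plus _ _ _ (bigO_plus _ _ _ R2 (bigO_scal (-2) _ _ L1))
    (bigO_plus _ _ _ T1 T2))) as HT.
  revert HT. apply bigO_eq. intros X M HX2 HM. cbv beta.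
  specialize (Hs X HX2). unfold al3. field. lra. }
split; [easy|].
assert (L2' : bigO 4 (fun X M => norm_moment k 2 X M + / c1 - al2 * (/ sqrt X) ^ 2)).
{ pose proof (bigO_eps 1 3 _ (bigO_plus _ _ _ (bigO_scal (- (1 / 2)) _ _ L1) (bigO_scal (c2 / 2)
  _ _ L3))) as T1.
  pose proof (bigO_eps 2 2 _ (bigO_plus _ _ _ (bigO_scal (1 / 2) _ _ L2) (bigO_scal (- (c3 / 6))
    _ _ L4))) as T2.
  pose proof (bigO_scal (/ c1) _ _ (bigO_plus _ _ _ R1 (bigO_plus _ _ _ T1 T2))) as HT.
  revert HT. apply (bigO_ext _ _ _ X1). intros X M HX HX2 HM. cbv beta.
  specialize (Hs X HX2). rewrite (HX1 X M HX HM). unfold al2. field. lra. }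
assert (P1 : bigO 1 (fun X M => norm_moment k 1 X M + al1 * / sqrt X)).
{ apply bigO_plus; [easy|]. apply bigO_scal.
  apply (bigO_eq 1 _ (fun X _ => (/ sqrt X) ^ 1)); [intros; ring|].
  apply bigO_eps_pow. }
pose proof (bigO_plus _ _ _ L2' (bigO_scal (-1) _ _ (bigO_mult 3 1 _ _ L1 P1))) as HT.
revert HT. apply bigO_eq. intros X M HX2 HM. cbv beta. rewrite <- (inv_sqrt_sqr X) by lra. ring.
Qed.

(** The recursion for [saddle_const] makes [c1], [c2] and [c3] multiples of [c], and the correction
    collapses to a rational function of [/ k] over [c ^ 2]. *)
Lemma saddle_const_variance (k : nat) : (1 <= k)%nat ->
  let c := saddle_const k 0 in let al := / INR k in
  bigO 4 (fun X M => norm_moment k 2 X M - norm_moment k 1 X M ^ 2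
    - (- / ((al + 1) * c) + (al + 3) / (2 * (al + 1) * c ^ 2) * / X)).
Proof.
intros Hk c al. destruct (norm_moment_variance k Hk) as [_ H].
assert (Hc : 0 < c) by now apply saddle_const0_pos.
assert (Hal : 0 < al) by (apply Rinv_0_lt_compat, lt_0_INR; lia).
revert H. apply bigO_eq. intros X M HX _.
replace (saddle_const k 3) with ((3 + al) * ((2 + al) * ((1 + al) * c)))
  by (unfold al, c; cbn [saddle_const INR]; ring).
replace (saddle_const k 2) with ((2 + al) * ((1 + al) * c))
  by (unfold al, c; cbn [saddle_const INR]; ring).
replace (saddle_const k 1) with ((1 + al) * c)
  by (unfold al, c; cbn [saddle_const INR]; ring).
field. lra.
Qed.

(** * Fourier coefficients *)

Lemma cis_plus (a b : R) : Cmult (cis a) (cis b) = cis (a + b).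
Proof. unfold cis, Cmult; cbn [fst snd]. rewrite cos_plus, sin_plus. f_equal; ring. Qed.

(** With [Q = q * exp (- i th)] this is [/ (1 - Q) = 1 + Q / (1 - Q)], the analytic form of the
    alternative that a part is absent or occurs at least once. *)
Lemma geom_factor_split (q th : R) : 0 < q < 1 ->
  geom_factor q th = Cplus (RtoC (1 - q)) (Cmult (RtoC q) (Cmult (cis (- th)) (geom_factor q th))).
Proof.
intros Hq. pose proof (geom_denom_neq0 q th Hq) as H0.
assert (HQ : geom_ratio q th = Cmult (RtoC q) (cis (- th))).
{ unfold geom_ratio, cis, Cmult, RtoC; cbn [fst snd]. rewrite cos_neg, sin_neg. f_equal; ring. }
rewrite Cmult_assoc, <- HQ. unfold geom_factor. set (Q := geom_ratio q th) in *.
field. easy.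
Qed.

(* Up to normalisation, the number of partitions of [nu] into the [M] smallest
   [k]th powers. *)
Definition fourier_coef (k : nat) (X : R) (M : nat) (nu : Z) : R :=
  RInt (fun Y => Re (weight k (IZR nu / X ^ S k) X M Y)) (- half_period k X) (half_period k X).

Definition part_ratio (k : nat) (X : R) (m : nat) : R := exp (- part_scale k X m).

Definition part_power (k m : nat) : nat := Nat.pow (S m) k.

Lemma INR_part_power (k m : nat) : INR (part_power k m) = INR (S m) ^ k.
Proof. apply pow_INR. Qed.

Lemma continuous_Re_weight (k : nat) (c X : R) (M : nat) (Y : R) : 0 < X ->
  continuous (fun Y => Re (weight k c X M Y)) Y.
Proof. exact (continuous_rot_weight k 0 c X M Y). Qed.

Lemma weight_step (k : nat) (X : R) (M : nat) (nu : Z) (Y : R) : 0 < X ->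
  weight k (IZR nu / X ^ S k) X (S M) Y =
  Cplus (Cmult (RtoC (1 - part_ratio k X M)) (weight k (IZR nu / X ^ S k) X M Y))
   (Cmult (RtoC (part_ratio k X M)) (weight k (IZR (nu - Z.of_nat (part_power k M)) / X ^ S k) X
     (S M) Y)).
Proof.
intros HX. unfold weight. cbn [Cprod]. fold (part_ratio k X M).
set (P := Cprod _ M). set (q := part_ratio k X M).
set (th := Y * (part_scale k X M / sqrt X)).
assert (Hq : 0 < q < 1) by apply exp_neg_lt1, part_scale_pos, HX.
assert (Hs : 0 < sqrt X) by now apply sqrt_lt_R0.
replace (IZR (nu - Z.of_nat (part_power k M)) / X ^ S k * sqrt X * Y)
  with (IZR nu / X ^ S k * sqrt X * Y + - th).
- rewrite <- cis_plus. rewrite (geom_factor_split q th Hq) at 1. ring.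
- unfold th, part_scale. rewrite minus_IZR, <- INR_IZR_INZ, INR_part_power.
  change ((INR (S M) / X) ^ k / sqrt X) with ((INR (S M) / X) ^ k * / sqrt X).
  rewrite (inv_sqrt_div X HX).
  assert (0 < X ^ k) by now apply pow_lt.
  replace ((INR (S M) / X) ^ k) with (INR (S M) ^ k / X ^ k)
    by (unfold Rdiv; now rewrite Rpow_mult_distr, pow_inv).
  set (D := INR (S M) ^ k). cbn [pow]. field. lra.
Qed.

Lemma fourier_coef_step (k : nat) (X : R) (M : nat) (nu : Z) : 0 < X ->
  fourier_coef k X (S M) nu = (1 - part_ratio k X M) * fourier_coef k X M nu
   + part_ratio k X M * fourier_coef k X (S M) (nu - Z.of_nat (part_power k M)).
Proof.
intros HX. unfold fourier_coef. set (P := half_period k X).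
assert (Hex : forall c M, ex_RInt (fun Y => Re (weight k c X M Y)) (- P) P).
{ intros c N. apply ex_RInt_cont. intros v. now apply continuous_Re_weight. }
apply is_RInt_unique.
set (q := part_ratio k X M). set (nu' := (nu - Z.of_nat (part_power k M))%Z).
apply is_RInt_ext with (fun Y => plus (scal (1 - q) (Re (weight k (IZR nu / X ^ S k) X M Y)))
   (scal q (Re (weight k (IZR nu' / X ^ S k) X (S M) Y)))).
- intros Y _. rewrite (weight_step k X M nu Y HX). fold q nu'.
  destruct (weight k (IZR nu / X ^ S k) X M Y), (weight k (IZR nu' / X ^ S k) X (S M) Y).
  change (@eq R ((1 - q) * r + q * r1) (((1 - q) * r - 0 * r0) + (q * r1 - 0 * r2))). ring.
- apply (is_RInt_plus (fun Y => scal (1 - q) (Re (weight k (IZR nu / X ^ S k) X M Y)))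
   (fun Y => scal q (Re (weight k (IZR nu' / X ^ S k) X (S M) Y)))).
  + apply (is_RInt_scal (fun Y => Re (weight k (IZR nu / X ^ S k) X M Y))).
    apply @RInt_correct. apply Hex.
  + apply (is_RInt_scal (fun Y => Re (weight k (IZR nu' / X ^ S k) X (S M) Y))).
    apply @RInt_correct. apply Hex.
Qed.

Lemma fourier_coef_bound (k : nat) (X : R) (M : nat) (nu : Z) : 0 < X ->
  Rabs (fourier_coef k X M nu) <= 2 * half_period k X.
Proof.
intros HX. unfold fourier_coef. pose proof (half_period_pos k X HX) as HP.
set (P := half_period k X) in *.
assert (Hex : ex_RInt (fun Y => Re (weight k (IZR nu / X ^ S k) X M Y)) (- P) P).
{ apply ex_RInt_cont. intros v. now apply continuous_Re_weight. }
eapply Rle_trans; [apply abs_RInt_le_const with (M := 1); [lra|easy|]|lra].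
intros t _. eapply Rle_trans; [apply Re_le_Cmod|]. now apply Cmod_weight_le1.
Qed.

(** Orthogonality of characters: at the end of the period the phase is [om * P = nu * PI], where the
    sine vanishes. *)
Lemma fourier_coef_0 (k : nat) (X : R) (nu : Z) : 0 < X ->
  fourier_coef k X 0 nu = if Z.eq_dec nu 0 then 2 * half_period k X else 0.
Proof.
intros HX. unfold fourier_coef.
assert (Hs : 0 < sqrt X) by now apply sqrt_lt_R0.
assert (HXk : 0 < X ^ k) by now apply pow_lt.
set (P := half_period k X). set (om := IZR nu / X ^ S k * sqrt X).
assert (Hw : forall Y, Re (weight k (IZR nu / X ^ S k) X 0 Y) = cos (om * Y)).
{ intros Y. unfold weight. cbn [Cprod]. rewrite Cmult_1_r. reflexivity. }
rewrite (RInt_ext _ (fun Y => cos (om * Y))) by (intros; apply Hw).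
destruct (Z.eq_dec nu 0) as [->|Hnu].
- rewrite (RInt_ext _ (fun _ => 1)).
  + rewrite RInt_const. unfold scal; simpl; unfold mult; simpl. ring.
  + intros x _. unfold om. rewrite Rdiv_0_l, !Rmult_0_l. apply cos_0.
- assert (Hom : om <> 0).
  { unfold om. apply Rmult_integral_contrapositive_currified; [|lra].
    apply Rmult_integral_contrapositive_currified.
    - now apply not_0_IZR.
    - apply Rinv_neq_0_compat. simpl. apply Rgt_not_eq, Rmult_lt_0_compat; lra. }
  assert (HomP : om * P = IZR nu * PI).
  { unfold om, P, half_period. cbn [pow].
    replace (IZR nu / (X * X ^ k) * sqrt X * (PI * sqrt X * X ^ k))
      with (IZR nu * PI * (sqrt X * sqrt X) / X) by (field; lra).
    rewrite sqrt_sqrt by lra. field. lra. }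
  assert (Hsin : sin (om * P) = 0).
  { rewrite HomP. pose proof (sin2_shift nu 0) as H. rewrite Rplus_0_l, sin_0 in H.
    destruct (Req_dec (sin (IZR nu * PI)) 0) as [|Hn]; [easy|]. exfalso.
    apply (pow_nonzero _ 2 Hn). rewrite H. ring. }
  apply is_RInt_unique.
  replace 0 with (minus (/ om * sin (om * P)) (/ om * sin (om * - P))).
  + apply (is_RInt_derive (fun Y => / om * sin (om * Y))).
    * intros x _. auto_derive; [easy|]. field. easy.
    * intros x _. apply @ex_derive_continuous. auto_derive. easy.
  + unfold minus, plus, opp; simpl.
    replace (om * - P) with (- (om * P)) by ring. rewrite sin_neg, Hsin. ring.
Qed.

Lemma fourier_coef_iter (k : nat) (X : R) (M J : nat) (nu : Z) : 0 < X ->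
  fourier_coef k X (S M) nu =
  (1 - part_ratio k X M) * rsum (fun j => part_ratio k X M ^ j
     * fourier_coef k X M (nu - Z.of_nat (j * part_power k M))) J
  + part_ratio k X M ^ J * fourier_coef k X (S M) (nu - Z.of_nat (J * part_power k M)).
Proof.
intros HX. induction J as [|J IH].
- cbn [rsum pow Nat.mul]. rewrite Z.sub_0_r. ring.
- rewrite IH. cbn [rsum pow].
  rewrite (fourier_coef_step k X M (nu - Z.of_nat (J * part_power k M))) by easy.
  replace (nu - Z.of_nat (J * part_power k M) - Z.of_nat (part_power k M))%Z
    with (nu - Z.of_nat (S J * part_power k M))%Z by lia.
  ring.
Qed.

Lemma part_power_pos (k m : nat) : (1 <= part_power k m)%nat.
Proof.
apply INR_le. rewrite INR_part_power. simpl (INR 1). apply pow_R1_Rle.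
apply (le_INR 1). lia.
Qed.

Lemma part_ratio_bounds (k : nat) (X : R) (m : nat) : 0 < X -> 0 < part_ratio k X m < 1.
Proof. intros HX. apply exp_neg_lt1. now apply part_scale_pos. Qed.

(** By induction on the number of parts. Iterating the recursion [J] times only moves the index
    further below 0, so every summed term vanishes, and what is left is [q ^ J] times a bounded
    quantity. *)
Lemma fourier_coef_neg (k : nat) (X : R) (M : nat) (nu : Z) : 0 < X -> (nu < 0)%Z ->
  fourier_coef k X M nu = 0.
Proof.
intros HX. revert nu. induction M as [|M IH]; intros nu Hnu.
- rewrite fourier_coef_0 by easy. destruct (Z.eq_dec nu 0); [lia|easy].
- pose proof (part_ratio_bounds k X M HX) as Hq. set (q := part_ratio k X M) in *.
  pose proof (half_period_pos k X HX) as HP.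
  assert (HE : forall J, Rabs (fourier_coef k X (S M) nu) <= q ^ J * (2 * half_period k X)).
  { intros J. rewrite (fourier_coef_iter k X M J nu HX). fold q.
    rewrite (rsum_ext _ (fun _ => 0)), rsum_const.
    - rewrite !Rmult_0_r, Rplus_0_l, Rabs_mult, Rabs_pos_eq by (apply pow_le; lra).
      apply Rmult_le_compat_l; [apply pow_le; lra|now apply fourier_coef_bound].
    - intros j _. rewrite IH by lia. ring. }
  assert (HL : is_lim_seq (fun J => q ^ J * (2 * half_period k X)) (0 * (2 * half_period k X))).
  { apply (is_lim_seq_scal_r _ (2 * half_period k X) 0). apply is_lim_seq_geom.
    rewrite Rabs_pos_eq; lra. }
  rewrite Rmult_0_l in HL.
  assert (H0 : Rbar_le (Rabs (fourier_coef k X (S M) nu)) 0).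
  { apply is_lim_seq_le with (u := fun _ => Rabs (fourier_coef k X (S M) nu)) (3 := HL);
      [easy|apply is_lim_seq_const]. }
  simpl in H0. pose proof (Rabs_pos (fourier_coef k X (S M) nu)) as H1.
  destruct (Req_dec (fourier_coef k X (S M) nu) 0) as [|Hn]; [easy|].
  apply Rabs_pos_lt in Hn. lra.
Qed.

Definition euler_product (k : nat) (X : R) (M : nat) : R := rprod (fun m => 1 - part_ratio k X m) M.

(* [cnt A n] counts the partitions of [n] into the [A] smallest [k]th powers,
   each used at most [B] times. *)
Lemma fourier_coef_count (k B : nat) (X : R) (cnt : nat -> nat -> R) : 0 < X ->
  (forall n, cnt 0%nat n = match n with O => 1 | _ => 0 end) ->
  (forall A n, cnt (S A) n = rsum (fun j => if Nat.ltb n (j * part_power k A) then 0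
     else cnt A (n - j * part_power k A)%nat) (S B)) ->
  forall A n, (n <= B)%nat -> fourier_coef k X A (Z.of_nat n)
    = 2 * half_period k X * euler_product k X A * exp (- (INR n / X ^ k)) * cnt A n.
Proof.
intros HX H0 HS. assert (HXk : 0 < X ^ k) by now apply pow_lt.
induction A as [|A IH]; intros n Hn.
- rewrite fourier_coef_0, H0 by easy. unfold euler_product; cbn [rprod].
  destruct n as [|n].
  + simpl INR. rewrite Rdiv_0_l, Ropp_0, exp_0. simpl. ring.
  + destruct (Z.eq_dec (Z.of_nat (S n)) 0); [lia|]. ring.
- rewrite (fourier_coef_iter k X A (S B)) by easy.
  pose proof (part_power_pos k A) as HD. set (D := part_power k A) in *.
  (* [B + 1] steps of length [D >= 1] carry an index [n <= B] below 0, so the leftover coefficient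
     vanishes. *)
  rewrite (fourier_coef_neg k X (S A)) by (try easy; nia).
  rewrite Rmult_0_r, Rplus_0_r, HS. fold D.
  unfold euler_product; cbn [rprod]; fold (euler_product k X A).
  set (q := part_ratio k X A).
  rewrite (rsum_ext _ (fun j => 2 * half_period k X * euler_product k X A * exp (- (INR n / X ^
    k)) *
    (if Nat.ltb n (j * D) then 0 else cnt A (n - j * D)%nat))).
  + rewrite rsum_scal. ring.
  + intros j _. destruct (Nat.ltb_spec n (j * D)) as [H|H].
    * rewrite fourier_coef_neg by (try easy; lia). ring.
    * rewrite <- Nat2Z.inj_sub by easy. rewrite IH by lia.
      replace (exp (- (INR n / X ^ k))) with (q ^ j * exp (- (INR (n - j * D) / X ^ k))); [ring|].
      unfold q, part_ratio.       replace (exp (- part_scale k X A) ^ j) with (exp (- (INR j *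
        part_scale k X A))).
      2: { clear. induction j as [|j IHj]; [simpl; rewrite Rmult_0_l, Ropp_0; apply exp_0|].
           rewrite S_INR. simpl pow. rewrite <- IHj, <- exp_plus. f_equal. ring. }
      rewrite <- exp_plus. f_equal. rewrite minus_INR, mult_INR by easy.
      unfold D, part_scale. rewrite INR_part_power. unfold Rdiv. rewrite Rpow_mult_distr, pow_inv.
      ring.
Qed.

(** The additional parts exceed [nu] and cannot occur in its partitions, so they change only the
    normalisation. Multiplying by the two Euler products avoids a division. *)
Lemma fourier_coef_stable (k : nat) (X : R) (M M' : nat) (nu : Z) : 0 < X -> (1 <= k)%nat ->
  (nu <= Z.of_nat M)%Z -> (M <= M')%nat ->
  fourier_coef k X M' nu * euler_product k X M = fourier_coef k X M nu * euler_product k X M'.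
Proof.
intros HX Hk Hn HM. induction HM as [|M' HM IH]; [easy|].
rewrite fourier_coef_step by easy.
assert (HD : (M' < part_power k M')%nat).
{ unfold part_power. apply Nat.lt_le_trans with (Nat.pow (S M') 1); [simpl; lia|].
  apply Nat.pow_le_mono_r; lia. }
rewrite (fourier_coef_neg k X (S M')) by (try easy; lia).
unfold euler_product at 2; cbn [rprod]; fold (euler_product k X M').
rewrite Rmult_0_r, Rplus_0_r, Rmult_assoc, IH. ring.
Qed.

(** * The constant [c_k] *)

Lemma exp_neg_le_Hfun (t : R) : 0 <= t -> exp (- t) <= Hfun t.
Proof.
intros [Ht|<-].
- unfold Hfun. rewrite exp_Ropp. apply Rinv_le_contravar; [apply Efun0_pos|].
  pose proof (Efun0_exp t). pose proof (exp_ineq1_le (- t)) as H1.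
  assert (H2 : exp t * exp (- t) = 1) by (rewrite <- exp_plus; replace (t + - t) with 0 by ring;
    apply exp_0).
  pose proof (exp_pos t). apply Rmult_le_reg_l with t; [easy|]. nra.
- unfold Hfun. rewrite Efun0_at0, Ropp_0, exp_0. lra.
Qed.

(* The [l]th term of the expansion of [Hfun (v ^ k)] in powers of [exp (- v ^ k)]. *)
Definition gamma_density (k l : nat) (v : R) : R := v ^ k * exp (- (INR l * v ^ k)).

Lemma continuous_gamma_density (k l : nat) (v : R) : continuous (gamma_density k l) v.
Proof. apply @ex_derive_continuous. unfold gamma_density. auto_derive. easy. Qed.

Lemma continuous_exp_pow (k l : nat) (v : R) : continuous (fun v => exp (- (INR l * v ^ k))) v.
Proof. apply @ex_derive_continuous. auto_derive. easy. Qed.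

Lemma exp_mult_nat_le (l : nat) (t : R) : (1 <= l)%nat -> 0 <= t -> exp (- (INR l * t)) <= exp (-
  t).
Proof.
intros Hl Ht. apply (le_INR 1) in Hl. simpl in Hl.
destruct (Rle_lt_or_eq_dec (t) (INR l * t) ltac:(nra)) as [H| <-]; [|lra].
left. apply exp_increasing. lra.
Qed.

Lemma gamma_density_decay (k : nat) : (1 <= k)%nat -> exists C, 0 <= C /\
  forall l v, (1 <= l)%nat -> 0 <= v -> Rabs (gamma_density k l v) <= C / (1 + v) ^ 2.
Proof.
intros Hk.
assert (HG : schwartz k (fun v => Hfun (v ^ k) * v ^ k)).
{ exists (fun v => v ^ k). split; [apply symbol_pow|easy]. }
destruct (schwartz_decay k _ 2 Hk HG) as [C [HC H]].
exists C. split; [easy|]. intros l v Hl Hv. eapply Rle_trans; [|apply (H v Hv)].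
assert (Hvk : 0 <= v ^ k) by now apply pow_le.
pose proof (Hfun_pos (v ^ k)). pose proof (exp_neg_le_Hfun _ Hvk).
pose proof (exp_mult_nat_le l _ Hl Hvk). pose proof (exp_pos (- (INR l * v ^ k))).
unfold gamma_density. rewrite !Rabs_pos_eq by nra. nra.
Qed.

(** * Dilations, the Gamma integral and the zeta series *)

Definition kth_root (k : nat) (y : R) : R := Rpower y (/ INR k).

Lemma kth_root_pos (k : nat) (y : R) : 0 < kth_root k y.
Proof. apply exp_pos. Qed.

Lemma kth_root_pow (k : nat) (y : R) : (1 <= k)%nat -> 0 < y -> kth_root k y ^ k = y.
Proof.
intros Hk Hy. rewrite <- Rpower_pow by apply kth_root_pos. unfold kth_root.
rewrite Rpower_mult, Rinv_l by (apply not_0_INR; lia). now apply Rpower_1.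
Qed.

Lemma kth_root_lt (k : nat) (y z : R) : (1 <= k)%nat -> 0 < y -> 0 <= z -> y < z ^ k -> kth_root
  k y < z.
Proof.
intros Hk Hy Hz H. destruct (Rlt_le_dec (kth_root k y) z) as [|Hle]; [easy|].
assert (z ^ k <= kth_root k y ^ k) by (apply pow_incr; lra).
rewrite kth_root_pow in H0 by easy. lra.
Qed.

Lemma kth_root_gt (k : nat) (y z : R) : (1 <= k)%nat -> 0 < y -> z ^ k < y -> z < kth_root k y.
Proof.
intros Hk Hy H. destruct (Rlt_le_dec z (kth_root k y)) as [|Hle]; [easy|].
pose proof (kth_root_pos k y).
assert (kth_root k y ^ k <= z ^ k) by (apply pow_incr; lra).
rewrite kth_root_pow in H1 by easy. lra.
Qed.

Lemma RInt_dilate (f : R -> R) (a b : R) : (forall v, continuous f v) ->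
  a * RInt (fun v => f (a * v)) 0 b = RInt f 0 (a * b).
Proof.
intros Hf. pose proof (RInt_comp_lin f a 0 0 b) as H.
rewrite Rmult_0_r, !Rplus_0_r in H. rewrite <- H by now apply ex_RInt_cont.
change (scal a (RInt (fun v => f (a * v)) 0 b) = RInt (fun y => scal a (f (a * y + 0))) 0 b).
rewrite <- (RInt_scal (fun v => f (a * v)) 0 b a).
- apply RInt_ext. intros x _. now rewrite Rplus_0_r.
- apply ex_RInt_cont. intros v. apply (continuous_comp (fun v => a * v) f); [|apply Hf].
  apply @ex_derive_continuous. auto_derive. easy.
Qed.

Lemma Jint_unique (f : R -> R) (l : R) : is_lim_seq (fun N => RInt f 0 (INR N)) l -> Jint f = l.
Proof. intros H. unfold Jint. now rewrite (is_lim_seq_unique _ _ H). Qed.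

Lemma RInt_dilate_lim (f : R -> R) (C a : R) : (forall v, continuous f v) ->
  (forall v, 0 <= v -> Rabs (f v) <= C / (1 + v) ^ 2) -> 0 < a ->
  is_lim_seq (fun N => RInt f 0 (a * INR N)) (Jint f).
Proof.
intros Hc Hf Ha.
apply is_lim_seq_ext with (fun N => Jint f + - (Jint f - RInt f 0 (a * INR N))); [intros; ring|].
replace (Finite (Jint f)) with (Finite (Jint f + 0)) by (f_equal; ring).
apply is_lim_seq_plus'; [apply is_lim_seq_const|].
apply is_lim_seq_abs_0.
apply is_lim_seq_le_le with (fun _ => 0) (fun N => C * / (1 + a * INR N)).
- intros N. split; [apply Rabs_pos|]. rewrite Rabs_Ropp.
  apply (Jint_tail f C (a * INR N) Hc Hf). apply Rmult_le_pos; [lra|apply pos_INR].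
- apply is_lim_seq_const.
- replace (Finite 0) with (Rbar_mult C 0) by (simpl; now rewrite Rmult_0_r).
  apply is_lim_seq_scal_l.
  replace (Finite 0) with (Rbar_inv p_infty) by reflexivity.
  apply is_lim_seq_inv; [|easy].
  apply is_lim_seq_plus with 1 p_infty; [apply is_lim_seq_const| |easy].
  replace p_infty with (Rbar_mult a p_infty).
  + apply is_lim_seq_scal_l, is_lim_seq_INR.
  + simpl. destruct (Rle_dec 0 a) as [H|H]; [|lra]. destruct (Rle_lt_or_eq_dec 0 a H); [easy|lra].
Qed.

(** The dilation by [l ^ (1 / k)] turns [l * v ^ k] into [v ^ k]; the prefactor [v ^ k] and the
    differential together give [l ^ -(1 + 1 / k)], a term of the Dirichlet series of zeta. *)
Lemma Jint_gamma_density (k l : nat) : (1 <= k)%nat -> (1 <= l)%nat ->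
  Jint (gamma_density k l) = Rpower (INR l) (- (1 + / INR k)) * Jint (gamma_density k 1).
Proof.
intros Hk Hl. destruct (gamma_density_decay k Hk) as [C [HC Hd]].
assert (Hl0 : 0 < INR l) by (apply lt_0_INR; lia).
set (a := kth_root k (INR l)). assert (Ha : 0 < a) by apply kth_root_pos.
assert (Hak : a ^ k = INR l) by now apply kth_root_pow.
apply Jint_unique.
apply is_lim_seq_ext with (fun N => Rpower (INR l) (- (1 + / INR k)) * RInt (gamma_density k 1) 0
  (a * INR N)).
- intros N. rewrite <- RInt_dilate by apply continuous_gamma_density.
  rewrite Ropp_plus_distr, Rpower_plus, !Rpower_Ropp, Rpower_1 by easy.
  fold (kth_root k (INR l)). fold a.
  replace (/ INR l * / a * (a * RInt (fun v => gamma_density k 1 (a * v)) 0 (INR N)))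
    with (/ INR l * RInt (fun v => gamma_density k 1 (a * v)) 0 (INR N)) by (field; lra).
  change (scal (/ INR l) (RInt (fun v => gamma_density k 1 (a * v)) 0 (INR N)) = RInt
    (gamma_density k l) 0 (INR N)).
  rewrite <- (RInt_scal (fun v => gamma_density k 1 (a * v)) 0 (INR N) (/ INR l)).
  + apply RInt_ext. intros v _. unfold gamma_density, scal; simpl; unfold mult; simpl.
    rewrite Rpow_mult_distr, Hak. replace (1 * (INR l * v ^ k)) with (INR l * v ^ k) by ring.
    field. lra.
  + apply ex_RInt_cont. intros v. apply (continuous_comp (fun v => a * v) (gamma_density k 1)).
    * apply @ex_derive_continuous. auto_derive. easy.
    * apply continuous_gamma_density.
- apply (is_lim_seq_scal_l _ (Rpower (INR l) (- (1 + / INR k))) (Jint (gamma_density k 1))).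
  apply RInt_dilate_lim with C; [apply continuous_gamma_density|intros v Hv; apply Hd;
    [lia|easy]|easy].
Qed.

(** Partial sums of [t / (exp t - 1)] as a geometric series in [exp (- t)], with the remainder in
    exact form so that it can be integrated. *)
Lemma Hfun_expansion (k L : nat) (v : R) :
  Hfun (v ^ k) - rsum (fun l => gamma_density k (S l) v) L = Hfun (v ^ k) * exp (- (INR L * v ^ k)).
Proof.
induction L as [|L IH].
- simpl. rewrite Rmult_0_l, Ropp_0, exp_0. ring.
- cbn [rsum]. set (t := v ^ k) in *.
  replace (Hfun t - (rsum (fun l => gamma_density k (S l) v) L + gamma_density k (S L) v))
    with (Hfun t - rsum (fun l => gamma_density k (S l) v) L - gamma_density k (S L) v) by ring.
  rewrite IH. unfold gamma_density. fold t.
  assert (Ht : Hfun t * (exp t - 1) = t).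
  { rewrite Efun0_exp. unfold Hfun. pose proof (Efun0_pos t). field. lra. }
  replace (exp (- (INR L * t))) with (exp (- (INR (S L) * t)) * exp t).
  + set (E := exp (- (INR (S L) * t))).
    replace (t * E) with (Hfun t * (exp t - 1) * E) by (rewrite Ht; ring). ring.
  + rewrite <- exp_plus. f_equal. rewrite S_INR. ring.
Qed.

(** As [Hfun <= 1], the integral of the exact remainder is at most that of [exp (- L * v ^ k)],
    which by dilation is at most [C / L ^ (1 / k)]. Sum and integral are thus exchanged with an
    explicit error. *)
Lemma Jint_Hfun_partial (k : nat) : (1 <= k)%nat -> exists C, 0 <= C /\ forall L, (1 <= L)%nat ->
  Rabs (saddle_const k 0 - Jint (gamma_density k 1) * rsum (fun l => Rpower (INR (S l)) (- (1 + /
    INR k))) L)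
    <= C / kth_root k (INR L).
Proof.
intros Hk.
assert (HG : schwartz k (fun v => Hfun (v ^ k))).
{ exists (fun _ => 1). split; [constructor|intros; ring]. }
destruct (schwartz_decay k _ 2 Hk HG) as [C [HC Hdec]].
destruct (gamma_density_decay k Hk) as [C' [HC' Hd]].
assert (HcH := schwartz_continuous k _ HG).
exists C. split; [easy|]. intros L HL.
assert (HL0 : 0 < INR L) by (apply lt_0_INR; lia).
set (a := kth_root k (INR L)). assert (Ha : 0 < a) by apply kth_root_pos.
assert (Hak : a ^ k = INR L) by now apply kth_root_pow.
set (rem := fun v => Hfun (v ^ k) * exp (- (INR L * v ^ k))).
assert (Hcr : forall v, continuous rem v).
{ intros v. apply (continuous_mult (fun v => Hfun (v ^ k)) (fun v => exp (- (INR L * v ^ k)))).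
  apply HcH. apply continuous_exp_pow. }
assert (HN : forall N, RInt rem 0 (INR N) = RInt (fun v => Hfun (v ^ k)) 0 (INR N)
   - rsum (fun l => RInt (gamma_density k (S l)) 0 (INR N)) L).
{ intros N. apply is_RInt_unique.
  apply is_RInt_ext with (fun v => minus (Hfun (v ^ k)) (rsum (fun l => gamma_density k (S l) v)
    L)).
  - intros v _. exact (Hfun_expansion k L v).
  - apply (is_RInt_minus (fun v => Hfun (v ^ k))).
    + apply @RInt_correct. now apply ex_RInt_cont.
    + clear -Hk. induction L as [|L IH].
      * cbn [rsum]. replace 0 with (scal (INR N - 0) 0) at 2 by (unfold scal; simpl; unfold mult;
        simpl; ring).
        apply @is_RInt_const.
      * cbn [rsum]. apply (is_RInt_plus (fun v => rsum (fun l => gamma_density k (S l) v) L));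
        [easy|].
        apply @RInt_correct. apply ex_RInt_cont, continuous_gamma_density. }
assert (Hb : forall N, Rabs (RInt rem 0 (INR N)) <= C / a).
{ intros N. set (st := fun v => exp (- v ^ k)).
  assert (Hcs : forall v, continuous st v).
  { intros v. apply @ex_derive_continuous. unfold st. auto_derive. easy. }
  assert (Hst : forall v, 0 <= v -> Rabs (st v) <= C / (1 + v) ^ 2).
  { intros v Hv. eapply Rle_trans; [|apply (Hdec v Hv)]. unfold st.
    pose proof (exp_neg_le_Hfun (v ^ k) (pow_le _ k Hv)). pose proof (Hfun_pos (v ^ k)).
    rewrite !Rabs_pos_eq; [easy|lra|left; apply exp_pos]. }
  assert (Hcsa : forall v, continuous (fun v => st (a * v)) v).
  { intros v. apply (continuous_comp (fun v => a * v) st); [|apply Hcs].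
    apply @ex_derive_continuous. auto_derive. easy. }
  pose proof (pos_INR N) as HN0.
  assert (H1 : Rabs (RInt rem 0 (INR N)) <= RInt (fun v => st (a * v)) 0 (INR N)).
  { eapply Rle_trans; [apply abs_RInt_le; [easy|now apply ex_RInt_cont]|].
    apply RInt_le; [easy| |now apply ex_RInt_cont|].
    - apply ex_RInt_cont. intros v. apply (continuous_comp rem Rabs);
      [apply Hcr|apply continuous_Rabs].
    - intros v Hv. unfold rem, st. rewrite Rpow_mult_distr, Hak.
      pose proof (exp_pos (- (INR L * v ^ k))). pose proof (Hfun_pos (v ^ k)).
      assert (Hfun (v ^ k) <= 1) by (apply Hfun_le1, pow_le; lra).
      rewrite Rabs_pos_eq by nra. nra. }
  eapply Rle_trans; [apply H1|].
  apply Rmult_le_reg_l with a; [easy|]. rewrite (RInt_dilate st a (INR N) Hcs).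
  replace (a * (C / a)) with C by (field; lra).
  assert (HaN : 0 <= a * INR N) by (apply Rmult_le_pos; lra).
  pose proof (RInt_decay st C 0 (a * INR N) Hcs Hst ltac:(lra)) as H2.
  assert (0 <= C / (1 + a * INR N)) by (apply Rdiv_le_0_compat; lra).
  pose proof (Rle_abs (RInt st 0 (a * INR N))). lra. }
assert (Hlim : is_lim_seq (fun N => RInt rem 0 (INR N))
  (saddle_const k 0 - Jint (gamma_density k 1) * rsum (fun l => Rpower (INR (S l)) (- (1 + / INR
    k))) L)).
{ apply is_lim_seq_ext with (1 := fun N => eq_sym (HN N)).
  apply is_lim_seq_minus'; [now apply schwartz_RInt_lim with k|].
  rewrite <- rsum_scal. clear -Hk Hd HC'. induction L as [|L IH].
  - cbn [rsum]. apply is_lim_seq_const.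
  - cbn [rsum]. apply is_lim_seq_plus'; [easy|].
    rewrite Rmult_comm, <- Jint_gamma_density by (try easy; lia).
    apply Jint_lim with C'; [apply continuous_gamma_density|]. intros v Hv. apply Hd; [lia|easy]. }
apply is_lim_seq_Rabs_le with (1 := Hlim) (v := fun _ => C / a); [apply is_lim_seq_const|easy].
Qed.

Lemma kth_root_INR_lim (k : nat) : (1 <= k)%nat -> is_lim_seq (fun L => kth_root k (INR L)) p_infty.
Proof.
intros Hk. apply is_lim_seq_spec. intros B.
destruct (nfloor_ex (Rabs B ^ k) ltac:(apply pow_le, Rabs_pos)) as [N HN].
exists (S N). intros n Hn. apply le_INR in Hn. rewrite S_INR in Hn.
pose proof (pow_le (Rabs B) k (Rabs_pos B)).
eapply Rle_lt_trans; [apply Rle_abs|]. apply kth_root_gt; [easy|lra|lra].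
Qed.

Lemma saddle_const_series (k : nat) (z : R) : (1 <= k)%nat ->
  is_lim_seq (rsum (fun l => Rpower (INR (S l)) (- (1 + / INR k)))) z ->
  saddle_const k 0 = Jint (gamma_density k 1) * z.
Proof.
intros Hk Hz. destruct (Jint_Hfun_partial k Hk) as [C [HC H]].
set (g := Jint (gamma_density k 1)) in *. set (u := rsum _) in Hz.
assert (H0 : is_lim_seq (fun L => saddle_const k 0 - g * u L) 0).
{ apply is_lim_seq_abs_0.
  apply is_lim_seq_le_le_loc with (fun _ => 0) (fun L => C * / kth_root k (INR L)).
  - exists 1%nat. intros L HL. split; [apply Rabs_pos|]. now apply H.
  - apply is_lim_seq_const.
  - replace (Finite 0) with (Rbar_mult C 0) by (simpl; now rewrite Rmult_0_r).
    apply is_lim_seq_scal_l. replace (Finite 0) with (Rbar_inv p_infty) by reflexivity.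
    apply is_lim_seq_inv; [now apply kth_root_INR_lim|easy]. }
assert (H1 : is_lim_seq (fun L => saddle_const k 0 - g * u L) (saddle_const k 0 - g * z)).
{ apply is_lim_seq_minus'; [apply is_lim_seq_const|]. now apply (is_lim_seq_scal_l u g z). }
apply is_lim_seq_unique in H0, H1. rewrite H0 in H1. injection H1 as H2. apply Rminus_diag_uniq.
symmetry. exact H2.
Qed.

(** The substitution [t = v ^ k], carried out through the explicit primitive [Om] on [t > 0]. The
    generalised integral is a limit over pairs of end points, so both tails are estimated
    directly. *)
Lemma Gamma_Jint (k : nat) : (1 <= k)%nat ->
  Gamma (1 + / INR k) = INR k * Jint (gamma_density k 1).
Proof.
intros Hk. destruct (gamma_density_decay k Hk) as [C [HC Hd]].
assert (Hkk : 0 < INR k) by (apply lt_0_INR; lia).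
set (g := gamma_density k 1). set (W := RInt g 0).
assert (Hcg : forall v, continuous g v) by apply continuous_gamma_density.
assert (Hg : forall v, 0 <= v -> Rabs (g v) <= C / (1 + v) ^ 2) by (intros; apply Hd; [lia|easy]).
set (f := fun t => Rpower t (1 + / INR k - 1) * exp (- t)).
set (Om := fun t => INR k * W (kth_root k t)).
assert (HOm : forall t, 0 < t -> is_derive Om t (f t)).
{ intros t Ht. unfold Om.
  replace (f t) with (INR k * (/ INR k * Rpower t (/ INR k - 1) * g (kth_root k t))).
  - apply (is_derive_scal (fun t => W (kth_root k t))).
    apply (is_derive_comp W (kth_root k)).
    + apply (is_derive_RInt g W 0); [|apply Hcg].
      apply filter_forall. intros x. apply @RInt_correct. now apply ex_RInt_cont.
    + apply is_derive_Reals. now apply derivable_pt_lim_power.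
  - unfold f, g, gamma_density. rewrite kth_root_pow by easy. simpl (INR 1). rewrite Rmult_1_l.
    replace (1 + / INR k - 1) with ((/ INR k - 1) + 1) by ring.
    rewrite Rpower_plus, Rpower_1 by easy. field. lra. }
assert (Hcf : forall t, 0 < t -> continuous f t).
{ intros t Ht. apply @ex_derive_continuous. unfold f, Rpower. auto_derive. easy. }
unfold Gamma. fold f. apply is_RInt_gen_unique.
intros P [eps HP].
(* With a lower limit below [e ^ k] and an upper limit above [e ^ -k], each tail costs at most
   [eps / 4]; [C + 1] keeps the denominator positive when [C = 0]. *)
set (e := eps / (4 * INR k * (C + 1))).
assert (Heps := cond_pos eps).
assert (He : 0 < e) by (apply Rdiv_lt_0_compat; [easy|]; repeat apply Rmult_lt_0_compat; lra).
assert (Hee : INR k * (C * e) <= eps / 4).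
{ apply Rle_trans with (INR k * ((C + 1) * e)).
  - apply Rmult_le_compat_l; [lra|]. apply Rmult_le_compat_r; lra.
  - right. unfold e. field. lra. }
assert (Hek : 0 < e ^ k) by now apply pow_lt.
apply Filter_prod with (Q := fun a => 0 < a < e ^ k) (R := fun b => (/ e) ^ k < b).
- exists (mkposreal _ Hek). intros y Hy Hy0. change (Rabs (y - 0) < e ^ k) in Hy.
  rewrite Rminus_0_r, Rabs_pos_eq in Hy by lra. easy.
- exists ((/ e) ^ k). easy.
- intros a b Ha Hb. exists (minus (Om b) (Om a)).
  assert (Hie : 0 < / e) by now apply Rinv_0_lt_compat.
  assert (Hb0 : 0 < b) by (pose proof (pow_lt _ k Hie); lra).
  assert (Hab : forall x, Rmin a b <= x -> 0 < x).
  { intros x Hx. pose proof (Rmin_glb_lt a b 0 ltac:(lra) ltac:(lra)). lra. }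
  split.
  + apply (is_RInt_derive Om); intros x Hx; [apply HOm|apply Hcf]; apply Hab, Hx.
  + apply HP. change (Rabs ((Om b - Om a) - INR k * Jint g) < eps).
    assert (B1 : Rabs (Om a) <= eps / 4).
    { unfold Om. rewrite Rabs_mult, Rabs_pos_eq by lra.
      assert (Hr := kth_root_lt k a e Hk ltac:(lra) ltac:(lra) ltac:(lra)).
      pose proof (kth_root_pos k a) as Hr0. set (r := kth_root k a) in *.
      eapply Rle_trans; [|apply Hee]. apply Rmult_le_compat_l; [lra|].
      eapply Rle_trans; [apply (RInt_decay g C 0 r); try easy; lra|].
      replace (C / (1 + 0) - C / (1 + r)) with (C * (r / (1 + r))) by (field; lra).
      apply Rmult_le_compat_l; [easy|]. apply Rmult_le_reg_r with (1 + r); [lra|].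
      replace (r / (1 + r) * (1 + r)) with r by (field; lra). nra. }
    assert (B2 : Rabs (INR k * Jint g - Om b) <= eps / 4).
    { unfold Om. rewrite <- Rmult_minus_distr_l, Rabs_mult, Rabs_pos_eq by lra.
      assert (Hr := kth_root_gt k b (/ e) Hk Hb0 Hb). set (r := kth_root k b) in *.
      eapply Rle_trans; [|apply Hee]. apply Rmult_le_compat_l; [lra|].
      eapply Rle_trans; [apply (Jint_tail g C r); try easy; lra|].
      apply Rmult_le_compat_l; [easy|].
      rewrite <- (Rinv_inv e). apply Rinv_le_contravar; lra. }
    replace (Om b - Om a - INR k * Jint g) with (- (INR k * Jint g - Om b) + - Om a) by ring.
    eapply Rle_lt_trans; [apply Rabs_triang|]. rewrite !Rabs_Ropp. lra.
Qed.

Lemma zeta_partial_sums (zeta : C -> C) (s : R) : is_Riemann_zeta zeta -> 1 < s ->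
  is_lim_seq (rsum (fun l => Rpower (INR (S l)) (- s))) (Re (zeta (RtoC s))).
Proof.
intros [Hz _] Hs. specialize (Hz (RtoC s) Hs).
assert (HR : is_lim_seq (fun n => Re (sum_n (fun m => Cpower_nat (S m) (Copp (RtoC s))) n : C))
  (Re (zeta (RtoC s)))).
{ apply (filterlim_comp _ _ _ (sum_n (fun m => Cpower_nat (S m) (Copp (RtoC s)) :
  C_NormedModule)) (fun z : C => fst z)
    _ (locally (zeta (RtoC s)))); [exact Hz|].
  destruct (zeta (RtoC s)) as [x y]. apply (continuous_fst x y). }
apply is_lim_seq_incr_1.
eapply is_lim_seq_ext; [|exact HR]. intros n.
assert (HC : forall l, Re (Cpower_nat (S l) (Copp (RtoC s))) = Rpower (INR (S l)) (- s)).
{ intros l. unfold Cpower_nat, Cexp, Rpower.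
  change (exp (Re (Cmult (Copp (RtoC s)) (RtoC (ln (INR (S l)))))) * cos (Im (Cmult (Copp (RtoC
    s)) (RtoC (ln (INR (S l))))))
    = exp (- s * ln (INR (S l)))).
  replace (Im (Cmult (Copp (RtoC s)) (RtoC (ln (INR (S l)))))) with 0
    by (unfold Im, Cmult, Copp, RtoC; cbn [fst snd]; ring).
  rewrite cos_0, Rmult_1_r. f_equal. unfold Re, Cmult, Copp, RtoC; cbn [fst snd]. ring. }
induction n as [|n IH].
- rewrite sum_O. cbn [rsum]. rewrite HC. ring.
- rewrite sum_Sn. cbn [rsum] in *. rewrite <- IH, <- (HC (S n)). reflexivity.
Qed.

Lemma c_coef_saddle_const (zeta : C -> C) (k : nat) : is_Riemann_zeta zeta -> (1 <= k)%nat ->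
  c_coef zeta k = saddle_const k 0.
Proof.
intros Hz Hk. assert (Hkk : 0 < INR k) by (apply lt_0_INR; lia).
assert (Hki : 0 < / INR k) by now apply Rinv_0_lt_compat.
pose proof (zeta_partial_sums zeta (1 + / INR k) Hz ltac:(lra)) as HL.
rewrite (saddle_const_series k _ Hk HL). unfold c_coef. rewrite Gamma_Jint by easy.
field. lra.
Qed.

(** * Shifted coefficients *)

(* The ratio [b] between a shift [d] of [n] and the rescaled variable [Y]. *)
Definition shift_scale (k : nat) (d X : R) : R := d * (/ sqrt X) ^ (2 * k + 1).

(** The integral of [exp (d z)] against the weight, without the real factor [exp (d x)]; the factors
    for [d] and [- d] have product 1. *)
Definition twisted_moment (k : nat) (c d X : R) (M : nat) : R :=
  RInt (fun Y => Re (Cmult (cis (shift_scale k d X * Y)) (weight k c X M Y)))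
    (- half_period k X) (half_period k X).

(** Taylor expansion of [exp (i b Y)]. The remainder [|b Y| ^ 5] is integrable against the weight,
    whose decay absorbs [|Y| ^ 5]. *)
Lemma twisted_moment_expansion (k : nat) (c d : R) : (1 <= k)%nat ->
  bigO (5 * (2 * k + 1)) (fun X M => let b := shift_scale k d X in let A := moment k c X M in
    twisted_moment k c d X M - (A 0%nat + b * A 1%nat + b ^ 2 / 2 * A 2%nat + b ^ 3 / 6 * A 3%nat
      + b ^ 4 / 24 * A 4%nat)).
Proof.
intros Hk. destruct (weight_pow_bound k 5 1 Hk) as [K [X0 [HK [HX0 HW]]]].
exists (4 * (2 * Rabs d ^ 5 * K)), X0.
assert (Hd5 : 0 <= Rabs d ^ 5) by apply pow_le, Rabs_pos.
assert (HdK : 0 <= Rabs d ^ 5 * K) by now apply Rmult_le_pos.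
split; [lra|]. split; [easy|].
intros X M HX HM. cbv beta zeta. set (b := shift_scale k d X). set (A := moment k c X M).
assert (HMX := cube_ge X M ltac:(lra) HM).
pose proof (inv_sqrt_bounds X ltac:(lra)) as He.
set (e := / sqrt X) in *. set (P := half_period k X).
assert (HP : 0 < P) by (apply half_period_pos; lra).
set (w := weight k c X M).
assert (Hb5 : Rabs b ^ 5 = Rabs d ^ 5 * e ^ (5 * (2 * k + 1))).
{ unfold b, shift_scale. fold e. rewrite Rabs_mult, (Rabs_pos_eq (e ^ _)) by (apply pow_le; lra).
  rewrite Rpow_mult_distr, <- pow_mult. f_equal. f_equal. lia. }
assert (Hcr : forall i y, continuous (fun Y => rot i (w Y)) y).
{ intros i y. apply continuous_rot_weight. lra. }
set (f := fun Y => cos (b * Y) * rot 0 (w Y) + sin (b * Y) * rot 1 (w Y)).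
assert (Hcf : forall y, continuous f y).
{ intros y. unfold f. apply continuous_Rplus; apply continuous_Rmult; try apply Hcr;
    apply @ex_derive_continuous; auto_derive; easy. }
assert (Htw : twisted_moment k c d X M = RInt f (- P) P).
{ apply RInt_ext. intros Y _. fold b w. unfold f. destruct (w Y) as [u v].
  change (@eq R (cos (b * Y) * u - sin (b * Y) * v) (cos (b * Y) * u + sin (b * Y) * (0 * u - 1 *
    v))). ring. }
set (g := fun i Y => Y ^ i * rot i (w Y)).
assert (Hcg : forall i y, continuous (g i) y).
{ intros i y. apply continuous_Rmult; [apply continuous_Rpow|apply Hcr]. }
set (h := fun Y => f Y - (g 0%nat Y + b * g 1%nat Y + b ^ 2 / 2 * g 2%nat Y + b ^ 3 / 6 * g 3%nat
  Y + b ^ 4 / 24 * g 4%nat Y)).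
assert (Hlin : forall a u v iu iv, is_RInt u (- P) P iu -> is_RInt v (- P) P iv ->
    is_RInt (fun y => u y + a * v y) (- P) P (iu + a * iv)).
{ intros a u v iu iv Hu Hv. apply (is_RInt_plus u (fun y => a * v y)); [easy|].
  now apply (is_RInt_scal v _ _ a). }
assert (Hg : forall i, is_RInt (g i) (- P) P (A i)).
{ intros i. apply @RInt_correct. now apply ex_RInt_cont. }
assert (Hf : is_RInt f (- P) P (RInt f (- P) P)) by (apply @RInt_correct; now apply ex_RInt_cont).
assert (Hpoly := Hlin (b ^ 4 / 24) _ _ _ _ (Hlin (b ^ 3 / 6) _ _ _ _ (Hlin (b ^ 2 / 2) _ _ _ _
  (Hlin b _ _ _ _ (Hg 0%nat) (Hg 1%nat)) (Hg 2%nat)) (Hg 3%nat)) (Hg 4%nat)).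
assert (Hh := is_RInt_unique (V := R_CompleteNormedModule) _ _ _ _ (Hlin (-1) _ _ _ _ Hf Hpoly)).
rewrite Htw.
match goal with |- Rabs ?x <= _ => replace x with (RInt f (- P) P + -1 *
  (A 0%nat + b * A 1%nat + b ^ 2 / 2 * A 2%nat + b ^ 3 / 6 * A 3%nat + b ^ 4 / 24 * A 4%nat)) by
    ring end.
rewrite <- Hh.
replace (4 * (2 * Rabs d ^ 5 * K) * e ^ (5 * (2 * k + 1))) with (4 * (2 * Rabs b ^ 5 * K)) by
  (rewrite Hb5; ring).
apply RInt_arctan_bound; [lra| |].
- intros y. apply continuous_Rplus; [apply Hcf|].
  apply continuous_Rmult; [apply continuous_const|].
  repeat (apply continuous_Rplus; [|apply continuous_Rmult; [apply continuous_const|apply Hcg]]).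
  apply Hcg.
- intros Y HY. specialize (HW c X M Y HX HMX HY). rewrite pow_1 in HW. fold w in HW.
  match goal with |- Rabs ?x <= _ => replace x with
    ((cos (b * Y) - (1 - (b * Y) ^ 2 / 2 + (b * Y) ^ 4 / 24)) * rot 0 (w Y)
      + (sin (b * Y) - (b * Y - (b * Y) ^ 3 / 6)) * rot 1 (w Y)) end.
  2: { unfold f, g. rewrite (rot_SS 2), (rot_SS 1), (rot_SS 0). field. }
  destruct (cos_sin_taylor5 (b * Y)) as [Hc Hs].
  set (W := Cmod (w Y)) in *. assert (HW0 : 0 <= W) by apply Cmod_ge_0.
  replace (2 * Rabs b ^ 5 * K / (1 + Y ^ 2)) with (2 * (Rabs b ^ 5 * (K / (1 + Y ^ 2))))
    by (field; pose proof (pow2_ge_0 Y); lra).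
  assert (Hm : forall u v, Rabs u <= Rabs (b * Y) ^ 5 -> Rabs v <= W -> Rabs (u * v) <= Rabs b ^
    5 * (K / (1 + Y ^ 2))).
  { intros u v Hu Hv. rewrite Rabs_mult.
    apply Rle_trans with (Rabs (b * Y) ^ 5 * W).
    - apply Rmult_le_compat; auto using Rabs_pos.
    - rewrite Rabs_mult, Rpow_mult_distr, Rmult_assoc.
      apply Rmult_le_compat_l; [apply pow_le, Rabs_pos|easy]. }
  eapply Rle_trans; [apply Rabs_triang|].
  pose proof (Hm _ _ Hc (rot_Rabs_le 0 (w Y))). pose proof (Hm _ _ Hs (rot_Rabs_le 1 (w Y))). lra.
Qed.

Lemma bigO_shift_scale (k : nat) (d : R) (p : nat) :
  bigO (p * (2 * k + 1)) (fun X _ => shift_scale k d X ^ p).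
Proof.
apply (bigO_eq _ _ (fun X _ => d ^ p * (/ sqrt X) ^ (p * (2 * k + 1)))).
- intros X M _ _. unfold shift_scale. rewrite Rpow_mult_distr, <- pow_mult. do 2 f_equal. lia.
- apply bigO_scal, bigO_eps_pow.
Qed.

Definition twisted_ratio (k : nat) (d X : R) (M : nat) : R :=
  twisted_moment k (saddle_const k 0) d X M / moment k (saddle_const k 0) X M 0.

Lemma shift_scale_opp (k : nat) (d X : R) : shift_scale k (- d) X = - shift_scale k d X.
Proof. unfold shift_scale. ring. Qed.

Lemma twisted_ratio_expansion (k : nat) (d : R) : (1 <= k)%nat ->
  bigO (4 * (2 * k + 1)) (fun X M => let b := shift_scale k d X in
    twisted_ratio k d X M - (1 + b * norm_moment k 1 X M + b ^ 2 / 2 * norm_moment k 2 X M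
      + b ^ 3 / 6 * norm_moment k 3 X M)).
Proof.
intros Hk.
pose proof (bigO_mult 0 _ _ _ (bigO_moment_inv k Hk) (twisted_moment_expansion k (saddle_const k
  0) d Hk)) as H.
apply (bigO_weaken (4 * (2 * k + 1))) in H; [|lia].
pose proof (bigO_scal (1 / 24) _ _ (bigO_mult _ 0 _ _ (bigO_shift_scale k d 4)
  (norm_moment_bounded k 4 Hk))) as H4.
apply (bigO_weaken (4 * (2 * k + 1))) in H4; [|lia].
destruct (moment0_lower k Hk) as [lb [X0 [Hb [HX0 Hlow]]]].
pose proof (bigO_plus _ _ _ H H4) as HT. revert HT. apply (bigO_ext _ _ _ X0).
intros X M HX HX1 HM. specialize (Hlow X M HX HM). cbv zeta beta. unfold twisted_ratio, norm_moment.
field. lra.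
Qed.

(* The exponential tilt cancels in the product, leaving the variance of [Y]. *)
Lemma twisted_ratio_product (k : nat) (d : R) : (1 <= k)%nat ->
  let c := saddle_const k 0 in let al := / INR k in
  bigO (4 * k + 6) (fun X M => twisted_ratio k d X M * twisted_ratio k (- d) X M
   - (1 + shift_scale k d X ^ 2 * (- / ((al + 1) * c) + (al + 3) / (2 * (al + 1) * c ^ 2) * / X))).
Proof.
intros Hk c al.
set (b := fun X (M : nat) => shift_scale k d X).
set (a := fun i => norm_moment k i).
assert (Ha : forall i, bigO 0 (a i)) by (intros; now apply norm_moment_bounded).
assert (Hb : forall p, bigO (p * (2 * k + 1)) (fun X M => b X M ^ p)) by (intros;
  apply bigO_shift_scale).
pose proof (twisted_ratio_expansion k d Hk) as Hp.
pose proof (twisted_ratio_expansion k (- d) Hk) as Hm.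
cbv zeta in Hp, Hm.
set (ep := fun X M => twisted_ratio k d X M - (1 + b X M * a 1%nat X M + b X M ^ 2 / 2 * a 2%nat
  X M + b X M ^ 3 / 6 * a 3%nat X M)).
set (em := fun X M => twisted_ratio k (- d) X M - (1 + - b X M * a 1%nat X M + b X M ^ 2 / 2 * a
  2%nat X M + - b X M ^ 3 / 6 * a 3%nat X M)).
assert (Hep : bigO (4 * (2 * k + 1)) ep) by exact Hp.
assert (Hem : bigO (4 * (2 * k + 1)) em).
{ revert Hm. apply bigO_eq. intros X M _ _. unfold em, b. rewrite shift_scale_opp.
  fold (a 1%nat) (a 2%nat) (a 3%nat).
  field. }
assert (HR : forall d', bigO 0 (twisted_ratio k d')).
{ intros d'. pose proof (twisted_ratio_expansion k d' Hk) as H. apply (bigO_weaken 0) in H; [|lia].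
  set (b' := fun X (M : nat) => shift_scale k d' X).
  assert (Hb' : forall p i q, bigO 0 (fun X M => q * (b' X M ^ p * a i X M))).
  { intros p i q. apply bigO_scal. apply (bigO_weaken 0 (p * (2 * k + 1) + 0)); [lia|].
    apply (bigO_mult _ 0); [apply bigO_shift_scale|apply Ha]. }
  pose proof (bigO_plus _ _ _ H (bigO_plus _ _ _ (bigO_const 1) (bigO_plus _ _ _ (Hb' 1%nat 1%nat
    1) (bigO_plus _ _ _ (Hb' 2%nat 2%nat (1 / 2)) (Hb' 3%nat 3%nat (1 / 6)))))) as HT.
  revert HT. apply bigO_eq. intros X M _ _. cbv zeta beta. unfold a, b'. field. }
(* Terms with [b ^ 4] or [b ^ 6] have order at least [8 k + 4], which is at least [4 k + 6] because
   [k >= 1]. *)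
assert (Hq : forall p i j q, (4 <= p)%nat -> bigO (4 * k + 6) (fun X M => q * (b X M ^ p * (a i X
  M * a j X M)))).
{ intros p i j q Hpp. apply bigO_scal. apply (bigO_weaken _ (p * (2 * k + 1) + (0 + 0))); [nia|].
  apply (bigO_mult _ (0 + 0)); [apply Hb|]. now apply bigO_mult. }
assert (H1 : bigO (4 * k + 6) (fun X M => ep X M * twisted_ratio k (- d) X M)).
{ apply (bigO_weaken _ (4 * (2 * k + 1) + 0)); [lia|]. now apply bigO_mult. }
assert (H2 : bigO (4 * k + 6) (fun X M => em X M * (twisted_ratio k d X M + -1 * ep X M))).
{ apply (bigO_weaken _ (4 * (2 * k + 1) + 0)); [lia|]. apply bigO_mult; [easy|].
  apply bigO_plus; [apply HR|]. apply bigO_scal.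
  apply (bigO_weaken 0 (4 * (2 * k + 1))); [lia|easy]. }
assert (H3 : bigO (4 * k + 6) (fun X M => b X M ^ 2 * (a 2%nat X M - a 1%nat X M ^ 2
    - (- / ((al + 1) * c) + (al + 3) / (2 * (al + 1) * c ^ 2) * / X)))).
{ apply (bigO_weaken _ (2 * (2 * k + 1) + 4)); [lia|].
  apply bigO_mult; [apply Hb|]. now apply saddle_const_variance. }
pose proof (bigO_plus _ _ _ (bigO_plus _ _ _ H1 H2) (bigO_plus _ _ _ H3
  (bigO_plus _ _ _ (Hq 4%nat 2%nat 2%nat (1 / 4) ltac:(lia)) (bigO_plus _ _ _ (Hq 4%nat 1%nat
    3%nat (- (1 / 3)) ltac:(lia))
   (Hq 6%nat 3%nat 3%nat (- (1 / 36)) ltac:(lia)))))) as HT.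
revert HT. apply bigO_eq. intros X M HX _. cbv beta. unfold ep, em, b.
set (V := - / ((al + 1) * c) + (al + 3) / (2 * (al + 1) * c ^ 2) * / X). field.
Qed.

(** * The asymptotic ratio *)

Lemma twisted_moment_fourier (k : nat) (c X : R) (M : nat) (n d : Z) : 0 < X ->
  IZR n = c * X ^ S k -> twisted_moment k c (IZR d) X M = fourier_coef k X M (n + d).
Proof.
intros HX Hn. unfold twisted_moment, fourier_coef. apply RInt_ext. intros Y _.
assert (Hs : 0 < sqrt X) by now apply sqrt_lt_R0.
assert (HXk : 0 < X ^ k) by now apply pow_lt.
unfold weight. rewrite Cmult_assoc, cis_plus.
replace (shift_scale k (IZR d) X * Y + c * sqrt X * Y) with (IZR (n + d) / X ^ S k * sqrt X * Y);
  [easy|].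
rewrite plus_IZR, Hn. unfold shift_scale.
rewrite pow_add, pow_1, pow_mult, inv_sqrt_sqr, pow_inv by easy.
rewrite (inv_sqrt_div X HX). cbn [pow]. field. lra.
Qed.

Lemma moment0_fourier (k : nat) (c X : R) (M : nat) (n : Z) : 0 < X ->
  IZR n = c * X ^ S k -> moment k c X M 0 = fourier_coef k X M n.
Proof.
intros HX Hn. unfold moment, fourier_coef. apply RInt_ext. intros Y _.
assert (HXk : 0 < X ^ S k) by now apply pow_lt.
replace (IZR n / X ^ S k) with c by (rewrite Hn; field; lra).
rewrite pow_O. apply Rmult_1_l.
Qed.

Lemma euler_product_pos (k : nat) (X : R) (M : nat) : 0 < X -> 0 < euler_product k X M.
Proof.
intros HX. unfold euler_product. induction M as [|M IH]; cbn [rprod]; [lra|].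
apply Rmult_lt_0_compat; [easy|]. pose proof (part_ratio_bounds k X M HX). lra.
Qed.

Lemma Rpower_neg_le (x y u : R) : 0 < x <= y -> 0 <= u -> Rpower y (- u) <= Rpower x (- u).
Proof.
intros Hxy Hu. rewrite !Rpower_Ropp. apply Rinv_le_contravar; [apply exp_pos|].
apply Rle_Rpower_l; lra.
Qed.

(** Mean value theorem; [y >= 1 + 2 * |h|] keeps the segment between [y] and [y + h] above [y / 2],
    which accounts for the power of [/ 2] in the constant. *)
Lemma Rpower_shift (s h : R) : 0 < s -> exists K Y0, 0 <= K /\ 1 <= Y0 /\ forall y, Y0 <= y ->
  Rabs (Rpower (y + h) (- s) - Rpower y (- s)) <= K * Rpower y (- (s + 1)).
Proof.
intros Hs. exists (s * Rpower (/ 2) (- (s + 1)) * Rabs h), (1 + 2 * Rabs h).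
pose proof (Rabs_pos h) as Hh0.
assert (Hp : 0 < Rpower (/ 2) (- (s + 1))) by apply exp_pos.
split; [repeat apply Rmult_le_pos; lra|]. split; [lra|].
intros y Hy. assert (Hh : - (y / 2) <= h <= y / 2) by (apply Rabs_le_between; lra).
destruct (MVT_gen (fun u => Rpower u (- s)) y (y + h) (fun u => - s * Rpower u (- s - 1))) as [xi
  [Hxi HE]].
- intros u Hu. apply is_derive_Reals, derivable_pt_lim_power.
  assert (y / 2 <= Rmin y (y + h)) by (apply Rmin_glb; lra). lra.
- intros u Hu. assert (y / 2 <= Rmin y (y + h)) by (apply Rmin_glb; lra).
  apply derivable_continuous_pt. exists (- s * Rpower u (- s - 1)).
  apply derivable_pt_lim_power. lra.
- assert (y / 2 <= Rmin y (y + h)) by (apply Rmin_glb; lra).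
  rewrite HE. replace (y + h - y) with h by ring. rewrite Rabs_mult.
  replace (s * Rpower (/ 2) (- (s + 1)) * Rabs h * Rpower y (- (s + 1)))
    with (s * (Rpower (/ 2) (- (s + 1)) * Rpower y (- (s + 1))) * Rabs h) by ring.
  apply Rmult_le_compat_r; [easy|].
  rewrite Rabs_mult, Rabs_Ropp, (Rabs_pos_eq s) by lra.
  rewrite Rabs_pos_eq by (left; apply exp_pos).
  apply Rmult_le_compat_l; [lra|]. rewrite Rpower_mult_distr by lra.
  replace (- s - 1) with (- (s + 1)) by ring.
  apply Rpower_neg_le; lra.
Qed.

Lemma Rpower_neg_exponent_le (y u v : R) : 1 <= y -> u <= v -> Rpower y (- v) <= Rpower y (- u).
Proof. intros Hy Huv. apply Rle_Rpower; lra. Qed.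

Lemma exp_tilt (u v w : R) : u + v = 2 * w -> exp (- u) * exp (- v) = exp (- w) ^ 2.
Proof.
intros H. simpl. rewrite Rmult_1_r, <- !exp_plus. f_equal. lra.
Qed.

(** The normalisation is common to the three coefficients, and the tilts at [n + d] and [n - d]
    multiply to the square of the tilt at [n]. Positivity of the zeroth moment provides
    [p n <> 0]. *)
Lemma ratio_fourier (k : nat) (p : Z -> R) (X : R) (M : nat) (n d : Z) : (1 <= k)%nat -> 0 < X ->
  (forall nu, (nu <= Z.of_nat M)%Z -> fourier_coef k X M nu
     = 2 * half_period k X * euler_product k X M * exp (- (IZR nu / X ^ k)) * p nu) ->
  (n + d <= Z.of_nat M)%Z -> (n - d <= Z.of_nat M)%Z ->
  IZR n = saddle_const k 0 * X ^ S k -> 0 < moment k (saddle_const k 0) X M 0 ->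
  p (n + d)%Z * p (n - d)%Z / p n ^ 2 = twisted_ratio k (IZR d) X M * twisted_ratio k (- IZR d) X M.
Proof.
intros Hk HX Hp Hd1 Hd2 Hn Hm. unfold twisted_ratio. rewrite <- opp_IZR.
rewrite !(twisted_moment_fourier k _ X M n) by easy.
rewrite (moment0_fourier k _ X M n) in Hm |- * by easy.
replace (n + - d)%Z with (n - d)%Z by lia.
rewrite !Hp by lia. rewrite Hp in Hm by lia.
pose proof (half_period_pos k X HX). pose proof (euler_product_pos k X M HX).
assert (HXk : 0 < X ^ k) by now apply pow_lt.
assert (Htilt := exp_tilt (IZR (n + d) / X ^ k) (IZR (n - d) / X ^ k) (IZR n / X ^ k)).
rewrite plus_IZR, minus_IZR in Htilt |- *. specialize (Htilt ltac:(field; lra)).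
set (E1 := exp (- ((IZR n + IZR d) / X ^ k))) in *.
set (E2 := exp (- ((IZR n - IZR d) / X ^ k))) in *.
pose proof (exp_pos (- (IZR n / X ^ k))) as HE.
set (E := exp (- (IZR n / X ^ k))) in *.
set (G := 2 * half_period k X * euler_product k X M) in *.
assert (HG : 0 < G) by (apply Rmult_lt_0_compat; lra).
assert (Hpn : p n <> 0).
{ intros H1. rewrite H1 in Hm. lra. }
replace (G * E1 * p (n + d)%Z / (G * E * p n) * (G * E2 * p (n - d)%Z / (G * E * p n)))
  with (E1 * E2 / E ^ 2 * (p (n + d)%Z * p (n - d)%Z / p n ^ 2)) by (field; lra).
rewrite Htilt. field. lra.
Qed.

Lemma ratio_asymptotic (k : nat) (p : Z -> R) (h : R) (d : Z) : (1 <= k)%nat ->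
  (forall X M nu, 0 < X -> (nu <= Z.of_nat M)%Z -> fourier_coef k X M nu
     = 2 * half_period k X * euler_product k X M * exp (- (IZR nu / X ^ k)) * p nu) ->
  exists (K : R) (N : Z), forall n : Z, (N <= n)%Z ->
    Rabs (p (n + d)%Z * p (n - d)%Z / p n ^ 2
          - (1
             - (1 - / (INR k + 1)) * Rpower (saddle_const k 0) (INR k / (INR k + 1)) * IZR d ^ 2
               / Rpower (IZR n + h) (2 - / (INR k + 1))
             + (3 / 2 - / (INR k + 1)) * IZR d ^ 2
               / (IZR n + h) ^ 2))
    <= K * / Rpower (IZR n) (2 + / (INR k + 1)).
Proof.
intros Hk Hp. set (c := saddle_const k 0).
assert (Hc : 0 < c) by now apply saddle_const0_pos.
assert (Hkk : 1 <= INR k) by (apply (le_INR 1); lia).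
set (be := / (INR k + 1)).
assert (Hbe : 0 < be <= / 2).
{ unfold be. split; [apply Rinv_0_lt_compat; lra|apply Rinv_le_contravar; lra]. }
destruct (twisted_ratio_product k (IZR d) Hk) as [K0 [X0 [HK0 [HX0 Hprod]]]].
destruct (moment0_lower k Hk) as [lb [X1 [Hlb [HX1 Hlow]]]].
destruct (Rpower_shift (2 - be) h ltac:(lra)) as [K1 [Y1 [HK1 [HY1 Hsh1]]]].
destruct (Rpower_shift 2 h ltac:(lra)) as [K2 [Y2 [HK2 [HY2 Hsh2]]]].
set (r := Rpower c be). assert (Hr : 0 < r) by apply exp_pos.
set (D1 := (1 - be) * Rpower c (INR k / (INR k + 1)) * IZR d ^ 2).
set (D2 := (3 / 2 - be) * IZR d ^ 2).
set (X2 := X0 + X1).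
assert (HX2c : 0 < c * X2 ^ S k) by (apply Rmult_lt_0_compat; [easy|apply pow_lt; unfold X2; lra]).
exists (K0 * (r * c ^ 2) + Rabs D1 * K1 + Rabs D2 * K2),
  (up (Y1 + Y2 + 2 * Rabs h + c * X2 ^ S k)).
intros n Hn.
assert (HnR : Y1 + Y2 + 2 * Rabs h + c * X2 ^ S k < IZR n).
{ eapply Rlt_le_trans; [apply archimed|]. now apply IZR_le. }
pose proof (Rabs_pos h) as Hh.
assert (Hnh : 0 < IZR n + h).
{ assert (- Rabs h <= h) by (pose proof (Rle_abs (- h)); rewrite Rabs_Ropp in H; lra). lra. }
set (X := kth_root (S k) (IZR n / c)).
assert (HX0' : 0 < X) by apply kth_root_pos.
assert (Hnc : 0 < IZR n / c) by (apply Rdiv_lt_0_compat; lra).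
assert (HXS : X ^ S k = IZR n / c) by (apply kth_root_pow; [lia|easy]).
assert (HnX : IZR n = c * X ^ S k) by (rewrite HXS; field; lra).
assert (HXX2 : X2 <= X).
{ left. apply kth_root_gt; [lia|easy|]. apply Rmult_lt_reg_l with c; [easy|].
  replace (c * (IZR n / c)) with (IZR n) by (field; lra). lra. }
assert (HX1' : 1 <= X) by (unfold X2 in HXX2; lra).
(* [M] must exceed [X ^ 3] for the asymptotics and both [n + d] and [n - d] for the truncation to
   lose no partition. *)
set (M := (Z.to_nat (up (X ^ 3)) + Z.to_nat (n + Z.abs d))%nat).
assert (Hup : 0 <= IZR (up (X ^ 3))).
{ pose proof (archimed (X ^ 3)). pose proof (pow_le X 3 ltac:(lra)). lra. }
apply le_IZR in Hup.
assert (HM : X ^ 3 <= INR M).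
{ apply Rle_trans with (IZR (up (X ^ 3))); [pose proof (archimed (X ^ 3)); lra|].
  rewrite INR_IZR_INZ. apply IZR_le. unfold M. lia. }
specialize (Hprod X M ltac:(unfold X2 in HXX2; lra) HM). fold c in Hprod.
specialize (Hlow X M ltac:(unfold X2 in HXX2; lra) HM).
rewrite (ratio_fourier k p X M n d Hk HX0' (fun nu => Hp X M nu HX0')
  ltac:(unfold M; lia) ltac:(unfold M; lia) HnX (Rlt_le_trans _ _ _ Hlb Hlow)).
set (R := twisted_ratio k (IZR d) X M * twisted_ratio k (- IZR d) X M) in *.
assert (HXk : 0 < X ^ k) by now apply pow_lt.
set (Z := X ^ k) in *.
assert (HnZ : IZR n = c * (X * Z)) by exact HnX.
assert (Hnbe : Rpower (IZR n) be = r * X).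
{ replace (IZR n) with (c * (IZR n / c)) by (field; lra).
  rewrite <- Rpower_mult_distr by easy. unfold X, kth_root, be. now rewrite S_INR. }
assert (Hn2 : Rpower (IZR n) 2 = IZR n ^ 2).
{ change 2 with (INR 2) at 1. apply Rpower_pow. lra. }
assert (Hn2b : Rpower (IZR n) (2 + be) = IZR n ^ 2 * (r * X)).
{ now rewrite Rpower_plus, Hn2, Hnbe. }
assert (Hn2m : Rpower (IZR n) (2 - be) = IZR n ^ 2 / (r * X)).
{ unfold Rminus. rewrite Rpower_plus, Hn2, Rpower_Ropp, Hnbe. reflexivity. }
assert (Hck : Rpower c (INR k / (INR k + 1)) = c / r).
{ replace (INR k / (INR k + 1)) with (1 + - be) by (unfold be; field; lra).
  rewrite Rpower_plus, Rpower_1, Rpower_Ropp by easy. reflexivity. }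
assert (Hb2 : shift_scale k (IZR d) X ^ 2 = IZR d ^ 2 / (X * Z ^ 2)).
{ unfold shift_scale. rewrite Rpow_mult_distr, <- pow_mult.
  replace ((2 * k + 1) * 2)%nat with (2 * (2 * k + 1))%nat by lia.
  rewrite (pow_mult (/ sqrt X)), inv_sqrt_sqr, pow_inv by easy.
  unfold Rdiv. do 2 f_equal. unfold Z. rewrite pow_add, pow_1, <- pow_mult, (Nat.mul_comm k 2).
  ring. }
(* An exact identity: with [n = c * X ^ (k + 1)], the two terms of the variance are the two main
   terms before the shift by [h]. *)
assert (Hmain : 1 + shift_scale k (IZR d) X ^ 2 * (- / ((/ INR k + 1) * c) + (/ INR k + 3) / (2 *
  (/ INR k + 1) * c ^ 2) * / X)
   = 1 - D1 / Rpower (IZR n) (2 - be) + D2 / Rpower (IZR n) 2).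
{ rewrite Hb2, Hn2m, Hn2. unfold D1, D2. rewrite Hck, HnZ. unfold be. field. repeat split; lra. }
assert (He : (/ sqrt X) ^ (4 * k + 6) = r * c ^ 2 * Rpower (IZR n) (- (2 + be))).
{ rewrite Rpower_Ropp, Hn2b, HnZ. replace (4 * k + 6)%nat with (2 * (2 * k + 3))%nat by lia.
  rewrite pow_mult, inv_sqrt_sqr, pow_inv by easy. rewrite pow_add.
  replace (X ^ (2 * k)) with (Z ^ 2) by (unfold Z; rewrite <- pow_mult; f_equal; lia). field. lra. }
rewrite Hmain, He in Hprod.
specialize (Hsh1 (IZR n) ltac:(lra)). specialize (Hsh2 (IZR n) ltac:(lra)).
(* Here [be <= 1 / 2] is used: the cost of the shift, of exponent [3 - be], is within the error of
   exponent [2 + be]. For [k = 1] the two exponents coincide. *)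
assert (HQ1 := Rpower_neg_exponent_le (IZR n) (2 + be) (2 - be + 1) ltac:(lra) ltac:(lra)).
assert (HQ2 := Rpower_neg_exponent_le (IZR n) (2 + be) (2 + 1) ltac:(lra) ltac:(lra)).
rewrite <- Rpower_Ropp. set (Q := Rpower (IZR n) (- (2 + be))) in *.
assert (Hnh2 : (IZR n + h) ^ 2 = Rpower (IZR n + h) 2).
{ symmetry. change 2 with (INR 2) at 1. now apply Rpower_pow. }
fold D1 D2. rewrite Hnh2. unfold Rdiv. rewrite <- !Rpower_Ropp.
unfold Rdiv in Hprod. rewrite <- !Rpower_Ropp in Hprod.
set (U1 := Rpower (IZR n + h) (- (2 - be))) in *. set (V1 := Rpower (IZR n) (- (2 - be))) in *.
set (U2 := Rpower (IZR n + h) (- (2))) in *. set (V2 := Rpower (IZR n) (- (2))) in *.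
replace (R - (1 - D1 * U1 + D2 * U2)) with ((R - (1 - D1 * V1 + D2 * V2)) + D1 * (U1 - V1) + - D2
  * (U2 - V2)) by ring.
eapply Rle_trans; [apply Rabs_triang|]. eapply Rle_trans; [apply Rplus_le_compat_r, Rabs_triang|].
rewrite !Rabs_mult, Rabs_Ropp.
pose proof (Rabs_pos D1). pose proof (Rabs_pos D2).
assert (B1 : Rabs D1 * Rabs (U1 - V1) <= Rabs D1 * (K1 * Q)).
{ apply Rmult_le_compat_l; [easy|]. eapply Rle_trans; [apply Hsh1|]. now apply Rmult_le_compat_l. }
assert (B2 : Rabs D2 * Rabs (U2 - V2) <= Rabs D2 * (K2 * Q)).
{ apply Rmult_le_compat_l; [easy|]. eapply Rle_trans; [apply Hsh2|]. now apply Rmult_le_compat_l. }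
lra.
Qed.

(** * Counting partitions *)

Module PartitionCount.
From mathcomp Require Import all_boot all_algebra.

Definition power_multiset_count (k A B n : nat) : nat :=
  #|[set f : {ffun 'I_A -> 'I_B.+1} | (\sum_(i < A) f i * i.+1 ^ k == n)%N]|.

(** The Euler product truncated in parts and multiplicities. Being a polynomial, it turns the
    removal of the largest part into the splitting off of one factor. *)
Definition power_poly (k A B : nat) : {poly int} :=
  (\prod_(i < A) \sum_(j < B.+1) 'X^(j * i.+1 ^ k)%N)%R.

(** Distributing the product over the inner sums produces one monomial for each choice of
    multiplicities. *)
Lemma power_multiset_count_coef (k A B n : nat) :
  ((power_poly k A B)`_n)%R = Posz (power_multiset_count k A B n).
Proof.
rewrite /power_poly bigA_distr_bigA /= coef_sum.
rewrite /power_multiset_count -sum1_card -natz GRing.natr_sum [RHS]big_mkcond /=.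
apply: eq_bigr => f _.
by rewrite -GRing.expr_sum coefXn inE eq_sym; case: (_ == n).
Qed.

Lemma power_multiset_count_0 (k B n : nat) :
  power_multiset_count k 0 B n = if n is 0 then 1%N else 0%N.
Proof.
have := power_multiset_count_coef k 0 B n.
by rewrite /power_poly big_ord0 coef1 => /esym; case: n => [|n] [] ->.
Qed.

Lemma power_multiset_count_S (k A B n : nat) :
  power_multiset_count k A.+1 B n = (\sum_(j < B.+1)
    if n < j * A.+1 ^ k then 0 else power_multiset_count k A B (n - j * A.+1 ^ k))%N.
Proof.
apply/eqP; rewrite -eqz_nat -power_multiset_count_coef /power_poly big_ord_recr /=.
rewrite GRing.mulr_sumr coef_sum -[X in _ == X]natz GRing.natr_sum; apply/eqP.
apply: eq_bigr => j _; rewrite coefMXn; case: ifP => // _.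
by rewrite (power_multiset_count_coef k A B) natz.
Qed.

Lemma INR_big_ord (F : nat -> nat) (n : nat) :
  INR (\sum_(j < n) F j)%N = rsum (fun j => INR (F j)) n.
Proof.
elim: n => [|n IH]; first by rewrite big_ord0.
by rewrite big_ord_recr /= plus_INR IH.
Qed.

Lemma pk_power_multiset_count (k n : nat) : pk k (Z.of_nat n) = power_multiset_count k n n n.
Proof.
rewrite /pk Nat2Z.id /kth_power_partitions.
by case: Z.ltb_spec => // H; exfalso; lia.
Qed.

Lemma expn_pow (m k : nat) : expn m k = Nat.pow m k.
Proof. by elim: k => // k IH; rewrite expnS IH. Qed.

Lemma power_multiset_count_rsum (k A B n : nat) :
  INR (power_multiset_count k A.+1 B n) = rsum (fun j =>
    if Nat.ltb n (j * Nat.pow A.+1 k) then 0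
    else INR (power_multiset_count k A B (n - j * Nat.pow A.+1 k))) B.+1.
Proof.
rewrite power_multiset_count_S (INR_big_ord (fun j => if (n < j * A.+1 ^ k)%N then 0%N
  else power_multiset_count k A B (n - j * A.+1 ^ k)%N)).
apply: rsum_ext => j _; rewrite expn_pow.
case: (Nat.ltb_spec n _) => H.
- by move/ltP: H => ->.
- by rewrite ifF //; apply/ltP; lia.
Qed.

End PartitionCount.

From mathcomp Require Import all_boot.
Import PartitionCount.

(** Counting is done with [n] parts and multiplicities at most [n], which matches [pk]; stability
    then raises the number of parts from [n] to [M]. For negative [nu] both sides vanish. *)
Lemma fourier_coef_pk (k : nat) (X : R) (M : nat) (nu : Z) : (1 <= k)%N -> 0 < X ->
  (nu <= Z.of_nat M)%Z -> fourier_coef k X M nu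
    = 2 * half_period k X * euler_product k X M * exp (- (IZR nu / X ^ k)) * INR (pk k nu).
Proof.
move=> /leP Hk HX HM.
case: (Z.ltb_spec nu 0) => Hnu.
  rewrite fourier_coef_neg // /pk; move/Z.ltb_lt: Hnu => ->; rewrite /=; ring.
have [n En] : exists n, nu = Z.of_nat n by exists (Z.to_nat nu); lia.
subst nu.
have Hstable := @fourier_coef_stable k X n M (Z.of_nat n) HX Hk (Z.le_refl _) ltac:(lia).
have H0 m : INR (power_multiset_count k 0 n m) = match m with O => 1 | _ => 0 end.
  by rewrite power_multiset_count_0; case: m.
have Hcount := @fourier_coef_count k n X (fun A m => INR (power_multiset_count k A n m)) HX
  H0 (fun A m => power_multiset_count_rsum k A n m) n n (le_n n).
have HEn := @euler_product_pos k X n HX.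
apply: (Rmult_eq_reg_r (euler_product k X n)); last lra.
rewrite Hstable Hcount pk_power_multiset_count -INR_IZR_INZ. ring.
Qed.

Theorem corollary5p7 (zeta : C -> C) (Hzeta : is_Riemann_zeta zeta)
    (k : nat) (Hk : (1 <= k)%N) (delta : Z) :
  exists (K : R) (N : Z), forall n : Z, (N <= n)%Z ->
    Rabs (INR (pk k (n + delta)) * INR (pk k (n - delta)) / INR (pk k n) ^ 2
          - (1
             - (1 - / (INR k + 1)) * a_coef zeta k * IZR delta ^ 2
               / Rpower (IZR n + h_coef zeta k) (2 - / (INR k + 1))
             + (3 / 2 - / (INR k + 1)) * IZR delta ^ 2
               / (IZR n + h_coef zeta k) ^ 2))
    <= K * / Rpower (IZR n) (2 + / (INR k + 1)).
Proof.
have Hk' := elimT leP Hk.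
rewrite /a_coef (c_coef_saddle_const zeta k Hzeta Hk').
apply: (@ratio_asymptotic k (fun nu => INR (pk k nu)) _ _ Hk') => X M nu HX HM.
exact: fourier_coef_pk.
Qed.
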